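(* Let $\phi$ be a flow on the Poincaré hemisphere $\mathcal{H}$ and let $S\subset\mathcal{E}$ be a closed invariant set of isolated invariant dynamical complement $S_{comp}$. Fix an isolating block $B$ for $S_{comp}$ and strong deformation retractions $r^{\pm}$ of $B^{\pm}$ onto subsets $b^{\pm}$ satisfying the injectivity condition (Inj), and let $\hat{\mathcal{H}}$ and $\hat\phi$ be the corresponding extended phase space and extended flow (all defined in the context). (a) Assume that there exist isolated invariant sets $R$ and $\hat I$ under $\hat\phi$ with $R\subset S_{comp}$ and $\hat I\supset R\cup b^-$, such that $(b^-,R)$ is an attractor-repeller decomposition of $\hat I$ (attractor $b^-$, repeller $R$), and suppose that $h(\hat I)\neq h(R)\vee h(b^-)$. Then there is a heteroclinic connection $R\to S$ in the original flow $\phi$ on $\mathcal{H}$; more precisely, there exists $x\in B$ such that, for $\phi$, $\alpha(x)\subset R$ and $\omega(x)\cap S\neq\emptyset$. (b) Assume that there exist isolated invariant sets $A$ and $\hat I$ under $\hat\phi$ with $A\subset S_{comp}$ and $\hat I\supset A\cup b^+$, such that $(A,b^+)$ is an attractor-repeller decomposition of $\hat I$ (attractor $A$, repeller $b^+$), and suppose that $h(\hat I)\neq h(A)\vee h(b^+)$. Then there is a heteroclinic connection $S\to A$ in the original flow $\phi$ on $\mathcal{H}$; more precisely, there exists $x\in B$ such that, for $\phi$, $\omega(x)\subset A$ and $\alpha(x)\cap S\neq\emptyset$.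
   Context: Poincaré hemisphere and flows. $X$ is a finite-dimensional real vector space with scalar product $\langle\cdot,\cdot\rangle$; $\mathcal{H}=\{(\chi,z)\in X\times\mathbb{R}:\langle\chi,\chi\rangle+z^2=1,\ z\ge 0\}$ is the Poincaré hemisphere and $\mathcal{E}=\{(\chi,0):\langle\chi,\chi\rangle=1\}$ its equator (boundary), called the sphere at infinity. A vector field $f:X\to X$ is normalizable if there is a continuous $\rho:[0,\infty)\to[0,\infty)$ with $\rho(z)\ne 0$ for $z\neq 0$ such that $(\chi,z)\mapsto\rho(z)\,z f(z^{-1}\chi)$ extends to a map $F$ on $\mathcal{H}$ that is Lipschitz continuous, even at $z=0$. A flow on $\mathcal{H}$ means the flow $\phi:\mathbb{R}\times\mathcal{H}\to\mathcal{H}$ of $\dot\chi=F-\langle F,\chi\rangle\chi$, $\dot z=-\langle F,\chi\rangle z$ for such an $F$; it leaves $\mathcal{E}$ invariant. Conventions. Closure, interior, boundary are relative to the phase space under consideration ($\mathcal{H}$ or $\hat{\mathcal{H}}$). $\alpha(x),\omega(x)$ are limit sets. Invariant means forward and backward invariant. A compact neighbourhood is a compact set $K$ with $K=cl(int\,K)$; $Inv(K)$ is the maximal invariant subset of $K$. A set is isolated invariant if it equals $Inv(K)$ and $Inv(K)\subset int(K)$ for some compact neighbourhood $K$ (an isolating neighbourhood). Dynamical complement. For a closed invariant set $S$, $S_{comp}:=\{x\in\mathcal{H}:\alpha(x)\cap S=\omega(x)\cap S=\emptyset\}$. $S$ is of isolated invariant dynamical complement if $S_{comp}$ is isolated invariant.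 Isolating block. An isolating block for $S_{comp}$ is a compact neighbourhood $B$ with $Inv(B)=S_{comp}$ such that for every $T>0$, $\{x\in B:\phi([-T,T],x)\subset B\}\subset int_{\mathcal{H}}(B)$, and such that the immediate exit set $B^-=\{x\in B:\phi([0,t],x)\not\subset B\ \forall t>0\}$ and the immediate entrance set $B^+=\{x\in B:\phi([-t,0],x)\not\subset B\ \forall t>0\}$ are closed; then $\partial_{\mathcal{H}}B=B^+\cup B^-$. Retractions. $r^{\pm}:[0,1]\times B^{\pm}\to B^{\pm}$ are continuous, $b^{\pm}\subset B^{\pm}$, with $r^{\pm}(0,x)=x$ for $x\in B^{\pm}$; $r^{\pm}(s,x)=x$ for $x\in b^{\pm}$, $s\in[0,1]$; $r^{\pm}(1,x)\in b^{\pm}$ for $x\in B^{\pm}$. Condition (Inj): for all $s\in[0,1)$ and $x_1,x_2\in B^{\pm}$, $r^{\pm}(s,x_1)=r^{\pm}(s,x_2)\Rightarrow x_1=x_2$. Extended phase space. $\beta^{\pm}:=\{(s,r^{\pm}(s,x)):s\in[0,1],x\in B^{\pm}\}$, and $\hat{\mathcal{H}}$ is the quotient of the disjoint union of $B,\beta^+,\beta^-$ by the equivalence relation generated by identifying each $(0,\xi)\in\beta^{\pm}$ with $\xi\in\partial_{\mathcal{H}}B$. $\hat{\mathcal{H}}$ is regarded as a (topological) manifold with boundary $\partial\hat{\mathcal{H}}$. By abuse of notation $b^{\pm}$ also denotes the subset $\{(1,r^{\pm}(1,x)):x\in B^{\pm}\}\subset\hat{\mathcal{H}}$; this is the meaning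 of $b^\pm$ in the hypotheses (a), (b). Extended flow. For $x\in B$ let $T_+(x)=\sup\{t\ge 0:\phi([0,t],x)\subset B\}\in[0,\infty]$ and $T_-(x)=\inf\{t\le 0:\phi([t,0],x)\subset B\}\in[-\infty,0]$. For $x\in B$: $\hat\phi(t,x)=\phi(t,x)$ if $t\in[T_-(x),T_+(x)]$; $\hat\phi(t,x)=(1-e^{T_+(x)-t},\,r^-(1-e^{T_+(x)-t},\phi(T_+(x),x)))\in\beta^-$ if $t\ge T_+(x)$; $\hat\phi(t,x)=(1-e^{t-T_-(x)},\,r^+(1-e^{t-T_-(x)},\phi(T_-(x),x)))\in\beta^+$ if $t\le T_-(x)$. For $(s,y)\in\beta^{\pm}$ with $s\in[0,1)$, let $Y^{\pm}(y)$ be the unique point of $B^{\pm}$ with $r^{\pm}(s,Y^{\pm}(y))=y$; put $\hat\phi(t,(s,y))=\hat\phi(t-\log(1-s),Y^-(y))$ for $(s,y)\in\beta^-$ and $\hat\phi(t,(s,y))=\hat\phi(t+\log(1-s),Y^+(y))$ for $(s,y)\in\beta^+$. Finally $\hat\phi(t,(1,y))=(1,y)$ for $(1,y)\in\beta^\pm$. Conley index for $\hat\phi$. An index pair for an isolated invariant set $Q\subset\hat{\mathcal{H}}$ is a pair of compact sets $N_1\subset N$ with (i) $cl(N\setminus N_1)$ an isolating neighbourhood for $Q$; (ii) for $x\in N_1$, $t>0$, $\hat\phi([0,t],x)\subseteq N$ implies $\hat\phi([0,t],x)\subseteq N_1$; (iii) if $x\in N$, $t_1>0$, $\hat\phi(t_1,x)\notin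 N$, there is $t_0\in[0,t_1]$ with $\hat\phi([0,t_0],x)\subseteq N$ and $\hat\phi(t_0,x)\in N_1$. With $*$ an additional universal point, $h(Q)$ is the triple of homotopy types of pointed spaces $h(\hat{\mathcal{H}};Q)=\left[\frac{N\cup\{*\}}{N_1\cup\{*\}}\right]$, $h(\hat{\mathcal{H}},\partial\hat{\mathcal{H}};Q)=\left[\frac{N\cup\{*\}}{N_1\cup(N\cap\partial\hat{\mathcal{H}})\cup\{*\}}\right]$, $h(\partial\hat{\mathcal{H}};Q)=\left[\frac{(N\cap\partial\hat{\mathcal{H}})\cup\{*\}}{(N_1\cap\partial\hat{\mathcal{H}})\cup\{*\}}\right]$. The wedge $\vee$ is taken componentwise, and $h(\hat I)\ne h(R)\vee h(b^-)$ means that the triples differ (in at least one component). Attractor-repeller decomposition. $(A,R)$ is an attractor-repeller decomposition of a compact invariant set $\hat I$ if $A$ is an attractor for $\hat\phi|_{\hat I}$ (the $\omega$-limit set of one of its neighbourhoods in $\hat I$) and $R$ is the dual repeller $R=\{x\in\hat I:\omega(x)\cap A=\emptyset\}$.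
   Formalization: In the definition of an index pair (N, N_1) for Q, the condition that Q and N_1 are disjoint is added; without it h(Q) is not well defined (for an attracting fixed point 0 in N=[-1,1], both N_1 empty and N_1={0} would be allowed and give different indices). *)

(* Defs.v *)
From HB Require Import structures.
From Stdlib Require Import Relation_Operators.
From mathcomp Require Import all_boot all_order all_algebra.
From mathcomp Require Import generic_quotient sesquilinear.
From mathcomp Require Import all_classical all_reals all_analysis homotopy.

Set Implicit Arguments.
Unset Strict Implicit.
Unset Printing Implicit Defensive.

Import Order.TTheory GRing.Theory Num.Theory.
Import numFieldNormedType.Exports.

Local Open Scope classical_set_scope.
Local Open Scope ring_scope.
Local Open Scope quotient_scope.

(* * Dynamics on a topological space *)

Section Dynamics.
Context {R : realType} {T : topologicalType} (phi : R -> T -> T).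
Implicit Types (x : T) (A K Q U N : set T).

Definition is_flow :=
  [/\ continuous (fun p : R * T => phi p.1 p.2),
      forall x, phi 0 x = x
    & forall s t x, phi (s + t) x = phi s (phi t x)].

Definition orb (J : set R) x : set T := [set phi t x | t in J].

Definition flow_invariant A := forall t x, A x -> A (phi t x).

Definition Inv K : set T := \bigcup_(A in [set A | flow_invariant A /\ A `<=` K]) A.

Definition compact_neighbourhood K := compact K /\ K = closure (interior K).

Definition isolating_neighbourhood K Q :=
  [/\ compact_neighbourhood K, Q = Inv K & Inv K `<=` interior K].

Definition isolated_invariant Q := exists K, isolating_neighbourhood K Q.

Definition omega_set U : set T :=
  \bigcap_(s in [set: R]) closure (\bigcup_(x in U) orb `[s, +oo[ x).

Definition omega x : set T := omega_set [set x].

Definition alpha x : set T :=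
  \bigcap_(s in [set: R]) closure (orb `]-oo, s] x).

Definition dyn_complement (S : set T) : set T :=
  [set x | alpha x `&` S = set0 /\ omega x `&` S = set0].

Definition exit_set (B : set T) : set T :=
  [set x | B x /\ forall t, 0 < t -> ~ (orb `[0, t] x `<=` B)].

Definition entrance_set (B : set T) : set T :=
  [set x | B x /\ forall t, 0 < t -> ~ (orb `[- t, 0] x `<=` B)].

Definition isolating_block (B Q : set T) :=
  [/\ compact_neighbourhood B,
      Inv B = Q,
      forall t, 0 < t -> [set x | B x /\ orb `[- t, t] x `<=` B] `<=` interior B,
      closed (exit_set B)
    & closed (entrance_set B)].

Definition attractor_in (I A : set T) :=
  exists U, [/\ U `<=` I,
    exists V, [/\ open V, A `<=` V & V `&` I `<=` U] & A = omega_set U].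

Definition attractor_repeller (I A Q : set T) :=
  [/\ compact I, flow_invariant I, A `<=` I, attractor_in I A
    & Q = [set x | I x /\ omega x `&` A = set0]].

(* The clause [Q `&` N1 = set0] makes Q a subset of the interior of [N `\` N1].
   Asking only that [closure (N `\` N1)] isolate Q would not determine the
   index: for an attracting fixed point 0 in a segment N, both N1 = set0 and
   N1 = [set 0] would be admitted. *)
Definition index_pair Q N N1 :=
  [/\ [/\ compact N, compact N1 & N1 `<=` N],
      isolating_neighbourhood (closure (N `\` N1)) Q,
      Q `&` N1 = set0,
      forall x t, N1 x -> 0 < t -> orb `[0, t] x `<=` N -> orb `[0, t] x `<=` N1
    & forall x t1, N x -> 0 < t1 -> ~ N (phi t1 x) ->
      exists t0, [/\ 0 <= t0 <= t1, orb `[0, t0] x `<=` N & N1 (phi t0 x)]].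

End Dynamics.

(* * Pointed spaces *)

HB.instance Definition _ := hasNbhs.Build unit principal_filter.
HB.instance Definition _ := Discrete_ofNbhs.Build unit erefl.

Section PairQuotient.
Context {T : topologicalType} (P Q : set T).

(* The disjoint union of P and of a point *, which is [star]. *)
Definition with_point : topologicalType :=
  {b : bool & (if b return topologicalType then set_type P else unit)}.

Definition star : with_point := existT _ false tt.

(* The subset Q u {*} of P u {*}. *)
Definition collapsed : set with_point :=
  [set a | match a with
           | existT true p => Q (set_val p)
           | existT false _ => True
           end].

Let rel0 (a b : with_point) : bool :=
  (a == b) || ((a \in collapsed) && (b \in collapsed)).

Local Lemma rel0_refl : reflexive rel0.
Proof. by move=> a; rewrite /rel0 eqxx. Qed.

Local Lemma rel0_sym : symmetric rel0.
Proof. by move=> a b; rewrite /rel0 eq_sym andbC. Qed.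

Local Lemma rel0_trans : transitive rel0.
Proof.
move=> b a d /predU1P[->//|/andP[aC bC]] /predU1P[<-|/andP[_ dC]].
  by rewrite /rel0 aC bC orbT.
by rewrite /rel0 aC dC orbT.
Qed.

Definition collapse_rel := EquivRel _ rel0_refl rel0_sym rel0_trans.

Definition pair_quotient := {eq_quot collapse_rel}.

HB.instance Definition _ :=
  Topological.copy pair_quotient (quotient_topology pair_quotient).
HB.instance Definition _ := Quotient.on pair_quotient.
HB.instance Definition _ := isPointed.Build pair_quotient (\pi_pair_quotient star).

End PairQuotient.

Section HomotopyType.
Context (R : realType).

Definition pointed_homotopic (Y Z : ptopologicalType) (f g : Y -> Z) :=
  exists h : R -> Y -> Z,
    [/\ {within `[0, 1] `*` [set: Y], continuous (fun p : R * Y => h p.1 p.2)},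
        h 0 = f, h 1 = g & forall s, 0 <= s <= 1 -> h s point = point].

Definition same_homotopy_type (Y Z : ptopologicalType) :=
  exists (f : Y -> Z) (g : Z -> Y),
    [/\ continuous f /\ f point = point, continuous g /\ g point = point,
        pointed_homotopic (g \o f) idfun & pointed_homotopic (f \o g) idfun].

End HomotopyType.

Definition wedge2 (Y Z : ptopologicalType) : ptopologicalType :=
  pwedge (fun b : bool => if b then Y else Z).

Record space_triple := SpaceTriple {
  sp_total : ptopologicalType;
  sp_relative : ptopologicalType;
  sp_boundary : ptopologicalType }.

Definition wedge_triple (a b : space_triple) :=
  SpaceTriple (wedge2 (sp_total a) (sp_total b))
              (wedge2 (sp_relative a) (sp_relative b))
              (wedge2 (sp_boundary a) (sp_boundary b)).

Definition same_homotopy_types (R : realType) (a b : space_triple) :=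
  [/\ same_homotopy_type R (sp_total a) (sp_total b),
      same_homotopy_type R (sp_relative a) (sp_relative b)
    & same_homotopy_type R (sp_boundary a) (sp_boundary b)].

(* * Boundary of a topological manifold *)

Definition homeomorphic (Y Z : topologicalType) :=
  exists (f : Y -> Z) (g : Z -> Y),
    [/\ continuous f, continuous g, cancel f g & cancel g f].

(* The points of M without a neighbourhood homeomorphic to an open set of the
   model space X. *)
Definition manifold_boundary (X M : topologicalType) : set M :=
  [set q | ~ exists (U : set M) (V : set X),
     [/\ open U, U q, open V & homeomorphic (set_type U) (set_type V)]].

Arguments manifold_boundary : clear implicits.

(* * Conley index *)

Section ConleyIndex.
Context {R : realType} {M : topologicalType} (bd : set M) (psi : R -> M -> M).

Definition index_triple (N N1 : set M) :=
  SpaceTriple (pair_quotient N N1)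
              (pair_quotient N (N1 `|` (N `&` bd)))
              (pair_quotient (N `&` bd) (N1 `&` bd)).

(* h(I) <> h(Q1) v h(Q2), the indices being computed from index pairs. *)
Definition index_neq_wedge (I Q1 Q2 : set M) :=
  exists N N1 K K1 L L1,
    [/\ index_pair psi I N N1, index_pair psi Q1 K K1, index_pair psi Q2 L L1
      & ~ same_homotopy_types R (index_triple N N1)
            (wedge_triple (index_triple K K1) (index_triple L L1))].

End ConleyIndex.

(* * Poincare hemisphere *)

Section Hemisphere.
Context {R : realType} {X : normedModType R} (ip : {dot X for idfun}).

(* X is a Euclidean space: finite-dimensional, and normed by its scalar
   product. *)
Definition euclidean_space :=
  (exists n (e : 'I_n -> X), forall x, exists c : 'I_n -> R,
     x = \sum_i c i *: e i) /\
  (forall x : X, `|x| = Num.sqrt (ip x x)).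

Definition hemisphere : set (X * R) :=
  [set p | ip p.1 p.1 + p.2 ^+ 2 = 1 /\ 0 <= p.2].

Definition hemi : topologicalType := set_type hemisphere.

Definition hemi_val (x : hemi) : X * R := set_val x.

Definition equator : set hemi := [set x | (hemi_val x).2 = 0].

(* F, of which only the values on the hemisphere matter, is the Lipschitz
   extension which witnesses that f is normalizable. *)
Definition normalization (f : X -> X) (F : X * R -> X) :=
  (exists rho : R -> R,
    [/\ {within `[0, +oo[, continuous rho},
        forall z, 0 <= z -> 0 <= rho z,
        forall z, 0 <= z -> z != 0 -> rho z != 0
      & forall p, hemisphere p -> p.2 != 0 ->
          F p = (rho p.2 * p.2) *: f (p.2^-1 *: p.1)]) /\
  [lipschitz F p | p in hemisphere].

Definition poincare_flow (phi : R -> hemi -> hemi) :=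
  is_flow phi /\
  exists (f : X -> X) (F : X * R -> X), normalization f F /\
    forall (x : hemi) (t : R), let p := hemi_val (phi t x) in
      is_derive (t : R^o) 1 (fun s => (hemi_val (phi s x)).1)
                (F p - ip (F p) p.1 *: p.1) /\
      is_derive (t : R^o) 1 (fun s => (hemi_val (phi s x)).2 : R^o)
                (- (ip (F p) p.1 * p.2)).

End Hemisphere.

Arguments equator {R X} ip.

(* * Extended phase space and extended flow *)

Definition retraction {R : realType} {T : topologicalType}
    (r : R -> T -> T) (C b : set T) :=
  [/\ {within `[0, 1] `*` C, continuous (fun p : R * T => r p.1 p.2)},
      forall s x, 0 <= s <= 1 -> C x -> C (r s x),
      b `<=` C /\ (forall x, C x -> r 0 x = x),
      forall s x, 0 <= s <= 1 -> b x -> r s x = x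
    & forall x, C x -> b (r 1 x)].

Definition retraction_inj {R : realType} {T : topologicalType}
    (r : R -> T -> T) (C : set T) :=
  forall s x1 x2, 0 <= s < 1 -> C x1 -> C x2 -> r s x1 = r s x2 -> x1 = x2.

Section Extension.
Context {R : realType} {T : topologicalType} (phi : R -> T -> T) (B : set T)
  (rp rm : R -> T -> T).

Local Notation Bp := (entrance_set phi B).
Local Notation Bm := (exit_set phi B).

Definition mapping_graph (r : R -> T -> T) (C : set T) : set (R * T) :=
  [set p | exists s x, [/\ 0 <= s <= 1, C x & p = (s, r s x)]].

Definition beta_p := mapping_graph rp Bp.
Definition beta_m := mapping_graph rm Bm.

(* None is the index of B, Some true that of beta^+, Some false that of
   beta^-. *)
Definition piece (i : option bool) : topologicalType :=
  match i with
  | None => set_type B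
  | Some true => set_type beta_p
  | Some false => set_type beta_m
  end.

Definition pieces : topologicalType := {i : option bool & piece i}.

Definition in_B (x : set_type B) : pieces := existT piece None x.
Definition in_p (p : set_type beta_p) : pieces := existT piece (Some true) p.
Definition in_m (p : set_type beta_m) : pieces := existT piece (Some false) p.

Inductive glue : pieces -> pieces -> Prop :=
| glue_p (p : set_type beta_p) (x : set_type B) :
    set_val p = (0, set_val x) -> glue (in_p p) (in_B x)
| glue_m (p : set_type beta_m) (x : set_type B) :
    set_val p = (0, set_val x) -> glue (in_m p) (in_B x).

Let glued (a b : pieces) : bool := `[< clos_refl_sym_trans pieces glue a b >].

Local Lemma glued_refl : reflexive glued.
Proof. by move=> a; apply/asboolP/rst_refl. Qed.

Local Lemma glued_sym : symmetric glued.
Proof. by move=> a b; apply/asboolP/asboolP => ?; apply: rst_sym. Qed.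

Local Lemma glued_trans : transitive glued.
Proof.
by move=> b a d /asboolP ab /asboolP bd; apply/asboolP/(rst_trans _ _ _ b).
Qed.

Definition glue_rel := EquivRel _ glued_refl glued_sym glued_trans.

Definition hatH := {eq_quot glue_rel}.

HB.instance Definition _ := Topological.copy hatH (quotient_topology hatH).
HB.instance Definition _ := Quotient.on hatH.

Definition hat_set (A : set T) : set hatH :=
  [set q | exists x : set_type B, A (set_val x) /\ q = \pi_hatH (in_B x)].

Definition hat_bp : set hatH :=
  [set q | exists x (p : set_type beta_p),
     [/\ Bp x, set_val p = (1, rp 1 x) & q = \pi_hatH (in_p p)]].

Definition hat_bm : set hatH :=
  [set q | exists x (p : set_type beta_m),
     [/\ Bm x, set_val p = (1, rm 1 x) & q = \pi_hatH (in_m p)]].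

(* The points of hatH given by a point of B, of beta^+ and of beta^-; the
   default d is returned only when the argument is not such a point. *)
Definition to_B (d : hatH) (x : T) : hatH :=
  if pselect (B x) is left Bx then \pi_hatH (in_B (exist _ x (mem_set Bx)))
  else d.

Definition to_p (d : hatH) (p : R * T) : hatH :=
  if pselect (beta_p p) is left bp then \pi_hatH (in_p (exist _ p (mem_set bp)))
  else d.

Definition to_m (d : hatH) (p : R * T) : hatH :=
  if pselect (beta_m p) is left bp then \pi_hatH (in_m (exist _ p (mem_set bp)))
  else d.

Definition exit_time (x : T) : \bar R :=
  ereal_sup [set t%:E | t in [set t | 0 <= t /\ orb phi `[0, t] x `<=` B]].

Definition entrance_time (x : T) : \bar R :=
  ereal_inf [set t%:E | t in [set t | t <= 0 /\ orb phi `[t, 0] x `<=` B]].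

(* The extended flow at a point x of B. *)
Definition hat_phi_B (d : hatH) (t : R) (x : T) : hatH :=
  let Tp := exit_time x in let Tm := entrance_time x in
  if (Tm <= t%:E <= Tp)%E then to_B d (phi t x)
  else if (Tp <= t%:E)%E then
    let s := 1 - expR (fine Tp - t) in to_m d (s, rm s (phi (fine Tp) x))
  else
    let s := 1 - expR (t - fine Tm) in to_p d (s, rp s (phi (fine Tm) x)).

Definition hat_phi_pieces (d : hatH) (t : R) (a : pieces) : hatH :=
  let: existT i p := a in
  match i return piece i -> hatH with
  | None => fun x => hat_phi_B d t (set_val x)
  | Some true => fun p => let: (s, y) := set_val p in
      if s < 1 then
        hat_phi_B d (t + ln (1 - s)) (xget y [set x | Bp x /\ rp s x = y])
      else d
  | Some false => fun p => let: (s, y) := set_val p in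
      if s < 1 then
        hat_phi_B d (t - ln (1 - s)) (xget y [set x | Bm x /\ rm s x = y])
      else d
  end p.

(* With the default d = q, the points (1, y) are fixed. The value does not
   depend on the representative of q. *)
Definition hat_phi (t : R) (q : hatH) : hatH := hat_phi_pieces q t (repr q).

End Extension.

Arguments hat_set {R T} phi B rp rm A.
Arguments hat_bp {R T} phi B rp rm.
Arguments hat_bm {R T} phi B rp rm.
Arguments hat_phi {R T} phi B rp rm t q.

(* Main.v *)
Require Import Defs.
From Stdlib Require Import Relation_Operators.
From mathcomp Require Import all_boot all_order all_algebra.
From mathcomp Require Import generic_quotient sesquilinear.
From mathcomp Require Import all_classical all_reals all_analysis homotopy.
From mathcomp Require Import lra.

Set Implicit Arguments.
Unset Strict Implicit.
Unset Printing Implicit Defensive.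

Import Order.TTheory GRing.Theory Num.Theory.
Import numFieldNormedType.Exports.
Local Open Scope classical_set_scope.
Local Open Scope ring_scope.
Local Open Scope quotient_scope.

(** Suppose that no connecting orbit exists.  A point of [I] outside attractor and
    repeller has its alpha-limit set in the repeller, while its omega-limit set
    meets the attractor.  In (a) this says that its orbit, followed back into [B],
    stays in [B] for all negative times and leaves [B] in positive time; since
    [S_comp] is the invariant part of [B], one of the limit sets under [phi] meets
    [S], and it is not the alpha-limit set, which lies in [S_comp].  So [I] is the
    disjoint union of attractor and repeller, and it remains to see that the index
    of a disjoint union is the wedge of the indices, whatever the index pairs.
    Following Salamon, index pairs (N, N1) and (K, K1) are compared by the map
    sending x to [phi_{3T} x] if [phi_[0,2T] x] lies in N \ N1 and [phi_[T,3T] x]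
    lies in K \ K1, and to the base point otherwise.  For T large this map is
    continuous, and the composites of two such maps are homotopic to the identity
    along the flow.  As the boundary is closed and invariant, these maps act on all
    three components of the index.  The extended flow is continuous because its
    phase space is compact and its graph is closed. *)

(** * Closed sets, compactness and continuity *)

Section Topology.
Implicit Types X Y Z : topologicalType.

(** Index pairs of the same set need not be related by inclusion; what they share is an isolation
    time. For a prescribed neighbourhood of the isolated set there is [tau] such that an orbit which
    stays in N \ N1 on [-tau, tau] lies in that neighbourhood at time 0. Taking for it the union of
    two disjoint open sets, one around each summand, connectedness of orbit segments assigns a point
    of N with a long enough stay to exactly one summand, and a common [tau] serves all three pairs.
    Continuity of the exit and entrance times is never established. The graph of the extended flow
    is instead written with the transition times as existential parameters in a compact interval,
    and projection along a compact factor preserves closedness. The two halves of the theorem are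
    not time reversals of each other: an attractor is defined by a neighbourhood, its repeller only
    by duality, so the attraction property is used at opposite ends of the orbit. *)

Lemma continuous_pair X Y Z (f : X -> Y) (g : X -> Z) :
  continuous f -> continuous g -> continuous (fun x => (f x, g x)).
Proof. by move=> cf cg x; apply: cvg_pair; [exact: cf|exact: cg]. Qed.

Lemma continuous_fstP X Y Z (f : X -> Y * Z) :
  continuous f -> continuous (fun x => (f x).1).
Proof. by move=> cf x; apply: (continuous_comp (cf x)); exact: cvg_fst. Qed.

Lemma continuous_sndP X Y Z (f : X -> Y * Z) :
  continuous f -> continuous (fun x => (f x).2).
Proof. by move=> cf x; apply: (continuous_comp (cf x)); exact: cvg_snd. Qed.

Lemma continuous_id X : continuous (fun x : X => x).
Proof. by move=> x; exact: cvg_id. Qed.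

Lemma continuous_mul (R : realType) X (f g : X -> R) :
  continuous f -> continuous g -> continuous (fun x => f x * g x).
Proof. by move=> cf cg x; apply: cvgM; [exact: cf|exact: cg]. Qed.

Lemma continuous_sub (R : realType) X (f g : X -> R) :
  continuous f -> continuous g -> continuous (fun x => f x - g x).
Proof. by move=> cf cg x; apply: cvgB; [exact: cf|exact: cg]. Qed.

Lemma closed_preimage X Y (f : X -> Y) (A : set Y) :
  continuous f -> closed A -> closed [set x | A (f x)].
Proof. by move=> /continuous_closedP + cA; apply. Qed.

Lemma closed_forall X I (A : I -> set X) :
  (forall i, closed (A i)) -> closed [set x | forall i, A i x].
Proof.
move=> cA; suff -> : [set x | forall i, A i x] = \bigcap_i A i.
  by apply: closed_bigI => i _; exact: cA.
by apply/seteqP; split => x Ax // i; apply: Ax.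
Qed.

(** Near a point outside the set, compactness of [K] makes the avoidance of [A] uniform in [y]. The
    lemma serves to eliminate unknown times and base points from closed conditions. *)
Lemma closed_exists_compact X Y (K : set Y) (A : set (X * Y)) :
  compact K -> closed A -> closed [set x | exists2 y, K y & A (x, y)].
Proof.
move=> /compact_near_coveringP cK cA; rewrite -openC openE => x /= nAx.
have := cK X (nbhs x) (fun x y => ~ A (x, y)) _.
have H y : K y -> \forall y' \near y & x' \near x, ~ A (x', y').
  move=> Ky; have : nbhs (x, y) (~` A).
    by apply: open_nbhs_nbhs; split; [exact: closed_openC|move=> Axy; apply: nAx;
      exists y].
  by move=> [[U V] /= [Ux Vy] UV]; exists (V, U) => //= -[y' x'] [/= ? ?];
    apply: (UV (x', y')).
move=> /(_ _ H); apply: filterS => x' /= Kx' [y Ky Axy].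
exact: Kx' Ky Axy.
Qed.

Lemma closed_eq_fun X Y (f g : X -> Y) : hausdorff_space Y ->
  continuous f -> continuous g -> closed [set x | f x = g x].
Proof.
move=> hY cf cg x /= clx; apply: hY => U V Uf Vg.
have Ux : nbhs x (f @^-1` U) by exact: cf.
have Vx : nbhs x (g @^-1` V) by exact: cg.
have := clx _ (filterI Ux Vx).
by move=> [y /= [fg [Uy Vy]]]; exists (f y); split => //; rewrite fg.
Qed.

Lemma hausdorff_inj X Y (f : X -> Y) : hausdorff_space Y ->
  continuous f -> injective f -> hausdorff_space X.
Proof.
move=> hY cf fI x y clxy; apply/fI/hY => U V Uf Vg.
by have [z [/= Uz Vz]] := clxy _ _ (cf x _ Uf) (cf y _ Vg); exists (f z).
Qed.

Lemma hausdorff_prod X Y : hausdorff_space X -> hausdorff_space Y ->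
  hausdorff_space (X * Y)%type.
Proof.
move=> hX hY [x1 y1] [x2 y2] cl; congr pair.
  apply: hX => U V Ux Vx.
  have [] := cl (fst @^-1` U) (fst @^-1` V).
  - exact: (@cvg_fst _ _ (nbhs x1) (nbhs y1) _ _ Ux).
  - exact: (@cvg_fst _ _ (nbhs x2) (nbhs y2) _ _ Vx).
  by move=> z [? ?]; exists z.1.
apply: hY => U V Ux Vx.
have [] := cl (snd @^-1` U) (snd @^-1` V).
- exact: (@cvg_snd _ _ (nbhs x1) (nbhs y1) _ _ Ux).
- exact: (@cvg_snd _ _ (nbhs x2) (nbhs y2) _ _ Vx).
by move=> z [? ?]; exists z.2.
Qed.

(** The preimage of a closed [C] is the projection, along the compact [Y], of the part of the graph
    that lies over [C]. *)
Lemma closed_graph_continuous X Y (f : X -> Y) :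
  compact [set: Y] -> closed [set p : X * Y | p.2 = f p.1] -> continuous f.
Proof.
move=> cY cG; apply/continuous_closedP => C cC.
suff -> : f @^-1` C = [set x | exists2 y, setT y &
    ([set p | p.2 = f p.1] `&` snd @^-1` C) (x, y)].
  apply: closed_exists_compact => //; apply: closedI => //.
  by apply: closed_preimage cC => p; exact: cvg_snd.
apply/seteqP; split => x /=; first by exists (f x).
by move=> [y _ [-> ]].
Qed.

Lemma set_val_continuous X (A : set X) : continuous (set_val : set_type A -> X).
Proof. exact: initial_continuous. Qed.

Lemma compact_set_type X (A : set X) : compact A -> compact [set: set_type A].
Proof.
move=> cA; apply/compact_near_coveringP => J F P FF H.
have := (compact_near_coveringP A).1 cA J F
  (fun i x => forall a : set_type A, set_val a = x -> P i a) FF _.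
have K x : A x -> \forall x' \near x & i \near F,
    forall a : set_type A, set_val a = x' -> P i a.
  move=> Ax; have [[U V] /= [Ux FV] UV] := H (exist _ x (mem_set Ax)) I.
  case: Ux => _ [[W oW <-] /= Wx WU].
  exists (W, V) => /=; first by split => //; exact: open_nbhs_nbhs.
  by move=> [x' i] /= [Wx' Vi] a ax'; apply: (UV (a, i)); split => //=;
    apply: WU; rewrite /= ax'.
move=> /(_ K); apply: filterS => i Ai a _; apply: (Ai (set_val a)) => //.
exact: set_valP.
Qed.

End Topology.

Lemma tube (X Y : topologicalType) (K : set Y) (A : set (X * Y)) (x0 : X) :
  compact K -> closed A -> (forall y, K y -> ~ A (x0, y)) ->
  exists V U, [/\ nbhs x0 V, open U, K `<=` U &
    forall x y, V x -> U y -> ~ A (x, y)].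
Proof.
move=> /compact_near_coveringP cK cA KA.
(* The second variable of the covering property is a neighbourhood [V] of [x0], taken along the
   filter of small neighbourhoods; since [UU] is antitone in [V], a single [V] can be extracted at
   the end. *)
pose UU (V : set X) := interior [set y | forall x, V x -> ~ A (x, y)].
have := cK _ (powerset_filter_from (nbhs x0)) (fun V y => UU V y) _.
have H y : K y -> \forall y' \near y & V \near powerset_filter_from (nbhs x0),
    UU V y'.
  move=> Ky; have : nbhs (x0, y) (~` A).
    by apply: open_nbhs_nbhs; split; [exact: closed_openC|exact: KA].
  move=> [[V0 W0] /= [V0x W0y] VO].
  exists (interior W0, [set V | V `<=` V0]) => /=.
    split; first by apply: open_nbhs_nbhs; split; [exact: open_interior|].
    exact: small_set_sub.
  move=> [y' V] /= [W0y' VV0].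
  apply: filterS W0y' => z Oz x Vx; apply: (VO (x, z)); split => //.
  exact: VV0.
move=> /(_ _ H) /near_powerset_filter_fromP [].
  move=> V1 V2 V12 HV y Ky; have := HV y Ky; apply: filterS => z Vz x V1x.
  by apply: Vz; apply: V12.
move=> V Vx0 KU; exists V, (UU V); split => //; first exact: open_interior.
by move=> x y Vx /interior_subset; apply.
Qed.

(** * Pointed pair quotients *)

Section PairQuotientTheory.
Context {M : topologicalType}.
Implicit Types P Q : set M.

(** Total on [M], with the base point as value off [P], so that the quotient is handled through
    points of [M] instead of [set_type P]. *)
Definition pq_class P Q (x : M) : pair_quotient P Q :=
  if pselect (P x) is left Px
  then \pi_(pair_quotient P Q) (existT _ true (exist _ x (mem_set Px)))
  else point.

Lemma pq_class_pi P Q (p : set_type P) :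
  \pi_(pair_quotient P Q) (existT _ true p) = pq_class P Q (set_val p).
Proof.
rewrite /pq_class; case: pselect => [Px|]; last by have := set_valP p.
by congr (\pi_(pair_quotient P Q) (existT _ true _)); apply: val_inj.
Qed.

Lemma pq_class_point P Q x : Q x -> pq_class P Q x = point.
Proof.
rewrite /pq_class; case: pselect => // Px Qx.
by apply/eqmodP/orP; right; apply/andP; split; apply/mem_set.
Qed.

Lemma pq_class_neq_point P Q x : P x -> ~ Q x -> pq_class P Q x <> point.
Proof.
rewrite /pq_class; case: pselect => // Px _ Qx.
by move=> /eqmodP /predU1P[//|/andP[/set_mem/=]].
Qed.

Lemma pq_class_inj P Q x y : P x -> ~ Q x -> pq_class P Q x = pq_class P Q y ->
  x = y.
Proof.
move=> Px Qx E; have := pq_class_neq_point Px Qx; rewrite E.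
move: E; rewrite {1 2 3}/pq_class; case: pselect => // {}Px.
case: pselect => // Py /eqmodP /predU1P[E|/andP[/set_mem//]] _.
by have /(congr1 set_val) := existT_inj2 E.
Qed.

Variant pq_spec P Q : pair_quotient P Q -> Prop :=
| PqPoint : pq_spec point
| PqClass x : P x -> ~ Q x -> pq_spec (pq_class P Q x).

Lemma pqP P Q (q : pair_quotient P Q) : pq_spec q.
Proof.
rewrite -[q]reprK; case: (repr q) => -[p|[]]; last exact: PqPoint.
have := pq_class_pi Q p; rewrite /= => ->.
have [Qp|nQp] := pselect (Q (set_val p)).
  by rewrite pq_class_point //; exact: PqPoint.
by apply: PqClass => //; exact: set_valP.
Qed.

(** Since [P] is closed, closedness in the subspace is closedness in [M]; the extra point is
    isolated and adds no condition. *)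
Lemma pq_closedP P Q (C : set (pair_quotient P Q)) : closed P ->
  closed C <-> closed [set x | P x /\ C (pq_class P Q x)].
Proof.
move=> cP; split=> cC.
  have : closed (set_val @^-1` [set x | P x /\ C (pq_class P Q x)] : set (set_type
    P)).
    suff -> : (set_val @^-1` [set x | P x /\ C (pq_class P Q x)] : set (set_type P)) =
      [set p | C (\pi_(pair_quotient P Q) (existT _ true p))].
      apply: closed_preimage cC => p.
      apply: continuous_comp; first exact: existT_continuous.
      exact: pi_continuous.
    apply/seteqP; split => p /=; first by move=> [_]; rewrite -pq_class_pi.
    by rewrite -pq_class_pi; split => //; exact: set_valP.
  rewrite -openC => -[W oW WE].
  suff -> : [set x | P x /\ C (pq_class P Q x)] = P `&` ~` W.
    by apply: closedI => //; exact: open_closedC.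
  apply/seteqP; split => x /= [Px].
    move=> Cx; split => // Wx; have : (set_val @^-1` W) (exist _ x (mem_set Px))
      by [].
    by rewrite WE /= => /(_ (conj Px Cx)).
  move=> nWx; split => //; apply: contrapT => nCx; apply: nWx.
  have : (~` (set_val @^-1` [set x0 | P x0 /\ C (pq_class P Q x0)]))
     (exist _ x (mem_set Px)) by move=> /= [].
  by rewrite -WE.
rewrite -openC /open /= /quotient_open; apply/sigT_openP => -[]; last first.
  by rewrite openE => u Cu; exact/principal_filterP.
rewrite -closedC; rewrite [X in closed X](_ : _ =
  (set_val @^-1` [set x | P x /\ C (pq_class P Q x)])).
  by apply: closed_preimage cC; exact: set_val_continuous.
apply/seteqP; split => p /=.
  rewrite -pq_class_pi => /contrapT ?; split => //.
  exact: set_valP.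
by rewrite -pq_class_pi => -[_ ?]; apply.
Qed.

(** Computed on the representative given by [repr]; this is compatible with the quotient as soon as
    [f] equals [z0] at the common points of [P] and [Q]. *)
Definition pq_map P Q (Z : Type) (z0 : Z) (f : M -> Z) (q : pair_quotient P Q) : Z :=
  match repr q with
  | existT true p => f (set_val p)
  | existT false _ => z0
  end.

Lemma pq_map_point P Q (Z : Type) (z0 : Z) (f : M -> Z) :
  (forall x, P x -> Q x -> f x = z0) -> @pq_map P Q Z z0 f point = z0.
Proof.
move=> fQ; rewrite /pq_map /point /=; case: piP => -[[p|//]].
move=> /eqmodP /predU1P[//|/andP[_ /set_mem /= Qp]].
by apply: fQ => //; exact: set_valP.
Qed.

Lemma pq_map_class P Q (Z : Type) (z0 : Z) (f : M -> Z) x :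
  (forall x, P x -> Q x -> f x = z0) -> P x ->
  pq_map z0 f (pq_class P Q x) = f x.
Proof.
move=> fQ Px; have [Qx|nQx] := pselect (Q x).
  by rewrite pq_class_point // pq_map_point // fQ.
rewrite /pq_map /pq_class; case: pselect => // {}Px.
case: piP => -[[p|/= u]] /eqmodP /predU1P[E|/andP[/set_mem//]].
  by rewrite -(existT_inj2 E).
by have := congr1 tag E.
Qed.

(** The product of a quotient map with the identity of [Th] need not be a quotient map, so joint
    continuity is proved with neighbourhoods instead of being lifted to [M]. *)
Lemma pq_map_continuous (Th : topologicalType) P Q (Z : ptopologicalType)
    (f : Th -> M -> Z) : compact P -> closed P -> closed Q ->
  (forall th x, P x -> Q x -> f th x = point) ->
  (forall C, closed C -> closed [set p : Th * M | P p.2 /\ C (f p.1 p.2)]) ->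
  continuous (fun p : Th * pair_quotient P Q => pq_map point (f p.1) p.2).
Proof.
move=> kP cP cQ fQ fC; apply/continuous_closedP => C cC.
rewrite -openC openE => -[th q] /=.
have {}fC := fC _ cC.
have nb (V : set Th) (U : set M) : nbhs th V -> open U ->
    (forall th' x, V th' -> U x -> P x -> ~ C (f th' x)) ->
    pq_spec q -> (q = point -> (P `&` Q `<=` U) /\ ~ C point) ->
    (forall x, P x -> ~ Q x -> q = pq_class P Q x -> U x) ->
    nbhs (th, q) (~` [set p : Th * pair_quotient P Q | C (pq_map point (f p.1) p.2)]).
  move=> Vth oU VU _ q0 qx.
  (* [O] consists of the classes of the points of [U] that lie in [P] but not in [Q], together with
     the base point exactly when [q] is the base point. *)
  pose O := [set q' | (q' = point -> q = point) /\
     forall x, P x -> ~ Q x -> q' = pq_class P Q x -> U x].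
  have oO : open O.
    rewrite -closedC; apply/pq_closedP => //.
    have cq : closed [set x : M | q <> point].
      have [qp|qp] := pselect (q = point).
        by rewrite (_ : [set _ | _] = set0) ?predeqE; [exact: closed0|].
      by rewrite (_ : [set _ | _] = setT) ?predeqE; [exact: closedT|].
    suff -> : [set x | P x /\ (~` O) (pq_class P Q x)] =
       P `&` ~` U `|` [set x | q <> point] `&` (P `&` Q).
      apply: closedU; last by apply: closedI => //; exact: closedI.
      by apply: closedI => //; exact: open_closedC.
    apply/seteqP; split => x /=.
      move=> [Px nO]; have [Qx|nQx] := pselect (Q x).
        have [Ux|nUx] := pselect (U x); last by left.
        right; split => // qp; apply: nO; split => // x' Px' Qx'.
        by move=> /esym /(pq_class_inj Px' Qx') ->.
      left; split => // Ux; apply: nO; split.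
        by move=> /(pq_class_neq_point Px nQx).
      by move=> x' Px' Qx' /esym /(pq_class_inj Px' Qx') ->.
    move=> [[Px nUx]|[nqp [Px Qx]]]; split => //; move=> [H1 H2].
      apply: nUx; have [Qx|nQx] := pselect (Q x); last by apply: H2.
      have qp : q = point by exact/H1/pq_class_point.
      by apply: (q0 qp).1.
    have qp : q = point by exact/H1/pq_class_point.
    exact: nqp qp.
  exists (V, O) => /=.
    split => //; apply: open_nbhs_nbhs; split; first exact: oO.
    by split => [//|x Px Qx qE]; exact: qx qE.
  move=> [th' q'] /= [Vth' [q'1 q'2]].
  case: (pqP q') q'1 q'2 => [qp _|x Px Qx _ /(_ x Px Qx erefl) Ux].
    by rewrite /= (pq_map_point (fQ th')); exact: (q0 (qp erefl)).2.
  by rewrite /= (pq_map_class (fQ th') Px); exact: VU.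
case: (pqP q) nb => [|x Px Qx] nb.
  rewrite (pq_map_point (fQ th)) => nC.
  (* A neighbourhood of the base point has to contain all common points of [P] and [Q] upstairs, so
     one [V] must serve this whole compact set. *)
  have kPQ : compact (P `&` Q) by exact: compact_closedI.
  have [|V [U [Vth oU PQU VU]]] := @tube _ _ (P `&` Q) _ th kPQ fC.
    by move=> y [Py Qy] /= [_]; rewrite fQ.
  apply: (nb V U) => //; first by move=> th' x Vth' Ux Px Cx; exact: (VU th' x).
    exact: PqPoint.
  by move=> x Px Qx /esym /(pq_class_neq_point Px Qx).
rewrite (pq_map_class (fQ th) Px) => nC.
have : nbhs (th, x) (~` [set p : Th * M | P p.2 /\ C (f p.1 p.2)]).
  by apply: open_nbhs_nbhs; split; [exact: closed_openC|move=> /= [_]].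
move=> [[V U] /= [Vth Ux] VU].
apply: (nb V (interior U)) => //.
- exact: open_interior.
- move=> th' x' Vth' /interior_subset Ux' Px' Cx'.
  by apply: (VU (th', x')).
- exact: PqClass.
- by move=> /(pq_class_neq_point Px Qx).
- by move=> x' Px' Qx' /(pq_class_inj Px Qx) <-.
Qed.

Definition partial_class (P' Q' D : set M) (k : M -> M) (x : M) :
    pair_quotient P' Q' :=
  if pselect (D x) then pq_class P' Q' (k x) else point.

(* The topology of a pair quotient being that of the one-point compactification
   of [P `\` Q], a partial map induces a continuous pointed map when its domain
   is open and when it is proper, which is the second closedness condition. *)
Lemma partial_class_continuous (Th : topologicalType) (P Q P' Q' : set M)
    (D : Th -> set M) (k : Th -> M -> M) (W : set (Th * M)) :
  compact P -> closed P -> closed Q -> closed P' ->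
  continuous (fun p : Th * M => k p.1 p.2) ->
  open W -> (forall th x, P x -> D th x <-> W (th, x)) ->
  (forall C, closed C -> C `<=` P' -> C `&` Q' = set0 ->
     closed [set p : Th * M | [/\ P p.2, D p.1 p.2 & C (k p.1 p.2)]]) ->
  (forall th x, P x -> D th x -> [/\ ~ Q x, P' (k th x) & ~ Q' (k th x)]) ->
  continuous (fun p : Th * pair_quotient P Q =>
    pq_map point (partial_class P' Q' (D p.1) (k p.1)) p.2).
Proof.
move=> kP cP cQ cP' ck oW DW Dk PD.
apply: (@pq_map_continuous Th P Q (pair_quotient P' Q')
  (fun th => partial_class P' Q' (D th) (k th))) => //.
  move=> th x Px Qx; rewrite /partial_class; case: pselect => // Dx.
  by case: (PD _ _ Px Dx).
move=> C cC; have cC' := (pq_closedP C cP').1 cC.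
(* Off the domain the value is the base point. If [C] contains it, openness of the domain gives
   closedness; otherwise the points of [P'] over [C] avoid [Q'] and the properness condition
   applies. *)
have [Cp|nCp] := pselect (C point).
  suff -> : [set p : Th * M | P p.2 /\ C (partial_class P' Q' (D p.1) (k p.1) p.2)]
     = [set p | P p.2] `&` (~` W `|` [set p : Th * M | P' (k p.1 p.2) /\
           C (pq_class P' Q' (k p.1 p.2))]).
    apply: closedI; first by apply: (@closed_preimage _ _ snd P) => // p;
      exact: cvg_snd.
    apply: closedU; first exact: open_closedC.
    by have := closed_preimage ck cC'.
  apply/seteqP; split => -[th x] /= [Px]; rewrite /partial_class.
    case: pselect => [Dx Cx|/= nD _]; split => //.
      by right; split => //; have [] := PD _ _ Px Dx.
    by left; move=> /(DW _ _ Px).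
  move=> [nW|[_ Cx]]; split => //; case: pselect => // Dx.
  by exfalso; apply: nW; apply/DW.
suff -> : [set p : Th * M | P p.2 /\ C (partial_class P' Q' (D p.1) (k p.1) p.2)]
   = [set p : Th * M | [/\ P p.2, D p.1 p.2 &
       [set z | P' z /\ C (pq_class P' Q' z)] (k p.1 p.2)]].
  apply: Dk => //; first by move=> z [].
  by apply/seteqP; split => z //= [[_ Cz] Qz]; apply: nCp;
    rewrite -(pq_class_point P' Qz).
apply/seteqP; split => -[th x] /=; rewrite /partial_class.
  by move=> [Px]; case: pselect => // Dx Cx; split => //; split => //;
    have [] := PD _ _ Px Dx.
by move=> [Px Dx [_ Cx]]; split => //; case: pselect.
Qed.

End PairQuotientTheory.

(** * Flows and index pairs *)

Section Segments.
Context {R : realType} {M : topologicalType} (psi : R -> M -> M).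
Hypotheses (hpsi : is_flow psi).
Implicit Types (A U : set M) (x : M).

Definition seg (a b : R) A x := forall t, a <= t <= b -> A (psi t x).

Lemma flow0 x : psi 0 x = x. Proof. by case: hpsi. Qed.

Lemma flowD s t x : psi s (psi t x) = psi (s + t) x.
Proof. by case: hpsi => _ _ ->. Qed.

Lemma flowK t x : psi (- t) (psi t x) = x.
Proof. by rewrite flowD addNr flow0. Qed.

Lemma flowNK t x : psi t (psi (- t) x) = x.
Proof. by rewrite flowD addrN flow0. Qed.

Lemma flow_continuous (Z : topologicalType) (a : Z -> R) (f : Z -> M) :
  continuous a -> continuous f -> continuous (fun z => psi (a z) (f z)).
Proof.
move=> ca cf z; have [cpsi _ _] := hpsi.
apply: (@continuous_comp _ _ _ (fun z => (a z, f z)) (fun p => psi p.1 p.2) z).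
  exact: continuous_pair.
exact: cpsi.
Qed.

Lemma continuous_time_map t : continuous (psi t).
Proof.
by apply: (@flow_continuous M (fun=> t) id) => x; [exact: cvg_cst|exact: cvg_id].
Qed.

Lemma continuous_orbit x : continuous (fun t => psi t x).
Proof.
by apply: (@flow_continuous R id (fun=> x)) => t; [exact: cvg_id|exact: cvg_cst].
Qed.

Lemma orb_subset a b A x : orb psi `[a, b] x `<=` A <-> seg a b A x.
Proof.
split=> [H t tab|H _ [t /= tab <-]]; last by apply: H; rewrite in_itv in tab.
by apply: H; exists t => //=; rewrite in_itv.
Qed.

(** Rescaling to a fixed compact interval makes [seg] conditions with variable end times accessible
    to closedness and compactness arguments. *)
Lemma segP a b A x : a <= b ->
  seg a b A x <-> forall u, 0 <= u <= 1 -> A (psi (a + u * (b - a)) x).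
Proof.
move=> ab; split=> H u /andP[u0 u1].
  apply: H; rewrite lerDl mulr_ge0 ?subr_ge0 //= -lerBrDl.
  by rewrite ler_piMl ?subr_ge0.
have [abE|nab] := eqVneq a b.
  have /H : 0 <= (0 : R) <= 1 by rewrite lexx ler01.
  by rewrite mul0r addr0; suff -> : a = u by []; apply/eqP; rewrite eq_le u0 abE.
have ba : 0 < b - a by rewrite subr_gt0 lt_neqAle nab.
have -> : u = a + (u - a) / (b - a) * (b - a).
  by rewrite divfK ?gt_eqF // addrC subrK.
apply: H; rewrite divr_ge0 ?subr_ge0 ?(ltW ba) //= ?ler_pdivrMr //.
by rewrite mul1r lerD2r.
Qed.

Lemma segS a b A A' x : A `<=` A' -> seg a b A x -> seg a b A' x.
Proof. by move=> AA' H t /H /AA'. Qed.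

Lemma segW a b c d A x : a <= c -> d <= b -> seg a b A x -> seg c d A x.
Proof.
move=> ac db H t /andP[ct td]; apply: H.
by rewrite (le_trans ac ct) (le_trans td db).
Qed.

Lemma seg_shift a b c A x : seg a b A (psi c x) <-> seg (a + c) (b + c) A x.
Proof.
split=> H t /andP[ta tb].
  have -> : t = (t - c) + c by rewrite subrK.
  by rewrite -flowD; apply: H; rewrite lerBrDr ta lerBlDr.
by rewrite flowD; apply: H; rewrite !lerD2r ta.
Qed.

Lemma seg_cat a b c d A x : c <= b -> seg a b A x -> seg c d A x -> seg a d A x.
Proof.
move=> cb H1 H2 t /andP[ta td]; have [tb|bt] := leP t b.
  by apply: H1; rewrite ta.
by apply: H2; rewrite td (le_trans cb (ltW bt)).
Qed.

Lemma seg_closed (Z : topologicalType) (a b : Z -> R) (f : Z -> M) A :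
  continuous a -> continuous b -> continuous f -> (forall z, a z <= b z) ->
  closed A -> closed [set z | seg (a z) (b z) A (f z)].
Proof.
move=> ca cb cf ab cA.
suff -> : [set z | seg (a z) (b z) A (f z)] =
  [set z | forall u : {u : R | 0 <= u <= 1},
     A (psi (a z + sval u * (b z - a z)) (f z))].
  apply: closed_forall => u.
  apply: (@closed_preimage _ _ (fun z =>
    psi (a z + sval u * (b z - a z)) (f z))) => //.
  apply: flow_continuous => // z; apply: cvgD; first exact: ca.
  by apply: cvgM; [exact: cvg_cst|apply: cvgB; [exact: cb|exact: ca]].
apply/seteqP; split => z /=.
  by move=> /(segP _ _ (ab z)) H [u u01]; exact: H.
by move=> H; apply/(segP _ _ (ab z)) => u u01; exact: (H (exist _ u u01)).
Qed.

Lemma seg_open (Z : topologicalType) (a b : Z -> R) (f : Z -> M) A :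
  continuous a -> continuous b -> continuous f -> (forall z, a z <= b z) ->
  open A -> open [set z | seg (a z) (b z) A (f z)].
Proof.
move=> ca cb cf ab oA; rewrite -closedC.
suff -> : ~` [set z | seg (a z) (b z) A (f z)] =
  [set z | exists2 u : R, `[0, 1]%classic u &
    [set p : Z * R | (~` A) (psi (a p.1 + p.2 * (b p.1 - a p.1)) (f p.1))] (z, u)].
  apply: closed_exists_compact; first exact: segment_compact.
  apply: (@closed_preimage _ _
    (fun p : Z * R => psi (a p.1 + p.2 * (b p.1 - a p.1)) (f p.1)));
      last exact: open_closedC.
  have c1 (Y : topologicalType) (g : Z -> Y) : continuous g ->
      continuous (fun p : Z * R => g p.1).
    by move=> cg p; apply: (@continuous_comp _ _ _ fst g); [exact: cvg_fst|exact: cg].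
  apply: flow_continuous; last exact: c1.
  move=> p; apply: cvgD; first exact: c1.
  apply: cvgM; first exact: cvg_snd.
  by apply: cvgB; exact: c1.
apply/seteqP; split => z /=.
  move=> H; apply: contrapT => nex; apply: H; apply/(segP _ _ (ab z)) => u u01.
  by apply: contrapT => nA; apply: nex; exists u => //; rewrite in_itv.
by move=> [u]; rewrite in_itv /= => u01 nA /(segP _ _ (ab z)) H; apply/nA/H.
Qed.

Lemma seg_connected a b c (U1 U2 : set M) x : open U1 -> open U2 ->
  U1 `&` U2 = set0 -> a <= c <= b -> seg a b (U1 `|` U2) x -> U1 (psi c x) ->
  seg a b U1 x.
Proof.
move=> oU1 oU2 U12 cab sx U1c.
have cI : connected ((fun t => psi t x) @` `[a, b]).
  apply: connected_continuous_connected; first exact: segment_connected.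
  apply: continuous_subspaceT.
  exact: continuous_orbit.
have sep : separated U1 U2.
  have sub (A B : set M) : open B -> A `&` B = set0 -> closure A `&` B = set0.
    move=> oB AB; apply/seteqP; split => // y [clA By].
    by have [z] := clA B (open_nbhs_nbhs (conj oB By)); rewrite AB.
  by split; [exact: sub|rewrite setIC; apply: sub => //; rewrite setIC].
have [|I1|I2] := connected_subset sep _ cI.
- by move=> _ [t /= tab <-]; apply: sx; rewrite in_itv in tab.
- by move=> t tab; apply: I1; exists t => //=; rewrite in_itv.
exfalso; have : (U1 `&` U2) (psi c x); last by rewrite U12.
by split => //; apply: I2; exists c => //=; rewrite in_itv.
Qed.

Lemma Inv_sub A : Defs.Inv psi A `<=` A.
Proof. by move=> x [Q [_ QA] /QA]. Qed.

Lemma Inv_invariant A : flow_invariant psi (Defs.Inv psi A).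
Proof. by move=> t x [Q [iQ QA] Qx]; exists Q => //; exact: iQ. Qed.

Lemma InvP A x : Defs.Inv psi A x <-> forall t, A (psi t x).
Proof.
split=> [Ix t|H]; first by apply: Inv_sub; exact: Inv_invariant.
exists [set psi t x | t in setT]; last by exists 0 => //; rewrite flow0.
split; last by move=> _ [t _ <-].
by move=> s _ [t _ <-]; exists (s + t) => //; rewrite flowD.
Qed.

Lemma Inv_closed A : closed A -> closed (Defs.Inv psi A).
Proof.
move=> cA; suff -> : Defs.Inv psi A = [set x | forall t, A (psi t x)].
  apply: closed_forall => t; apply: (@closed_preimage _ _ (psi t)) => //.
  exact: continuous_time_map.
by apply/seteqP; split => x /InvP.
Qed.

(** The orbit of a point of [A] outside [U] leaves [A] at some time, which also serves a
    neighbourhood of that point; compactness of the part of [A] outside [U] bounds these times. *)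
Lemma isolation_time A U : compact A -> closed A -> open U ->
  Defs.Inv psi A `<=` U -> \forall T \near +oo, forall x, seg (- T) T A x -> U x.
Proof.
move=> kA cA oU IU.
have kAU : compact (A `&` ~` U) by apply: compact_closedI => //; exact: open_closedC.
have H x : (A `&` ~` U) x -> \forall x' \near x & T \near pinfty_nbhs R,
  ~ seg (- T) T A x'.
  move=> [Ax nUx].
  have [t nAt] : exists t, ~ A (psi t x).
    apply: contrapT => nex; apply/nUx/IU/InvP => t; apply: contrapT => nA.
    by apply: nex; exists t.
  exists (psi t @^-1` (~` A), [set T | `|t| < T]) => /=.
    split; last by apply: nbhs_pinfty_gt; rewrite num_real.
    apply: open_nbhs_nbhs; split => //; rewrite -closedC setCK.
    apply: (@closed_preimage _ _ (psi t)) => //.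
    exact: continuous_time_map.
  move=> [x' T] /= [nAx' tT] sx; apply: nAx'; apply: sx.
  by rewrite -ler_norml ltW.
have := (compact_near_coveringP _).1 kAU R (pinfty_nbhs R) _ _ H.
move=> K; near=> T; move=> x sx; apply: contrapT => nUx.
have /(_ x) nT : A `&` ~` U `<=` [set x | ~ seg (- T) T A x] by near: T; exact: K.
have T0 : 0 <= T by near: T; apply: nbhs_pinfty_ge; rewrite num_real.
apply: nT => //; split => //; rewrite -(flow0 x); apply: sx.
by rewrite oppr_le0 T0.
Unshelve. all: by end_near. Qed.

End Segments.

(** * Index pairs and the comparison maps between their quotients *)

Section FlowPairs.
Context {R : realType} {M : topologicalType} (psi : R -> M -> M).
Hypotheses (hpsi : is_flow psi).
Implicit Types (A N C : set M) (x : M).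

Local Notation seg := (seg psi).

(** The properties of an index pair that do not mention the isolated set. The exit condition appears
    in contrapositive form: an orbit that avoids [N1] cannot leave [N]. *)
Definition flow_pair N N1 :=
  [/\ compact N, closed N, closed N1,
      forall x s t, s <= t -> N1 (psi s x) -> seg s t N x -> N1 (psi t x)
    & forall x t, N x -> seg 0 t (~` N1) x -> seg 0 t N x].

Lemma index_pair_flow_pair Q N N1 : hausdorff_space M ->
  index_pair psi Q N N1 -> flow_pair N N1.
Proof.
move=> hM [[kN kN1 N1N] _ _ pos exit]; split => //.
- exact: compact_closed.
- exact: compact_closed.
- move=> x s t; rewrite le_eqVlt => /predU1P[<-//|st] N1s sx.
  have := pos _ (t - s) N1s; rewrite subr_gt0 => /(_ st).
  have /orb_subset sx' : seg 0 (t - s) N (psi s x).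
    by apply/(seg_shift hpsi); rewrite add0r subrK.
  move=> /(_ sx') /orb_subset /(_ (t - s)); rewrite (flowD hpsi) subrK; apply.
  by rewrite subr_ge0 lexx ltW.
- move=> x t Nx nN1 u /andP[u0 ut]; apply: contrapT => nN.
  move: u0; rewrite le_eqVlt => /predU1P[u0|u0].
    by apply: nN; rewrite -u0 (flow0 hpsi).
  have [t0 [/andP[t00 t0u] _]] := exit _ _ Nx u0 nN.
  by apply: nN1; rewrite t00 (le_trans t0u).
Qed.

Section Relative.
Variables (D E : set M).
Hypotheses (cD : closed D) (cE : closed E).
Hypotheses (iD : flow_invariant psi D) (iE : flow_invariant psi E).

(* The three components of the index arise from (D, E) = (setT, set0),
   (setT, boundary) and (boundary, set0). *)
Definition pqD N := N `&` D.
Definition pqE N N1 := (N1 `|` (N `&` E)) `&` D.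
Definition rel_quotient N N1 : ptopologicalType :=
  pair_quotient (pqD N) (pqE N N1).

Let iff_inv (A : set M) (iA : flow_invariant psi A) t x : A (psi t x) -> A x.
Proof. by move=> /(iA (- t)); rewrite (flowK hpsi). Qed.

(** [D] and the complement of [E] are tested at time 0 only, which is enough for invariant sets. *)
Definition salamon_dom A A1 C C1 (T : R) : set M :=
  [set x | [/\ seg 0 (2 * T) (A `\` A1) x, seg T (3 * T) (C `\` C1) x, D x & ~ E x]].

Definition salamon A A1 C C1 (T : R) : rel_quotient A A1 -> rel_quotient C C1 :=
  pq_map point (partial_class (pqD C) (pqE C C1)
    (salamon_dom A A1 C C1 T) (psi (3 * T))).

Definition stay_dom N N1 (a : R) : set M :=
  [set x | [/\ seg 0 a (N `\` N1) x, D x & ~ E x]].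

(** The map of an index space induced by flowing for time [a]. The composites of comparison maps
    reduce to it with [a] equal to [6 * T], and letting [a] shrink to 0 joins them to the
    identity. *)
Definition stay N N1 (a : R) : rel_quotient N N1 -> rel_quotient N N1 :=
  pq_map point (partial_class (pqD N) (pqE N N1) (stay_dom N N1 a) (psi a)).

Lemma seg0 a A x : 0 <= a -> seg 0 a A x -> A x.
Proof. by move=> a0 /(_ 0); rewrite lexx a0 (flow0 hpsi); apply. Qed.

Lemma seg_end a b A x : a <= b -> seg a b A x -> A (psi b x).
Proof. by move=> ab; apply; rewrite ab lexx. Qed.

(** [N1] is positively invariant relative to [N], so an earlier visit to [N1] would persist until
    time [t]. Thus avoidance on a segment is decided at its end. *)
Lemma flow_pair_avoid N N1 x s t : flow_pair N N1 ->
  seg s t N x -> ~ N1 (psi t x) -> seg s t (N `\` N1) x.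
Proof.
move=> [_ _ _ pos _] sN nt u /andP[su ut]; split; first by apply: sN; rewrite su.
by move=> N1u; apply: nt; apply: (pos _ u) => //; apply: segW sN.
Qed.

(** The domain is open because avoiding [A1] and [C1] is open and avoidance forces the orbit to stay
    in [A] and [C]; for [C] this needs a starting point in [C] at time [T], which the open [U]
    supplies. Properness replaces avoidance by the closed conditions of staying in [A] and [C]:
    avoidance of [A1] is recovered from [V] at time [2 * T], that of [C1] from the end point at time
    [3 * T]. *)
Lemma salamon_continuous A A1 C C1 U V T :
  flow_pair A A1 -> flow_pair C C1 -> 0 < T -> open U -> U `<=` C -> closed V ->
  (forall x, seg 0 (2 * T) (A `\` A1) x -> seg T (3 * T) (C `\` C1) x ->
     U (psi T x) /\ V (psi (2 * T) x)) ->
  (forall x, seg T (3 * T) (C `\` C1) x -> V (psi (2 * T) x) ->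
     ~ A1 (psi (2 * T) x)) ->
  continuous (@salamon A A1 C C1 T).
Proof.
move=> pA pC T0 oU UC cV UV VA1.
have [kA cA cA1 posA exA] := pA; have [kC cC cC1 posC exC] := pC.
pose W : set (R * M) := [set p | [/\ seg 0 (2 * T) (~` A1) p.2,
  U (psi T p.2), seg T (3 * T) (~` C1) p.2 & (~` E) p.2]].
have cst (c : R) : continuous (fun _ : R * M => c) by move=> p; exact: cvg_cst.
have csnd : continuous (@snd R M) by move=> p; exact: cvg_snd.
have cflow t : continuous (fun p : R * M => psi t p.2) by exact: flow_continuous.
have T2 : 0 <= 2 * T by lra.
have T3 : T <= 3 * T by lra.
have cont : continuous (fun p : R * rel_quotient A A1 => @salamon A A1 C C1 T p.2).
  apply: (@partial_class_continuous _ R _ _ _ _ (fun=> salamon_dom A A1 C C1 T)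
    (fun=> psi (3 * T)) W).
  - exact: compact_closedI.
  - exact: closedI.
  - by apply: closedI => //; apply: closedU => //; exact: closedI.
  - exact: closedI.
  - exact: cflow.
  - rewrite (_ : W = [set p | seg 0 (2 * T) (~` A1) p.2] `&`
      [set p | U (psi T p.2)] `&` [set p | seg T (3 * T) (~` C1) p.2] `&`
      [set p | (~` E) p.2]); last first.
      by apply/seteqP; split => p /=; [move=> [? ? ? ?]|move=> [[[? ?] ?] ?]].
    apply: openI; last by apply: open_comp; [|exact: closed_openC].
    apply: openI; last by apply: seg_open => //; exact: closed_openC.
    apply: openI; first by apply: seg_open => //; exact: closed_openC.
    by apply: (@open_comp _ _ (fun p : R * M => psi T p.2)).
  - move=> th x [Ax Dx]; split=> [[sA sC _ nE]|[/= nA1 Ux nC1 nE]].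
      split => //=; [by apply: segS sA => z []|exact: (UV _ sA sC).1|].
      by apply: segS sC => z [].
    split => //.
      by move=> t t2; split; [apply: exA nA1 _ t2|exact: nA1].
    have : seg 0 (2 * T) C (psi T x).
      apply: exC; first exact: UC.
      by apply/(seg_shift hpsi); apply: segW nC1; lra.
    move=> /(seg_shift hpsi) sC t tT; split; last exact: nC1.
    by apply: sC; lra.
  - move=> C0 cC0 C0C C0E.
    rewrite (_ : [set p | _] = [set p | A p.2] `&` [set p | D p.2] `&`
      [set p | seg 0 (2 * T) A p.2] `&` [set p | seg T (3 * T) C p.2] `&`
      [set p | V (psi (2 * T) p.2)] `&` [set p | C0 (psi (3 * T) p.2)]).
      apply: closedI; last exact: (@closed_preimage _ _ (fun p : R * M =>
        psi (3 * T) p.2)).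
      apply: closedI; last exact: (@closed_preimage _ _ (fun p : R * M =>
        psi (2 * T) p.2)).
      apply: closedI; last by apply: seg_closed.
      apply: closedI; last by apply: seg_closed.
      by apply: closedI; exact: (@closed_preimage _ _ (@snd R M)).
    apply/seteqP; split => -[th x] /=.
      move=> [[Ax Dx] [sA sC _ nE] C0x]; split => //; split;
        last exact: (UV _ sA sC).2.
      by repeat split => //; [apply: segS sA => z []|apply: segS sC => z []].
    move=> [[[[[Ax Dx] sA] sC] Vx] C0x].
    have nE : ~ E x.
      move=> Ex; suff : (C0 `&` pqE C C1) (psi (3 * T) x) by rewrite C0E.
      by split => //; have [Cx ?] := C0C _ C0x; split => //; right; split => //;
        exact: iE.
    have sC' : seg T (3 * T) (C `\` C1) x.
      apply: flow_pair_avoid => // C1x.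
      suff : (C0 `&` pqE C C1) (psi (3 * T) x) by rewrite C0E.
      by split => //; have [Cx ?] := C0C _ C0x; split => //; left.
    split => //; split => //.
    by apply: flow_pair_avoid => //; exact: VA1.
  - move=> th x [Ax Dx] [sA sC _ nE]; split.
    + by move=> [[A1x|[_ Ex]] _]; [have [] := seg0 T2 sA|exact: nE].
    + by split; [have [] := seg_end T3 sC|exact: iD].
    + move=> [[C1x|[_ Ex]] _]; first by have [] := seg_end T3 sC.
      exact: nE (iff_inv iE Ex).
move=> q; apply: (@continuous_comp _ _ _ (fun q => (0 : R, q))
  (fun p : R * rel_quotient A A1 => @salamon A A1 C C1 T p.2) q); last exact: cont.
apply: continuous_pair; first exact: cst_continuous.
by move=> z; exact: cvg_id.
Qed.

Lemma stay_continuous N N1 (a : R -> R) : flow_pair N N1 -> continuous a ->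
  (forall th, 0 <= a th) ->
  continuous (fun p : R * rel_quotient N N1 => @stay N N1 (a p.1) p.2).
Proof.
move=> pN ca a0; have [kN cN cN1 pos ex] := pN.
pose W : set (R * M) := [set p | seg 0 (a p.1) (~` N1) p.2 /\ (~` E) p.2].
have cst (c : R) : continuous (fun _ : R * M => c) by move=> p; exact: cvg_cst.
have csnd : continuous (@snd R M) by move=> p; exact: cvg_snd.
have ca1 : continuous (fun p : R * M => a p.1).
  by move=> p; apply: (@continuous_comp _ _ _ fst a); [exact: cvg_fst|exact: ca].
have cflow : continuous (fun p : R * M => psi (a p.1) p.2) by exact: flow_continuous.
apply: (@partial_class_continuous _ R _ _ _ _ (fun th => stay_dom N N1 (a th))
    (fun th => psi (a th)) W).
- exact: compact_closedI.
- exact: closedI.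
- by apply: closedI => //; apply: closedU => //; exact: closedI.
- exact: closedI.
- exact: cflow.
- rewrite (_ : W = [set p | seg 0 (a p.1) (~` N1) p.2] `&`
     [set p | (~` E) p.2]); last by [].
  apply: openI; last by apply: open_comp; [|exact: closed_openC].
  by apply: seg_open => //; exact: closed_openC.
- move=> th x [Nx Dx]; split=> [[sN _ nE]|[/= nN1 nE]].
    by split => //=; apply: segS sN => z [].
  split => //; move=> t t2; split; [apply: ex nN1 _ t2|exact: nN1] => //.
- move=> C0 cC0 C0C C0E.
  rewrite (_ : [set p | _] = [set p | N p.2] `&` [set p | D p.2] `&`
    [set p | seg 0 (a p.1) N p.2] `&` [set p | C0 (psi (a p.1) p.2)]).
    apply: closedI; last exact: (@closed_preimage _ _ (fun p : R * M =>
      psi (a p.1) p.2)).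
    apply: closedI; last by apply: seg_closed.
    by apply: closedI; exact: (@closed_preimage _ _ (@snd R M)).
  apply/seteqP; split => -[th x] /=.
    move=> [[Nx Dx] [sN _ nE] C0x]; split => //; split => //.
    by apply: segS sN => z [].
  move=> [[[Nx Dx] sN] C0x]; split => //; split => //.
    apply: flow_pair_avoid => // N1x.
    suff : (C0 `&` pqE N N1) (psi (a th) x) by rewrite C0E.
    by split => //; have [_ ?] := C0C _ C0x; split => //; left.
  move=> Ex; suff : (C0 `&` pqE N N1) (psi (a th) x) by rewrite C0E.
  by split => //; have [Cx ?] := C0C _ C0x; split => //; right; split => //;
    exact: iE.
- move=> th x [Nx Dx] [sN _ nE]; split.
  + by move=> [[N1x|[_ Ex]] _]; [have [] := seg0 (a0 th) sN|exact: nE].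
  + by split; [have [] := seg_end (a0 th) sN|exact: iD].
  + move=> [[N1x|[_ Ex]] _]; first by have [] := seg_end (a0 th) sN.
    exact: nE (iff_inv iE Ex).
Qed.

End Relative.
End FlowPairs.

Arguments salamon {R M} psi {D E A A1} C C1 T _.
Arguments stay {R M} psi {D E N N1} a _.

(** * The index of a disjoint union *)

Section WedgeCombine.
Context {Y : ptopologicalType} (Z : bool -> ptopologicalType).
Variable f : forall i, Y -> Z i.

Let lift i : Z i -> pwedge Z := @wedge_lift bool (fun i => Z i) (fun i => point) i.

(** Under the hypothesis [fd] at most one coordinate differs from the base point, and the wedge
    receives that one. *)
Definition wedge_combine (q : Y) : pwedge Z :=
  if pselect (f true q = point) then lift (f false q) else lift (f true q).

Lemma wedge_lift_point i : lift (point : Z i) = point.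
Proof.
exact: (@wedge_liftE bool (fun i => Z i) (fun=> point) _ (point : Z point) i
  point).
Qed.

Hypothesis fd : forall q, f true q = point \/ f false q = point.

Lemma wedge_combineE i q : f (~~ i) q = point -> wedge_combine q = lift (f i q).
Proof.
rewrite /wedge_combine; case: i => /= fq; case: pselect => //= f1.
by rewrite fq f1 !wedge_lift_point.
Qed.

Lemma wedge_combine_continuous :
  (forall i, continuous (f i)) -> continuous wedge_combine.
Proof.
move=> cf; apply/continuousP => V oV.
have ofV i : open (f i @^-1` (lift (i:=i) @^-1` V)).
  apply: open_comp => [q _|]; first exact: cf.
  apply: open_comp => // q _; exact: wedge_lift_continuous.
(* If [V] contains the base point, both coordinates have to land in [V]; if not, it is enough that
   one does, the other then being the base point. *)
have [Vp|nVp] := pselect (V point).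
  rewrite (_ : _ @^-1` _ = f true @^-1` (lift (i:=true) @^-1` V) `&`
     f false @^-1` (lift (i:=false) @^-1` V)); first exact: openI.
  apply/seteqP; split => q /=.
    case: (fd q) => fq.
      rewrite (@wedge_combineE false) // => Vq; split => //.
      by rewrite fq wedge_lift_point.
    rewrite (@wedge_combineE true) // => Vq; split => //.
    by rewrite fq wedge_lift_point.
  by rewrite /wedge_combine; case: pselect => /= ? [].
rewrite (_ : _ @^-1` _ = f true @^-1` (lift (i:=true) @^-1` V) `|`
     f false @^-1` (lift (i:=false) @^-1` V)); first exact: openU.
apply/seteqP; split => q /=.
  by rewrite /wedge_combine; case: pselect => /= ? ?; [right|left].
case: (fd q) => fq.
  rewrite (@wedge_combineE false) // => -[|//].
  by rewrite fq wedge_lift_point.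
rewrite (@wedge_combineE true) // => -[//|].
by rewrite fq wedge_lift_point.
Qed.

End WedgeCombine.

Section SalamonClass.
Context {R : realType} {M : topologicalType} (psi : R -> M -> M).
Hypotheses (hpsi : is_flow psi).
Variables (D E : set M).
Hypotheses (iD : flow_invariant psi D) (iE : flow_invariant psi E).
Implicit Types (A N C : set M) (x : M).

Definition rel_class A A1 x : rel_quotient D E A A1 :=
  pq_class (pqD D A) (pqE D E A A1) x.

Lemma salamon_class A A1 C C1 T x : 0 <= T -> pqD D A x ->
  salamon psi C C1 T (rel_class A A1 x) =
  partial_class (pqD D C) (pqE D E C C1) (salamon_dom psi D E A A1 C C1 T)
    (psi (3 * T)) x.
Proof.
move=> T0; apply: pq_map_class => {}x Px Qx; rewrite /partial_class.
case: pselect => //= -[sA _ _ nE].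
have /(seg0 hpsi) [|_ nA1] := sA; first by rewrite mulr_ge0.
by case: Qx => -[//|[]].
Qed.

Lemma salamon_point A A1 C C1 T : 0 <= T ->
  salamon psi C C1 T (point : rel_quotient D E A A1) = point.
Proof.
move=> T0; apply: pq_map_point => {}x Px Qx; rewrite /partial_class.
case: pselect => //= -[sA _ _ nE].
have /(seg0 hpsi) [|_ nA1] := sA; first by rewrite mulr_ge0.
by case: Qx => -[//|[]].
Qed.

Lemma stay_class N N1 a x : 0 <= a -> pqD D N x ->
  stay psi a (rel_class N N1 x) =
  partial_class (pqD D N) (pqE D E N N1) (stay_dom psi D E N N1 a) (psi a) x.
Proof.
move=> a0; apply: pq_map_class => {}x Px Qx; rewrite /partial_class.
case: pselect => //= -[sA _ nE].
have [_ nA1] := seg0 hpsi a0 sA.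
by case: Qx => -[//|[]].
Qed.

Lemma stay_point N N1 a : 0 <= a ->
  stay psi a (point : rel_quotient D E N N1) = point.
Proof.
move=> a0; apply: pq_map_point => {}x Px Qx; rewrite /partial_class.
case: pselect => //= -[sA _ nE].
have [_ nA1] := seg0 hpsi a0 sA.
by case: Qx => -[//|[]].
Qed.

Lemma stay0 N N1 (q : rel_quotient D E N N1) : stay psi 0 q = q.
Proof.
case: (pqP q) => [|x Px Qx]; first exact: stay_point.
rewrite [LHS](stay_class _ (lexx 0) Px) /partial_class; case: pselect => [_|nS] /=.
  by rewrite (flow0 hpsi).
case: nS; split; last by move=> Ex; apply: Qx; split; [right; split=> //|]; case: Px.
  move=> t; rewrite -eq_le => /eqP <-; rewrite (flow0 hpsi); case: Px => Nx Dx.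
  by split => // N1x; apply: Qx; split => //; left.
by case: Px.
Qed.

(** A composite of two comparison maps advances by [6 * T], like [stay psi (6 * T)], so that only
    the domains remain to be compared. *)
Lemma salamon2_class A A1 C C1 B B1 T x : 0 <= T -> pqD D A x ->
  salamon psi B B1 T (salamon psi C C1 T (rel_class A A1 x)) =
  if pselect (salamon_dom psi D E A A1 C C1 T x /\
     salamon_dom psi D E C C1 B B1 T (psi (3 * T) x))
  then rel_class B B1 (psi (6 * T) x) else point.
Proof.
move=> T0 Px; rewrite (salamon_class _ _ _ T0 Px) {1}/partial_class.
case: (pselect (salamon_dom psi D E A A1 C C1 T x)) => [S1|nS1] /=; last first.
  by rewrite salamon_point //; case: pselect => // -[].
have [sA sC Dx nE] := S1.
rewrite [LHS](salamon_class _ _ _ T0); last first.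
  have [] := seg_end _ sC; first by lra.
  by move=> Cx _; split => //; exact: iD.
rewrite /partial_class; case: pselect => S2 /=; last by case: pselect => // -[].
case: pselect => /= [?|[]] //.
by rewrite (flowD hpsi) -mulrDl; congr (rel_class _ _ (psi (_ * _) x)); lra.
Qed.

Lemma salamon_neq_point A A1 C C1 T x : 0 <= T -> pqD D A x ->
  salamon psi C C1 T (rel_class A A1 x) <> point ->
  salamon_dom psi D E A A1 C C1 T x.
Proof.
by move=> T0 Px; rewrite (salamon_class _ _ _ T0 Px) /partial_class; case: pselect.
Qed.

End SalamonClass.

(** * Homotopy equivalence between one index space and the wedge of two others *)

Section Decomposition.
Context {R : realType} {M : topologicalType} (psi : R -> M -> M).
Hypotheses (hpsi : is_flow psi).
Variables (D E : set M).
Hypotheses (cD : closed D) (cE : closed E).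
Hypotheses (iD : flow_invariant psi D) (iE : flow_invariant psi E).
Variables (N N1 : set M) (K K1 U : bool -> set M) (tau : R).
Hypotheses (pN : flow_pair psi N N1) (pK : forall i, flow_pair psi (K i) (K1 i)).
Hypotheses (oU : forall i, open (U i)) (U_disj : U true `&` U false = set0).
Hypotheses (UN : forall i, U i `<=` N `\` N1) (UK : forall i, U i `<=` K i `\` K1 i).
Hypothesis tau0 : 0 < tau.

Local Notation seg := (seg psi).

Hypothesis thrN : forall x, seg (- tau) tau (N `\` N1) x -> U true x \/ U false x.
Hypothesis thrK : forall i x, seg (- tau) tau (K i `\` K1 i) x -> U i x.

(** Locating an orbit in [U] costs [tau] at both ends of a window. With this [T] the windows
    [0, 4 tau] and [2 tau, 6 tau] shrink to [tau, 3 tau] and [3 tau, 5 tau], which still meet, at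
    [3 * tau]. *)
Local Notation T := (2 * tau).

Lemma seg_threshold (A V : set M) a b x :
  (forall y, seg (- tau) tau A y -> V y) -> seg a b A x ->
  seg (a + tau) (b - tau) V x.
Proof.
have t0 := tau0.
move=> AV sA t /andP[at_ tb]; apply: AV; apply/(seg_shift hpsi).
by apply: segW sA; lra.
Qed.

Lemma disjU i j x : U i x -> U j x -> i = j.
Proof.
move: i j => [] [] // U1 U2; suff : (U true `&` U false) x by rewrite U_disj.
  by [].
by [].
Qed.

(** By [thrN] the shortened segment lies in the union of two disjoint open sets, and a connected
    orbit piece cannot pass from one to the other. *)
Lemma segU_connected i a b c x : seg a b (N `\` N1) x -> a + tau <= c <= b - tau ->
  U i (psi c x) -> seg (a + tau) (b - tau) (U i) x.
Proof.
move=> sN cab Uc; apply: (@seg_connected _ _ _ hpsi _ _ c _ (U (~~ i))) => //.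
  apply/seteqP; split => // z [Uz nUz]; have := disjU Uz nUz.
  by case: (i).
move: (seg_threshold thrN sN); apply: segS => z.
by case: (i) => /= -[]; [left|right|right|left].
Qed.

Lemma segK i a b x : seg a b (K i `\` K1 i) x -> seg (a + tau) (b - tau) (U i) x.
Proof. by apply: seg_threshold => y; exact: thrK. Qed.

Lemma segNK i x : seg 0 (2 * T) (N `\` N1) x -> seg T (3 * T) (K i `\` K1 i) x ->
  seg tau (5 * tau) (U i) x.
Proof.
have t0 := tau0.
move=> /[dup] sN0 sN /segK sK.
have H : U i (psi (3 * tau) x) by apply: sK; lra.
have h : 0 + tau <= 3 * tau <= 2 * T - tau by lra.
have s1 := segU_connected sN h H.
apply: (@seg_cat _ _ _ tau (3 * tau) (3 * tau)) => //.
  by apply: segW s1; lra.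
by apply: segW sK; lra.
Qed.

Lemma segKN i x : seg 0 (2 * T) (K i `\` K1 i) x -> seg T (3 * T) (N `\` N1) x ->
  seg tau (5 * tau) (U i) x.
Proof.
have t0 := tau0.
move=> /segK sK sN.
have H : U i (psi (3 * tau) x) by apply: sK; lra.
have h : T + tau <= 3 * tau <= 3 * T - tau by lra.
have s1 := segU_connected sN h H.
apply: (@seg_cat _ _ _ tau (3 * tau) (3 * tau)) => //.
  by apply: segW sK; lra.
by apply: segW s1; lra.
Qed.

Local Notation dom A A1 C C1 := (salamon_dom psi D E A A1 C C1 T).

Lemma dom_NK_disj i j x : dom N N1 (K i) (K1 i) x -> dom N N1 (K j) (K1 j) x ->
  i = j.
Proof.
have t0 := tau0.
move=> [sN si _ _] [_ sj _ _].
have h : tau <= 3 * tau <= 5 * tau by lra.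
exact: (disjU (segNK sN si h) (segNK sN sj h)).
Qed.

(** The windows in [N] leave the gap from [2 * T] to [4 * T]. The windows in [K i] cover it with
    margin [T], so the orbit is in [U i] there, hence in [N] and off [N1]. *)
Lemma dom_NKN i x : dom N N1 (K i) (K1 i) x ->
  dom (K i) (K1 i) N N1 (psi (3 * T) x) ->
  stay_dom psi D E N N1 (6 * T) x.
Proof.
have t0 := tau0.
move=> [sN sK Dx nEx] [/(seg_shift hpsi) sK' /(seg_shift hpsi) sN' _ _]; split => //.
have {}sK : seg T (5 * T) (K i `\` K1 i) x.
  apply: (@seg_cat _ _ _ T (3 * T) (3 * T)) => //.
  by apply: segW sK'; lra.
have sU : seg (2 * T) (4 * T) (N `\` N1) x.
  apply: segS (@UN i) _; apply: segW (segK sK); lra.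
apply: (@seg_cat _ _ _ 0 (4 * T) (4 * T)); first exact: lexx.
  by apply: (@seg_cat _ _ _ 0 (2 * T) (2 * T)).
by apply: segW sN'; lra.
Qed.

(** The summand is read off at time [tau]; connectedness keeps the orbit in the same [U i] up to
    [11 * tau], which contains both windows required in [K i]. *)
Lemma stay_NKN x : stay_dom psi D E N N1 (6 * T) x ->
  exists i, dom N N1 (K i) (K1 i) x /\ dom (K i) (K1 i) N N1 (psi (3 * T) x).
Proof.
have t0 := tau0.
move=> [sN Dx nEx].
have [i Ui] : exists i, U i (psi tau x).
  have [] := seg_threshold thrN sN (t := tau); first by lra.
    by exists true.
  by exists false.
have sU : seg tau (11 * tau) (U i) x.
  have h : 0 + tau <= tau <= 6 * T - tau by lra.
  by apply: segW (segU_connected sN h Ui); lra.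
have sK : seg T (5 * T) (K i `\` K1 i) x.
  by apply: segS (@UK i) _; apply: segW sU; lra.
exists i; split; split => //.
- by apply: segW sN; lra.
- by apply: segW sK; lra.
- by apply/(seg_shift hpsi); apply: segW sK; lra.
- by apply/(seg_shift hpsi); apply: segW sN; lra.
- exact: iD.
- by move=> /(iE (- (3 * T))); rewrite (flowK hpsi).
Qed.

(** The long stay in [N] carries the summand [i], known at time [3 * tau], to time [9 * tau], where
    the second window in [K j] determines [j]. The mixed composites of the wedge are therefore
    trivial. *)
Lemma dom_KNK i j x : dom (K i) (K1 i) N N1 x ->
  dom N N1 (K j) (K1 j) (psi (3 * T) x) ->
  i = j /\ stay_dom psi D E (K i) (K1 i) (6 * T) x.
Proof.
have t0 := tau0.
move=> [sK sN Dx nEx] [/(seg_shift hpsi) sN' /(seg_shift hpsi) sK' _ _].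
have {}sN : seg T (5 * T) (N `\` N1) x.
  apply: (@seg_cat _ _ _ T (3 * T) (3 * T)) => //.
  by apply: segW sN'; lra.
have H : U i (psi (3 * tau) x) by apply: (segK sK); lra.
have sU : seg (3 * tau) (9 * tau) (U i) x.
  have h : T + tau <= 3 * tau <= 5 * T - tau by lra.
  by apply: segW (segU_connected sN h H); lra.
have ij : i = j.
  apply: (@disjU _ _ (psi (9 * tau) x)); first by apply: sU; lra.
  by apply: (segK sK'); lra.
split => //; split => //; rewrite -ij in sK'.
have sUK : seg (3 * tau) (9 * tau) (K i `\` K1 i) x by apply: segS (@UK i) _.
apply: (@seg_cat _ _ _ 0 (9 * tau) (4 * T)); first by lra.
  by apply: (@seg_cat _ _ _ 0 (2 * T) (3 * tau)) => //; lra.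
by apply: segW sK'; lra.
Qed.

Lemma stay_KNK i x : stay_dom psi D E (K i) (K1 i) (6 * T) x ->
  dom (K i) (K1 i) N N1 x /\ dom N N1 (K i) (K1 i) (psi (3 * T) x).
Proof.
have t0 := tau0.
move=> [sK Dx nEx].
have sN : seg T (5 * T) (N `\` N1) x.
  by apply: segS (@UN i) _; apply: segW (segK sK); lra.
split; split => //.
- by apply: segW sK; lra.
- by apply: segW sN; lra.
- by apply/(seg_shift hpsi); apply: segW sN; lra.
- by apply/(seg_shift hpsi); apply: segW sK; lra.
- exact: iD.
- by move=> /(iE (- (3 * T))); rewrite (flowK hpsi).
Qed.


Local Notation Y := (rel_quotient D E N N1).
Local Notation Z := (fun i => rel_quotient D E (K i) (K1 i)).

Let f i : Y -> Z i := salamon psi (K i) (K1 i) T.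
Let g i : Z i -> Y := salamon psi N N1 T.

Let T0 : 0 <= T. Proof. by rewrite mulr_ge0 // ltW. Qed.
Let T6 : 0 <= 6 * T. Proof. by rewrite mulr_ge0. Qed.

Let closedCU i : closed (~` U i).
Proof. exact: open_closedC. Qed.

Lemma f_continuous i : continuous (f i).
Proof.
have t0 := tau0.
apply: (@salamon_continuous _ _ _ hpsi _ _ _ _ _ _ _ _ _ _ (U i) (~` U (~~ i))) => //.
- by rewrite mulr_gt0.
- by move=> x /UK [].
- move=> x sN sK; have sU := segNK sN sK.
  split; first by apply: sU; lra.
  have Ui : U i (psi (2 * T) x) by apply: sU; lra.
  by move=> /(disjU Ui); case: (i).
- move=> x /segK sK _; have Ui : U i (psi (2 * T) x) by apply: sK; lra.
  by case: (UN Ui).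
Qed.

Lemma g_continuous i : continuous (@g i).
Proof.
have t0 := tau0.
apply: (@salamon_continuous _ _ _ hpsi _ _ _ _ _ _ _ _ _ _ (U i) (~` U (~~ i))) => //.
- by rewrite mulr_gt0.
- by move=> x /UN [].
- move=> x sK sN; have sU := segKN sK sN.
  split; first by apply: sU; lra.
  have Ui : U i (psi (2 * T) x) by apply: sU; lra.
  by move=> /(disjU Ui); case: (i).
(* The window in [N] places the point only in one of the two sets [U]; the condition [V], the
   complement of the other one, decides which. *)
- move=> x sN nU; have : U true (psi (2 * T) x) \/ U false (psi (2 * T) x).
    by apply: (seg_threshold thrN sN); lra.
  move=> H; have Ui : U i (psi (2 * T) x) by move: nU H; case: (i) => /= ? [].
  by case: (UK Ui).
Qed.

Lemma f_point i : f i point = point. Proof. exact: salamon_point. Qed.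
Lemma g_point i : @g i point = point. Proof. exact: salamon_point. Qed.

Lemma f_disj q : f true q = point \/ f false q = point.
Proof.
case: (pqP q) => [|x Px Qx]; first by left; exact: f_point.
have [|ft] := pselect (f true (pq_class (pqD D N) (pqE D E N N1) x) = point);
  first by left.
right; apply: contrapT => ff.
have := dom_NK_disj (salamon_neq_point hpsi T0 Px ft) (salamon_neq_point hpsi T0 Px
  ff).
by [].
Qed.

(** If [q] stays for [6 * T], the index [i] is the summand through which it passes. Otherwise [g]
    after [f i] gives the base point for both indices, and any [i] whose opposite coordinate is
    trivial will do. *)
Lemma gfE q : exists2 i, wedge_combine f q = wedge_lift _ (f i q) &
  g (f i q) = stay psi (6 * T) q.
Proof.
case: (pqP q) => [|x Px Qx].
  exists true; first by apply: wedge_combineE; exact: f_point.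
  by rewrite f_point g_point (stay_point hpsi).
rewrite -/(rel_class D E N N1 x).
have Egf i : g (f i (rel_class D E N N1 x)) =
    if pselect (salamon_dom psi D E N N1 (K i) (K1 i) T x /\
     salamon_dom psi D E (K i) (K1 i) N N1 T (psi (3 * T) x))
    then rel_class D E N N1 (psi (6 * T) x) else point.
  exact: salamon2_class.
have Es : stay psi (6 * T) (rel_class D E N N1 x) =
    if pselect (stay_dom psi D E N N1 (6 * T) x)
    then rel_class D E N N1 (psi (6 * T) x) else point.
  exact: stay_class.
have [S|nS] := pselect (stay_dom psi D E N N1 (6 * T) x).
  have [i [Si S'i]] := stay_NKN S.
  exists i; last by rewrite Egf Es; 
    by case: pselect => /= [?|[]] //; case: pselect => /= [?|[]].
  apply: wedge_combineE.
  apply: contrapT => fn; have := dom_NK_disj Si (salamon_neq_point hpsi T0 Px fn).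
  by case: (i).
have nE i : g (f i (rel_class D E N N1 x)) = stay psi (6 * T) (rel_class D E N N1 x).
  rewrite Egf Es; case: pselect => /= [[Si S'i]|_]; last by case: pselect.
  by case: nS; exact: dom_NKN Si S'i.
have [fp|fp] := f_disj (rel_class D E N N1 x).
  by exists false => //; apply: wedge_combineE.
by exists true => //; apply: wedge_combineE.
Qed.

Lemma fgE i q : wedge_combine f (g q) = wedge_lift _ (stay psi (6 * T) (q : Z i)).
Proof.
have [fn fi] : f (~~ i) (g q) = point /\ f i (g q) = stay psi (6 * T) (q : Z i).
  case: (pqP q) => [|x Px Qx]; first by rewrite g_point !f_point (stay_point hpsi).
  rewrite -/(rel_class D E (K i) (K1 i) x).
  have Efg j : f j (g (rel_class D E (K i) (K1 i) x)) =
    if pselect (salamon_dom psi D E (K i) (K1 i) N N1 T x /\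
     salamon_dom psi D E N N1 (K j) (K1 j) T (psi (3 * T) x))
    then rel_class D E (K j) (K1 j) (psi (6 * T) x) else point.
    exact: salamon2_class.
  have Es : stay psi (6 * T) (rel_class D E (K i) (K1 i) x) =
    if pselect (stay_dom psi D E (K i) (K1 i) (6 * T) x)
    then rel_class D E (K i) (K1 i) (psi (6 * T) x) else point.
    exact: stay_class.
  split.
    rewrite Efg; case: pselect => //= -[Si Sj].
    by have [] := dom_KNK Si Sj; case: (i).
  rewrite Efg Es; case: pselect => /= [[Si Sj]|nS].
    by have [_ S] := dom_KNK Si Sj; case: pselect.
  by case: pselect => //= S; case: nS; exact: stay_KNK.
by rewrite -fi; apply: wedge_combineE.
Qed.

Lemma decomposition_wedge : same_homotopy_type R Y (pwedge Z).
Proof.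
have gp i j : g (point : Z i) = g (point : Z j) by rewrite !g_point.
(* The time decreases from [6 * T] at 0 to 0 at 1; the maximum keeps it nonnegative for all real
   [s], so that [stay_continuous] applies on the whole line. *)
pose a (s : R) := 6 * T * Num.max 0 (1 - s).
have ca : continuous a.
  move=> s; apply: cvgM; first exact: cvg_cst.
  apply: (@continuous_max R R (cst 0) (fun s => 1 - s)); first exact: cvg_cst.
  by apply: cvgB; [exact: cvg_cst|exact: cvg_id].
have a0 s : 0 <= a s by rewrite mulr_ge0 // le_max lexx.
have a0E : a 0 = 6 * T by rewrite /a subr0 max_r ?mulr1.
have a1E : a 1 = 0 by rewrite /a subrr max_r ?mulr0.
exists (wedge_combine f), (wedge_fun (@g)); split.
- split; last by rewrite (@wedge_combineE _ _ f true) ?f_point ?wedge_lift_point.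
  by apply: wedge_combine_continuous; [exact: f_disj|exact: f_continuous].
- split; last by rewrite /point /= wedge_lift_funE // g_point.
  by apply: wedge_fun_continuous => // i; exact: g_continuous.
- exists (fun s q => stay psi (a s) q); split.
  + by apply: continuous_subspaceT; exact: stay_continuous.
  + apply/funext => q /=; rewrite a0E; have [i -> <-] := gfE q.
    by rewrite wedge_lift_funE.
  + by apply/funext => q /=; rewrite a1E (stay0 hpsi).
  + by move=> s _; exact: stay_point.
pose h i s (q : Z i) : pwedge Z := wedge_lift _ (stay psi (a s) q).
have hp s i j : h i s point = h j s point.
  by rewrite /h !(stay_point hpsi) // !wedge_lift_point.
have liftP (w : pwedge Z) : exists i (q : Z i), w = wedge_lift _ q.
  have : [set: pwedge Z] w by [].
  by rewrite -[X in X w]wedgeTE => -[i _ [q _ <-]]; exists i, q.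
exists (fun s => wedge_fun (fun i => h i s)); split.
- apply: continuous_subspaceT.
  rewrite (_ : (fun p => _) = uncurry (fun s => wedge_fun (fun i => h i s)));
    last first.
    by apply/funext => -[].
  apply: (@wedge_fun_joint_continuous bool (fun i => Z i) (fun i => point) R
    (pwedge Z) (fun i s => h i s)).
  + exact: finite_finset.
  (* Joint continuity on the wedge requires the base points to be closed; upstairs the base point of
     summand [i] is the collapsed set. *)
  + move=> i; apply/pq_closedP; first by apply: closedI => //; have [] := pK i.
    rewrite (_ : [set x | _] = pqE D E (K i) (K1 i) `&` pqD D (K i)).
      have [kK cK cK1 _ _] := pK i.
      by apply: closedI; apply: closedI => //; apply: closedU => //; exact: closedI.
    apply/seteqP; split => x /= [].
      move=> Px /= H; split => //; apply: contrapT => Qx.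
      exact: (pq_class_neq_point Px Qx).
    by move=> Qx Px; split => //; exact: pq_class_point.
  + by move=> s i j; exact: hp.
  + move=> i.
    have ci := stay_continuous hpsi cD cE iD iE (pK i) ca a0.
    rewrite (_ : uncurry _ = (@wedge_lift bool (fun i => Z i) (fun i => point) i) \o
      (fun p : R * Z i => stay psi (a p.1) p.2)); last by apply/funext => -[].
    by move=> p; apply: continuous_comp; [exact: ci|exact: wedge_lift_continuous].
- apply/funext => w /=; have [i [q ->]] := liftP w.
  by rewrite !wedge_lift_funE // /h a0E fgE.
- apply/funext => w /=; have [i [q ->]] := liftP w.
  by rewrite !wedge_lift_funE // /h a1E (stay0 hpsi).
- by move=> s _; rewrite /point /= wedge_lift_funE // /h (stay_point hpsi) //
  wedge_lift_point.
Qed.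

End Decomposition.

(** * Index pairs of disjoint isolated invariant sets *)

Section IndexWedge.
Context {R : realType} {M : topologicalType} (psi : R -> M -> M).
Hypotheses (hpsi : is_flow psi) (hM : hausdorff_space M) (cM : compact [set: M]).

Lemma disjoint_closed_open (A B : set M) : closed A -> closed B ->
  A `&` B = set0 -> exists V W, [/\ open V, open W, A `<=` V, B `<=` W &
  V `&` W = set0].
Proof.
move=> cA cB AB; have : set_nbhs A (~` B).
  apply/set_nbhsP; exists (~` B); split => //; first exact: closed_openC.
  by move=> x Ax Bx; have : (A `&` B) x by []; rewrite AB.
move=> /(compact_normal hM cM cA) [V /set_nbhsP [W [oW AW WV]] VB].
exists W, (~` closure V); split => //.
- exact/closed_openC/closed_closure.
- by move=> x Bx /VB.
- by apply/seteqP; split => // x [Wx]; apply; apply/subset_closure/WV.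
Qed.

Lemma index_pair_isolation Q N N1 : index_pair psi Q N N1 ->
  exists U, [/\ open U, Q `<=` U, U `<=` N `\` N1 & closed Q].
Proof.
move=> [[kN kN1 _] [[kC _] QE IC] QN1 _ _].
have cN : closed N by exact: compact_closed.
have cN1 : closed N1 by exact: compact_closed.
exists (interior (closure (N `\` N1)) `&` ~` N1); split.
- by apply: openI; [exact: open_interior|exact: closed_openC].
- move=> x Qx; split; first by apply: IC; rewrite -QE.
  by move=> N1x; have : (Q `&` N1) x by []; rewrite QN1.
- move=> x [/interior_subset clx nN1]; split => //.
  by rewrite (closure_id N).1 //; apply: closureS clx; move=> z [].
- by rewrite QE; apply: Inv_closed => //; exact: closed_closure.
Qed.

Lemma index_pair_time Q N N1 U : index_pair psi Q N N1 -> open U -> Q `<=` U ->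
  \forall T \near +oo, forall x, seg psi (- T) T (N `\` N1) x -> U x.
Proof.
move=> [_ [[kC _] QE _] _ _ _] oU QU.
have : \forall T \near pinfty_nbhs R, forall x,
    seg psi (- T) T (closure (N `\` N1)) x -> U x.
  apply: isolation_time => //; first exact: closed_closure.
  by rewrite -QE.
by apply: filterS => T H x sx; apply: H; apply: segS sx; exact: subset_closure.
Qed.

(** An equality of spaces, so that the result for ([D], [E]) is transported to each component of the
    triple by rewriting. *)
Lemma rel_quotientE (D E N N1 P P1 : set M) : pqD D N = P -> pqE D E N N1 = P1 ->
  rel_quotient D E N N1 = pair_quotient P P1 :> ptopologicalType.
Proof. by move=> <- <-. Qed.

Lemma wedge2E (Z : bool -> ptopologicalType) : wedge2 (Z true) (Z false) = pwedge Z.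
Proof. by rewrite /wedge2; congr pwedge; apply/funext => -[]. Qed.

Lemma rel_index_wedge (D E : set M) Q1 Q2 N N1 K K1 L L1 :
  closed D -> closed E -> flow_invariant psi D -> flow_invariant psi E ->
  Q1 `&` Q2 = set0 -> index_pair psi (Q1 `|` Q2) N N1 ->
  index_pair psi Q1 K K1 -> index_pair psi Q2 L L1 ->
  same_homotopy_type R (rel_quotient D E N N1)
    (wedge2 (rel_quotient D E K K1) (rel_quotient D E L L1)).
Proof.
move=> cD cE iD iE Q12 pN pK pL.
have [UN [oUN QUN UNN _]] := index_pair_isolation pN.
have [UK [oUK QUK UKK cQ1]] := index_pair_isolation pK.
have [UL [oUL QUL ULL cQ2]] := index_pair_isolation pL.
have [V1 [V2 [oV1 oV2 QV1 QV2 V12]]] := disjoint_closed_open cQ1 cQ2 Q12.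
(* Each [U i] must lie in both pairs to be compared, off their exit sets, while [V1] and [V2] keep
   the two disjoint. *)
pose U (i : bool) := UN `&` if i then UK `&` V1 else UL `&` V2.
have oU i : open (U i) by case: i; apply: openI => //; exact: openI.
have Q1U : Q1 `<=` U true.
  by move=> x Qx; split; [apply: QUN; left|split; [exact: QUK|exact: QV1]].
have Q2U : Q2 `<=` U false.
  by move=> x Qx; split; [apply: QUN; right|split; [exact: QUL|exact: QV2]].
pose K' (i : bool) := if i then K else L.
pose K1' (i : bool) := if i then K1 else L1.
rewrite -[wedge2 _ _]/(wedge2 (rel_quotient D E (K' true) (K1' true))
  (rel_quotient D E (K' false) (K1' false))).
rewrite (wedge2E (fun i => rel_quotient D E (K' i) (K1' i))).
have t0 : \forall T \near pinfty_nbhs R, 0 < T by apply: nbhs_pinfty_gt;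
  rewrite num_real.
have tN := index_pair_time pN (openU (oU true) (oU false)) (setUSS Q1U Q2U).
have tK := index_pair_time pK (oU true) Q1U.
have tL := index_pair_time pL (oU false) Q2U.
have [tau [[{}t0 {}tN] [{}tK {}tL]]] := filter_ex (filterI (filterI t0 tN) (filterI
  tK tL)).
apply: (@decomposition_wedge R M psi hpsi D E cD cE iD iE N N1 K' K1' U tau).
- exact: index_pair_flow_pair pN.
- by case; [exact: index_pair_flow_pair pK|exact: index_pair_flow_pair pL].
- exact: oU.
- apply/seteqP; split => // x [[_ [_ V1x]] [_ [_ V2x]]].
  by have : (V1 `&` V2) x by []; rewrite V12.
- by move=> i x [/UNN].
- by case=> x [_ []]; [move=> /UKK|move=> /ULL].
- exact: t0.
- exact: tN.
- by case=> x; [exact: tK|exact: tL].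
Qed.

Lemma index_wedge (bd : set M) Q1 Q2 N N1 K K1 L L1 :
  closed bd -> flow_invariant psi bd ->
  Q1 `&` Q2 = set0 -> index_pair psi (Q1 `|` Q2) N N1 ->
  index_pair psi Q1 K K1 -> index_pair psi Q2 L L1 ->
  same_homotopy_types R (index_triple bd N N1)
    (wedge_triple (index_triple bd K K1) (index_triple bd L L1)).
Proof.
move=> cbd ibd Q12 pN pK pL.
have iT : flow_invariant psi setT by [].
have i0 : flow_invariant psi set0 by [].
have H D E cD cE iD iE := @rel_index_wedge D E _ _ _ _ _ _ _ _ cD cE iD iE Q12 pN
  pK pL.
split => /=.
- have E0 A A1 : pqE (@setT M) set0 A A1 = A1 by rewrite /pqE setI0 setU0 setIT.
  have := H setT set0 closedT closed0 iT i0.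
  have E2 A A1 := @rel_quotientE setT set0 A A1 _ _ (setIT _) (E0 A A1).
  by rewrite !E2.
- have := H setT bd closedT cbd iT ibd.
  have E2 A A1 := @rel_quotientE setT bd A A1 _ _ (setIT _) (setIT _).
  by rewrite !E2.
- have E0 A A1 : pqE bd set0 A A1 = A1 `&` bd by rewrite /pqE setI0 setU0.
  have := H bd set0 cbd closed0 ibd i0.
  have E2 A A1 := @rel_quotientE bd set0 A A1 _ _ erefl (E0 A A1).
  by rewrite !E2.
Qed.

End IndexWedge.

(** * The extended phase space and flow *)

Section ExitTime.
Context {R : realType} {T : topologicalType} (phi : R -> T -> T) (B : set T).
Hypotheses (hphi : is_flow phi) (cB : closed B).
Implicit Types x y : T.

Local Notation seg := (seg phi).

Lemma exit_setP x : exit_set phi B x <-> B x /\ forall t, 0 < t -> ~ seg 0 t B x.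
Proof.
by split=> -[Bx H]; split => // t /H nH; apply: contra_not nH => /orb_subset.
Qed.

Lemma entrance_setP x :
  entrance_set phi B x <-> B x /\ forall t, 0 < t -> ~ seg (- t) 0 B x.
Proof.
by split=> -[Bx H]; split => // t /H nH; apply: contra_not nH => /orb_subset.
Qed.

Lemma exit_max x r t : exit_set phi B (phi r x) -> seg r t B x -> t <= r.
Proof.
move=> /exit_setP [_ H] sB; rewrite leNgt; apply/negP => rt.
apply: (H (t - r)); first by rewrite subr_gt0.
by apply/(seg_shift hphi); rewrite add0r subrK.
Qed.

Lemma entrance_min x r t : entrance_set phi B (phi r x) -> seg t r B x -> r <= t.
Proof.
move=> /entrance_setP [_ H] sB; rewrite leNgt; apply/negP => rt.
apply: (H (r - t)); first by rewrite subr_gt0.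
by apply/(seg_shift hphi); rewrite add0r opprB subrK.
Qed.

Variant exit_spec x : \bar R -> Prop :=
| NoExit of (forall t, 0 <= t -> B (phi t x)) : exit_spec x +oo%E
| Exit r of 0 <= r & seg 0 r B x & exit_set phi B (phi r x) : exit_spec x r%:E.

Variant entrance_spec x : \bar R -> Prop :=
| NoEntrance of (forall t, t <= 0 -> B (phi t x)) : entrance_spec x -oo%E
| Entrance r of r <= 0 & seg r 0 B x & entrance_set phi B (phi r x) :
    entrance_spec x r%:E.

(** The supremum is attained when finite because [B] is closed, and its maximality makes the end
    point an immediate exit point. *)
Lemma exit_timeP x : B x -> exit_spec x (exit_time phi B x).
Proof.
move=> Bx; pose S := [set t | 0 <= t /\ seg 0 t B x].
have ES : exit_time phi B x = ereal_sup [set t%:E | t in S].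
  rewrite /exit_time; congr ereal_sup; congr image.
  by apply/seteqP; split => t [t0 /orb_subset st].
have S0 : S 0.
  split => // t; rewrite -eq_le => /eqP <-; by rewrite (flow0 hphi).
rewrite ES; case E : (ereal_sup _) => [r| |].
- have r0 : 0 <= r by rewrite -lee_fin -E; apply: ereal_sup_ubound; exists 0.
  have sr : forall t, 0 <= t -> t < r -> B (phi t x).
    move=> t t0 tr; have : (t%:E < ereal_sup [set t%:E | t in S])%E
      by rewrite E lte_fin.
    move=> /ereal_sup_gt [_ [u [u0 su] <-]]; rewrite lte_fin => tu.
    by apply: su; rewrite t0 ltW.
  have Br : B (phi r x).
    have [->|rn0] := eqVneq r 0; first by rewrite (flow0 hphi).
    have rgt : 0 < r by rewrite lt_neqAle eq_sym rn0.
    apply: cB => V Vr; have : nbhs r ((fun t =>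
      phi t x) @^-1` V) by exact: continuous_orbit.
    move=> /nbhs_ballP [d /= d0 dV].
    (* A time before [r] within distance [d] of it; the alternative [r / 2] keeps it nonnegative
       when [d] is large. *)
    have [t [t0 tr td]] : exists t, [/\ 0 <= t, t < r & r - t < d].
      have [h|h] := leP (r / 2) (r - d / 2).
        by exists (r - d / 2); split; lra.
      by exists (r / 2); split; lra.
    exists (phi t x); split; first exact: sr.
    by apply: dV; rewrite /ball /= ltr_norml; lra.
  apply: Exit => //.
    move=> t /andP[t0]; rewrite le_eqVlt => /predU1P[->//|]; exact: sr.
  apply/exit_setP; split => // t t0 /(seg_shift hphi) sB.
  have : S (r + t).
    split; first by lra.
    apply: (@seg_cat _ _ _ 0 r r) => //; last by rewrite addrC -{1}(add0r r).
    by move=> v /andP[v0]; rewrite le_eqVlt => /predU1P[->//|]; exact: sr.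
  move=> Srt; have : ((r + t)%:E <= ereal_sup [set t%:E | t in S])%E.
    by apply: ereal_sup_ubound; exists (r + t).
  by rewrite E lee_fin; lra.
- apply: NoExit => t t0; have : (t%:E < ereal_sup [set t%:E | t in S])%E
  by rewrite E ltry.
  move=> /ereal_sup_gt [_ [u [u0 su] <-]]; rewrite lte_fin => tu.
  by apply: su; rewrite t0 ltW.
- have : (0%:E <= ereal_sup [set t%:E | t in S])%E by apply: ereal_sup_ubound;
  exists 0.
  by rewrite E.
Qed.

End ExitTime.

Section EntranceTime.
Context {R : realType} {T : topologicalType} (phi : R -> T -> T) (B : set T).
Hypotheses (hphi : is_flow phi) (cB : closed B).

Let psi t := phi (- t).

Lemma reverse_flow : is_flow psi.
Proof.
split; rewrite /psi.
- apply: (@flow_continuous _ _ _ hphi _ (fun p : R * T => - p.1) snd) => p.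
    by apply: cvgN; exact: cvg_fst.
  exact: cvg_snd.
- by move=> x; rewrite oppr0 (flow0 hphi).
- by move=> s t x; rewrite (flowD hphi) opprD.
Qed.

Lemma reverse_seg a b A x : seg psi a b A x <-> seg phi (- b) (- a) A x.
Proof.
split=> H t tab; last by apply: H; rewrite !lerN2 andbC.
by rewrite -(opprK t); apply: H; rewrite lerNr lerNl andbC.
Qed.

(** Reversing time turns the entrance time into minus an exit time and the entrance set into an exit
    set. *)
Lemma entrance_timeP x : B x -> entrance_spec phi B x (entrance_time phi B x).
Proof.
move=> Bx.
have -> : entrance_time phi B x = (- exit_time psi B x)%E.
  rewrite /exit_time -ereal_infN /entrance_time; congr ereal_inf.
  apply/seteqP; split => [_ [t [t0 /orb_subset st] <-]|_ [_ [t [t0 /orb_subset st]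
    <-] <-]].
    exists (- t)%:E; last by rewrite /= opprK.
    exists (- t) => //; split; first by rewrite oppr_ge0.
    by apply/orb_subset/reverse_seg; rewrite opprK oppr0.
  exists (- t) => //; split; first by rewrite oppr_le0.
  by apply/orb_subset; move/reverse_seg : st; rewrite oppr0.
case: (exit_timeP reverse_flow cB Bx) => [H|r r0 sr Br] /=.
  by apply: NoEntrance => t t0; rewrite -(opprK t); apply: H; rewrite oppr_ge0.
apply: Entrance; first by rewrite oppr_le0.
  by move/reverse_seg : sr; rewrite oppr0.
apply/entrance_setP; have /exit_setP [Bx' H] := Br; split => // t t0 sB.
by apply: (H t t0); apply/reverse_seg; rewrite oppr0.
Qed.

End EntranceTime.

(** * Coordinates, separation and compactness of the extended phase space *)

Section Embedding.
Context {R : realType} {T : topologicalType} (phi : R -> T -> T) (B : set T)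
  (rp rm : R -> T -> T) (bp bm : set T).
Hypotheses (hT : hausdorff_space T) (kB : compact B).
Local Notation Bp := (entrance_set phi B).
Local Notation Bm := (exit_set phi B).
Hypotheses (cBp : closed Bp) (cBm : closed Bm).
Hypotheses (hrp : retraction rp Bp bp) (hrm : retraction rm Bm bm).

Local Notation H := (hatH phi B rp rm).
Local Notation pcs := (pieces phi B rp rm).

Definition piece_coord (a : pcs) : R * T :=
  match a with
  | existT None x => (0, set_val x)
  | existT (Some true) p => (- (set_val p).1, (set_val p).2)
  | existT (Some false) p => set_val p
  end.

(* B lies at height 0, the collar of the exit set above it and the collar of
   the entrance set below it. *)
Definition hat_coord (q : H) : R * T := piece_coord (repr q).

Let rel := clos_refl_sym_trans pcs (@Defs.glue R T phi B rp rm).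

Lemma rel_coord a b : rel a b -> piece_coord a = piece_coord b.
Proof.
elim=> //=; last by move=> ? ? ? _ -> _ ->.
by move=> _ _ [p x /= ->|p x /= ->] //=; rewrite oppr0.
Qed.

Lemma pi_eqP (a b : pcs) : \pi_H a = \pi_H b <-> rel a b.
Proof.
by split=> [/eqmodP /asboolP|ab]; last apply/eqmodP/asboolP.
Qed.

Lemma hat_coord_pi (a : pcs) : hat_coord (\pi_H a) = piece_coord a.
Proof. by rewrite /hat_coord; case: piP => b /pi_eqP /rel_coord ->. Qed.

Lemma Bm_sub : Bm `<=` B. Proof. by move=> x []. Qed.
Lemma Bp_sub : Bp `<=` B. Proof. by move=> x []. Qed.

Lemma r0m x : Bm x -> rm 0 x = x.
Proof. by case: hrm => _ _ [_ h] _ _; exact: h. Qed.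
Lemma r0p x : Bp x -> rp 0 x = x.
Proof. by case: hrp => _ _ [_ h] _ _; exact: h. Qed.

Lemma rel_in_m (p : set_type (beta_m phi B rm)) (x : set_type B) :
  set_val p = (0, set_val x) -> rel (in_m rp p) (in_B phi rp rm x).
Proof. by move=> px; apply: rst_step; exact: glue_m. Qed.

Lemma rel_in_p (p : set_type (beta_p phi B rp)) (x : set_type B) :
  set_val p = (0, set_val x) -> rel (in_p rm p) (in_B phi rp rm x).
Proof. by move=> px; apply: rst_step; exact: glue_p. Qed.

(** The sign of the height separates the pieces except at height 0; there a collar point is [r 0 x],
    which equals [x], and is glued to [B]. *)
Lemma piece_coord_inj a b : piece_coord a = piece_coord b -> rel a b.
Proof.
have m0 (p : set_type (beta_m phi B rm)) : (set_val p).1 = 0 ->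
    exists x : set_type B, set_val p = (0, set_val x).
  have [s [x [s01 Bx E]]] : beta_m phi B rm (set_val p) := set_valP p.
  rewrite E /= => s0; exists (exist _ x (mem_set (Bm_sub Bx))).
  by rewrite s0 r0m.
have p0 (p : set_type (beta_p phi B rp)) : (set_val p).1 = 0 ->
    exists x : set_type B, set_val p = (0, set_val x).
  have [s [x [s01 Bx E]]] : beta_p phi B rp (set_val p) := set_valP p.
  rewrite E /= => s0; exists (exist _ x (mem_set (Bp_sub Bx))).
  by rewrite s0 r0p.
have gem (p : set_type (beta_m phi B rm)) : 0 <= (set_val p).1.
  by have [s [x [/andP[s0 _] Bx ->]]] : beta_m phi B rm (set_val p) := set_valP p.
have gep (p : set_type (beta_p phi B rp)) : 0 <= (set_val p).1.
  by have [s [x [/andP[s0 _] Bx ->]]] : beta_p phi B rp (set_val p) := set_valP p.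
have mB p x : piece_coord (in_m rp p) = piece_coord (in_B phi rp rm x) ->
    rel (in_m rp p) (in_B phi rp rm x) by exact: rel_in_m.
have pB p x : piece_coord (in_p rm p) = piece_coord (in_B phi rp rm x) ->
    rel (in_p rm p) (in_B phi rp rm x).
  move=> /= [/eqP]; rewrite oppr_eq0 => /eqP E1 E2; apply: rel_in_p.
  by rewrite -E1 -E2; case: (set_val p).
have mp p p' : piece_coord (in_m rp p) = piece_coord (in_p rm p') ->
    rel (in_m rp p) (in_p rm p').
  move=> E; have E1 : (set_val p).1 = - (set_val p').1 by rewrite [LHS](congr1 fst E).
  have := gem p; have := gep p'; rewrite E1 oppr_ge0 => h1 h2.
  have z : (set_val p').1 = 0 by apply/eqP; rewrite eq_le h1 h2.
  have [x px] := p0 p' z.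
  apply: (rst_trans _ _ _ (in_B phi rp rm x)); last by apply/rst_sym/rel_in_p.
  by apply: mB; rewrite E /= px /= oppr0.
case: a b => -[[]|] p [[[]|] p'] E.
- rewrite (_ : p = p'); first exact: rst_refl.
  apply: val_inj; case: E => E1 E2; rewrite [LHS]surjective_pairing.
  by rewrite [RHS]surjective_pairing; congr pair => //; apply: oppr_inj.
- by apply: rst_sym; exact: mp.
- exact: pB.
- exact: mp.
- by rewrite (_ : p = p'); [exact: rst_refl|exact: val_inj].
- exact: mB.
- by apply: rst_sym; exact: pB.
- by apply: rst_sym; exact: mB.
- by rewrite (_ : p = p'); [exact: rst_refl|apply: val_inj; case: E].
Qed.

Lemma hat_coord_inj : injective hat_coord.
Proof.
move=> q q'; rewrite -[q]reprK -[q']reprK !hat_coord_pi => /piece_coord_inj E.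
exact/pi_eqP.
Qed.

Lemma hat_coord_continuous : continuous hat_coord.
Proof.
apply: repr_comp_continuous.
  have cp i : continuous (fun p : piece phi B rp rm i => piece_coord (existT _ i p)).
    case: i => [[]|] /=.
    - apply: continuous_pair; last exact/continuous_sndP/set_val_continuous.
      have c1 : continuous (fun p : set_type (beta_p phi B rp) => (set_val p).1).
        exact/continuous_fstP/set_val_continuous.
      by move=> p; apply: (continuous_comp (c1 p)); exact: opp_continuous.
    - exact: set_val_continuous.
    - by apply: continuous_pair; [exact: cst_continuous|exact: set_val_continuous].
  by move=> [i p] V nV; apply: existT_continuous; exact: (cp i p V nV).
by move=> a b /eqP /pi_eqP /rel_coord ->.
Qed.

Lemma continuous_coord (Z : topologicalType) (f : Z -> H) :
  continuous f -> continuous (fun z => hat_coord (f z)).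
Proof.
move=> cf z; apply: (@continuous_comp _ _ _ f hat_coord); first exact: cf.
exact: hat_coord_continuous.
Qed.

Lemma hausdorff_hatH : hausdorff_space H.
Proof.
apply: hausdorff_inj hat_coord_continuous hat_coord_inj.
by apply: hausdorff_prod => //; exact: Rhausdorff.
Qed.

(** The retraction is continuous only on [0, 1] x [C], so an equation involving it is not a closed
    condition on the whole space; membership in its compact graph is. *)
Definition retraction_graph (r : R -> T -> T) (C : set T) : set ((R * T) * T) :=
  [set p | [/\ 0 <= p.1.1 <= 1, C p.1.2 & p.2 = r p.1.1 p.1.2]].

Lemma compact_retraction_graph r C : compact C ->
  {within `[0, 1] `*` C, continuous (fun p : R * T => r p.1 p.2)} ->
  compact (retraction_graph r C).
Proof.
move=> kC cr; rewrite (_ : retraction_graph r C =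
    (fun p : R * T => (p, r p.1 p.2)) @` (`[0, 1] `*` C)).
  apply: continuous_compact; last by apply: compact_setX => //;
    exact: segment_compact.
  by apply: continuous_pair => // p; exact: incl_subspace_continuous.
apply/seteqP; split => [[[s x] y] [/= s01 Cx /= ->]|_ [[s x] /= [s01 Cx] <-]].
  by exists (s, x) => //; split => //=; rewrite in_itv.
by split => //; rewrite /= in_itv in s01.
Qed.

Lemma compact_mapping_graph r C : compact C ->
  {within `[0, 1] `*` C, continuous (fun p : R * T => r p.1 p.2)} ->
  compact (mapping_graph r C).
Proof.
move=> kC cr; have kG := compact_retraction_graph kC cr.
rewrite (_ : mapping_graph r C = (fun p : (R * T) * T =>
  (p.1.1, p.2)) @` retraction_graph r C).
  apply: continuous_compact kG; apply: continuous_subspaceT.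
  apply: continuous_pair; last by move=> p; exact: cvg_snd.
  by apply: continuous_fstP; move=> p; exact: cvg_fst.
apply/seteqP; split => [_ [s [x [s01 Cx ->]]]|_ [[[s x] y] [/= s01 Cx /= ->] <-]].
  by exists (s, x, r s x).
by exists s, x.
Qed.

Lemma kBm : compact Bm.
Proof. exact: subclosed_compact cBm kB Bm_sub. Qed.

Lemma kBp : compact Bp.
Proof. exact: subclosed_compact cBp kB Bp_sub. Qed.

Lemma compact_hatH : compact [set: H].
Proof.
have -> : [set: H] = \pi_H @` [set: pcs].
  by apply/seteqP; split => // q _; exists (repr q) => //; rewrite reprK.
apply: continuous_compact; first exact/continuous_subspaceT/pi_continuous.
apply: sigT_compact; first exact: finite_finset.
move=> [[]|] /=; apply: compact_set_type => //.
  by apply: compact_mapping_graph kBp _; case: hrp.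
by apply: compact_mapping_graph kBm _; case: hrm.
Qed.

End Embedding.

(** * Orbits and group law of the extended flow *)

Section HatFlow.
Context {R : realType} {T : topologicalType} (phi : R -> T -> T) (B : set T)
  (rp rm : R -> T -> T) (bp bm : set T).
Hypotheses (hphi : is_flow phi) (cB : closed B).
Local Notation Bp := (entrance_set phi B).
Local Notation Bm := (exit_set phi B).
Hypotheses (hrp : retraction rp Bp bp) (hrm : retraction rm Bm bm).
Hypotheses (hip : retraction_inj rp Bp) (him : retraction_inj rm Bm).

Local Notation H := (hatH phi B rp rm).
Local Notation seg := (seg phi).
Local Notation coord := (@hat_coord R T phi B rp rm).
Local Notation psi := (hat_phi phi B rp rm).

Lemma coord_to_B (d : H) x : B x -> coord (to_B d x) = (0, x).
Proof. by rewrite /to_B; case: pselect => // Bx _; rewrite hat_coord_pi. Qed.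

Lemma coord_to_m (d : H) s x : 0 <= s <= 1 -> Bm x ->
  coord (to_m d (s, rm s x)) = (s, rm s x).
Proof.
move=> s01 Bx; rewrite /to_m; case: pselect => [h|[]]; first by rewrite hat_coord_pi.
by exists s, x.
Qed.

Lemma coord_to_p (d : H) s x : 0 <= s <= 1 -> Bp x ->
  coord (to_p d (s, rp s x)) = (- s, rp s x).
Proof.
move=> s01 Bx; rewrite /to_p; case: pselect => [h|[]]; first by rewrite hat_coord_pi.
by exists s, x.
Qed.

Variant coord_spec (q : H) : Prop :=
| CoordB x of B x & coord q = (0, x)
| CoordM s x of 0 < s <= 1 & Bm x & coord q = (s, rm s x)
| CoordP s x of 0 < s <= 1 & Bp x & coord q = (- s, rp s x).

Lemma coordP q : coord_spec q.
Proof.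
rewrite -[q]reprK; case: (repr q) => -[[]|] p.
- have [s [x [/andP[s0 s1] Bx E]]] : beta_p phi B rp (set_val p) := set_valP p.
  move: s0; rewrite le_eqVlt => /predU1P[s0|s0].
    apply: (@CoordB _ x); first by case: Bx.
    by rewrite hat_coord_pi /= E -s0 (r0p hrp) //= oppr0.
  by apply: (@CoordP _ s x) => //; rewrite ?s0 // hat_coord_pi /= E.
- have [s [x [/andP[s0 s1] Bx E]]] : beta_m phi B rm (set_val p) := set_valP p.
  move: s0; rewrite le_eqVlt => /predU1P[s0|s0].
    apply: (@CoordB _ x); first by case: Bx.
    by rewrite hat_coord_pi /= E -s0 (r0m hrm).
  by apply: (@CoordM _ s x) => //; rewrite ?s0 // hat_coord_pi /= E.
- apply: (@CoordB _ (set_val p)); first exact: set_valP.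
  by rewrite hat_coord_pi.
Qed.

(* [hat_orbit t x p]: the extended flow takes the point x of B to the point of
   coordinates p in time t. *)
Variant hat_orbit (t : R) (x : T) : R * T -> Prop :=
| OrbB of seg (Num.min 0 t) (Num.max 0 t) B x : hat_orbit t x (0, phi t x)
| OrbM r of 0 <= r <= t & seg 0 r B x & Bm (phi r x) :
    hat_orbit t x (1 - expR (r - t), rm (1 - expR (r - t)) (phi r x))
| OrbP r of t <= r <= 0 & seg r 0 B x & Bp (phi r x) :
    hat_orbit t x (- (1 - expR (t - r)), rp (1 - expR (t - r)) (phi r x)).

Lemma collar_height (a b : R) : a <= b -> 0 <= 1 - expR (a - b) <= 1.
Proof.
move=> ab; rewrite subr_ge0 -[X in _ <= X]expR0 ler_expR subr_le0 ab /=.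
by rewrite gerBl expR_ge0.
Qed.

Lemma hat_phi_B_orbit d t x : B x -> hat_orbit t x (coord (hat_phi_B d t x)).
Proof.
move=> Bx; rewrite /hat_phi_B.
have B0 : seg 0 0 B x by move=> u; rewrite -eq_le => /eqP <-; rewrite (flow0 hphi).
have HE : (t%:E <= exit_time phi B x)%E -> seg 0 (Num.max 0 t) B x.
  case: (exit_timeP hphi cB Bx) => [HE _ u /andP[u0 _]|r r0 sr _]; first exact: HE.
  by rewrite lee_fin => tr; apply: segW sr => //; rewrite ge_max r0.
have HN : (entrance_time phi B x <= t%:E)%E -> seg (Num.min 0 t) 0 B x.
  case: (entrance_timeP hphi cB Bx) => [HN _ u /andP[_ u0]|r r0 sr _];
    first exact: HN.
  by rewrite lee_fin => tr; apply: segW sr => //; rewrite le_min r0.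
have [/andP[/HN h1 /HE h2]|nC] := boolP (_ && _).
  rewrite coord_to_B; first by apply: OrbB; apply: seg_cat h1 h2.
  have [t0|t0] := leP t 0.
    by apply: h1; rewrite t0 ge_min lexx orbT.
  by apply: h2; rewrite (ltW t0) le_max lexx orbT.
have [Tt|tT] := leP (exit_time phi B x) t%:E.
  move: Tt; case: (exit_timeP hphi cB Bx) => [_|r r0 sr Br]; first by rewrite leye_eq.
  rewrite lee_fin => rt /=; rewrite coord_to_m //; last exact: collar_height.
  by apply: OrbM => //; rewrite r0.
move: nC; rewrite (ltW tT) andbT -ltNge.
case: (entrance_timeP hphi cB Bx) => [_|r r0 sr Br]; first by rewrite ltNge leNye.
rewrite lte_fin => /ltW tr /=; rewrite coord_to_p //; last exact: collar_height.
by apply: OrbP => //; rewrite r0 tr.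
Qed.

(** Maximality of exit and entrance times fixes [r] in each collar. Different cases overlap only at
    a transition, where the height is 0 and the retraction is the identity. *)
Lemma hat_orbit_inj t x p p' : hat_orbit t x p -> hat_orbit t x p' -> p = p'.
Proof.
have BM r : seg (Num.min 0 t) (Num.max 0 t) B x -> 0 <= r <= t ->
    Bm (phi r x) -> r = t.
  move=> sB /andP[r0 rt] Br; apply/eqP; rewrite eq_le rt /=.
  apply: (exit_max hphi Br); apply: segW sB; first by rewrite ge_min r0.
  by rewrite le_max lexx orbT.
have BP r : seg (Num.min 0 t) (Num.max 0 t) B x -> t <= r <= 0 ->
    Bp (phi r x) -> r = t.
  move=> sB /andP[rt r0] Br; apply/eqP; rewrite eq_le rt andbT.
  apply: (entrance_min hphi Br); apply: segW sB; last by rewrite le_max r0.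
  by rewrite ge_min lexx orbT.
have MM r r' : 0 <= r <= t -> 0 <= r' <= t -> seg 0 r B x -> seg 0 r' B x ->
    Bm (phi r x) -> Bm (phi r' x) -> r = r'.
  move=> /andP[r0 _] /andP[r'0 _] sr sr' Br Br'.
  apply/eqP; rewrite eq_le.
  rewrite (exit_max hphi Br'); last exact: segW sr.
  by rewrite (exit_max hphi Br) //; exact: segW sr'.
have PP r r' : t <= r <= 0 -> t <= r' <= 0 -> seg r 0 B x -> seg r' 0 B x ->
    Bp (phi r x) -> Bp (phi r' x) -> r = r'.
  move=> /andP[_ r0] /andP[_ r'0] sr sr' Br Br'.
  apply/eqP; rewrite eq_le.
  rewrite (entrance_min hphi Br); last exact: segW sr'.
  by rewrite (entrance_min hphi Br') //; exact: segW sr.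
have MP r r' : 0 <= r <= t -> t <= r' <= 0 -> [/\ r = 0, r' = 0 & t = 0].
  by move=> ? ?; split; lra.
have E0 a : 1 - expR (a - a) = 0 :> R by rewrite subrr expR0 subrr.
case=> [sB|r rt sr Br|r rt sr Br] [sB'|r' rt' sr' Br'|r' rt' sr' Br'] //.
- by rewrite (BM r') // E0 (r0m hrm) // -(BM r').
- by rewrite (BP r') // E0 oppr0 (r0p hrp) // -(BP r').
- by rewrite (BM r) // E0 (r0m hrm) // -(BM r).
- by rewrite (MM r r').
- have [E1 E2 E3] := MP _ _ rt rt'; rewrite E1 in Br *; rewrite E2 in Br' *.
  by rewrite E3 E0 oppr0 (r0m hrm) // (r0p hrp).
- by rewrite (BP r) // E0 oppr0 (r0p hrp) // -(BP r).
- have [E1 E2 E3] := MP _ _ rt' rt; rewrite E1 in Br' *; rewrite E2 in Br *.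
  by rewrite E3 E0 oppr0 (r0m hrm) // (r0p hrp).
- by rewrite (PP r r').
Qed.


Lemma hat_phi_p_piece (d : H) u (p : R * T) (s : R) x : 0 <= s < 1 -> Bp x ->
  p = (s, rp s x) ->
  hat_orbit (u + ln (1 - s)) x (coord (let: (s, y) := p in
    if s < 1 then hat_phi_B d (u + ln (1 - s))
       (xget y [set x | Bp x /\ rp s x = y]) else d)).
Proof.
(* (Inj) makes [x] the only base point of the collar point, so the choice made by [xget] is [x]. *)
move=> /andP[s0 s1] Bx ->; rewrite s1 (@xget_unique _ _ _ x) //.
  by apply: hat_phi_B_orbit; case: Bx.
by move=> y [By E]; apply: (hip (s := s)) => //; rewrite s0.
Qed.

Lemma hat_phi_m_piece (d : H) u (p : R * T) (s : R) x : 0 <= s < 1 -> Bm x ->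
  p = (s, rm s x) ->
  hat_orbit (u - ln (1 - s)) x (coord (let: (s, y) := p in
    if s < 1 then hat_phi_B d (u - ln (1 - s))
       (xget y [set x | Bm x /\ rm s x = y]) else d)).
Proof.
move=> /andP[s0 s1] Bx ->; rewrite s1 (@xget_unique _ _ _ x) //.
  by apply: hat_phi_B_orbit; case: Bx.
by move=> y [By E]; apply: (him (s := s)) => //; rewrite s0.
Qed.

(** [repr] may select a collar representative at height 0; there the time correction is [ln 1] and
    the retraction is the identity, so the result is that of [B]. *)
Lemma hat_phi_B0 u q x : B x -> coord q = (0, x) ->
  hat_orbit u x (coord (psi u q)).
Proof.
have s01 : 0 <= (0 : R) < 1 by rewrite lexx ltr01.
have ln0 : ln (1 - 0) = 0 :> R by rewrite subr0 ln1.
move=> Bx; rewrite {1}/hat_coord /hat_phi; case: (repr q) => -[[]|] p /=.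
- have [s [y [_ By E]]] : beta_p phi B rp (set_val p) := set_valP p.
  move=> q0; rewrite E /= in q0; case: q0 => /eqP; rewrite oppr_eq0 => /eqP sz yx.
  rewrite sz (r0p hrp) // in yx; rewrite yx in By.
  have E' : set_val p = (0, rp 0 x) by rewrite E sz yx.
  by have := hat_phi_p_piece q u s01 By E'; rewrite ln0 addr0.
- have [s [y [_ By E]]] : beta_m phi B rm (set_val p) := set_valP p.
  move=> q0; rewrite E /= in q0; case: q0 => sz yx.
  rewrite sz (r0m hrm) // in yx; rewrite yx in By.
  have E' : set_val p = (0, rm 0 x) by rewrite E sz yx.
  by have := hat_phi_m_piece q u s01 By E'; rewrite ln0 subr0.
- by move=> [->]; exact: hat_phi_B_orbit.
Qed.

Lemma hat_phi_m u q s x : 0 <= s < 1 -> Bm x -> coord q = (s, rm s x) ->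
  hat_orbit (u - ln (1 - s)) x (coord (psi u q)).
Proof.
move=> s01 Bx; have [s0|sn0] := eqVneq s 0.
  rewrite s0 (r0m hrm) // subr0 ln1 subr0.
  by apply: hat_phi_B0; case: Bx.
have sgt : 0 < s by move: s01 => /andP[s0 _]; rewrite lt_neqAle eq_sym sn0.
rewrite {1}/hat_coord /hat_phi; case: (repr q) => -[[]|] p /=.
- have [s' [y [/andP[s'0 _] By E]]] : beta_p phi B rp (set_val p) := set_valP p.
  by rewrite E /= => -[ss _]; lra.
- by move=> E; exact: hat_phi_m_piece.
- by move=> [ss _]; lra.
Qed.

Lemma hat_phi_p u q s x : 0 <= s < 1 -> Bp x -> coord q = (- s, rp s x) ->
  hat_orbit (u + ln (1 - s)) x (coord (psi u q)).
Proof.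
move=> s01 Bx; have [s0|sn0] := eqVneq s 0.
  rewrite s0 (r0p hrp) // subr0 ln1 addr0 oppr0.
  by apply: hat_phi_B0; case: Bx.
have sgt : 0 < s by move: s01 => /andP[s0 _]; rewrite lt_neqAle eq_sym sn0.
rewrite {1}/hat_coord /hat_phi; case: (repr q) => -[[]|] p /=.
- move=> E; apply: hat_phi_p_piece => //.
  by case: E => /oppr_inj; case: (set_val p) => a b /= -> ->.
- have [s' [y [/andP[s'0 _] By E]]] : beta_m phi B rm (set_val p) := set_valP p.
  by rewrite E /= => -[ss _]; lra.
- by move=> [ss _]; lra.
Qed.

Lemma hat_phi_top u q : `|(coord q).1| = 1 -> psi u q = q.
Proof.
rewrite /hat_coord /hat_phi; case: (repr q) => -[[]|] p /=.
- rewrite normrN; have [s [y [/andP[s0 _] By E]]] : beta_p phi B rp (set_val p) :=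
  set_valP p.
  by rewrite E /= ger0_norm // => ->; rewrite ltxx.
- have [s [y [/andP[s0 _] By E]]] : beta_m phi B rm (set_val p) := set_valP p.
  by rewrite E /= ger0_norm // => ->; rewrite ltxx.
- by move=> /eqP; rewrite normr0 eq_sym oner_eq0.
Qed.

Lemma hat_orbit_shift t u x p : seg (Num.min 0 t) (Num.max 0 t) B x ->
  hat_orbit u (phi t x) p -> hat_orbit (u + t) x p.
Proof.
move=> sB [sB'|r ru sr Br|r ru sr Br]; rewrite ?(flowD hphi).
- apply: OrbB => v /andP[]; rewrite ge_min le_max => v1 v2.
  move: sB' => /(seg_shift hphi) sB'.
  have [h|h] := boolP (Num.min 0 t <= v <= Num.max 0 t); first exact: sB.
  apply: sB'; move: h v1 v2; rewrite !minElt !maxElt.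
  by case: ltP => ?; case: ltP => ?; lra.
- move: sr Br; rewrite (flowD hphi) => /(seg_shift hphi); rewrite add0r => sr Br.
  have -> : r - u = (r + t) - (u + t) by lra.
  have [rt|rt] := leP 0 (r + t).
    apply: OrbM => //; first by rewrite rt lerD2r; case/andP: ru.
    move=> v /andP[v0 vr]; have [vt|tv] := leP v t; last by apply: sr; rewrite ltW.
    by apply: sB; rewrite ge_min le_max v0 vt orbT.
  (* An exit at the negative time [r + t] is impossible, since the orbit is in [B] from then until
     0. *)
  exfalso; have : seg (r + t) 0 B x.
    apply: segW sB; last by rewrite le_max lexx.
    by rewrite ge_min; apply/orP; right; lra.
  by move=> /(exit_max hphi Br); lra.
- move: sr Br; rewrite (flowD hphi) => /(seg_shift hphi); rewrite add0r => sr Br.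
  have -> : u - r = (u + t) - (r + t) by lra.
  have [rt|rt] := leP (r + t) 0.
    apply: OrbP => //; first by rewrite rt lerD2r andbT; case/andP: ru.
    move=> v /andP[vr v0]; have [tv|vt] := leP t v; last by apply: sr; rewrite vr ltW.
    by apply: sB; rewrite ge_min le_max v0 tv orbT.
  exfalso; have : seg 0 (r + t) B x.
    apply: segW sB; first by rewrite ge_min lexx.
    by rewrite le_max; apply/orP; right; lra.
  by move=> /(entrance_min hphi Br); lra.
Qed.

Lemma hat_orbit_flow t u x q : B x -> hat_orbit t x (coord q) ->
  hat_orbit (u + t) x (coord (psi u q)).
Proof.
move=> Bx; move E : (coord q) => p hO; case: hO E => [sB|r rt sr Br|r rt sr Br] E.
- apply: hat_orbit_shift => //; apply: hat_phi_B0 E.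
  by apply: sB; rewrite ge_min le_max !lexx !orbT.
- have r0 : 0 <= r by case/andP: rt.
  (* The logarithm recovers from the collar height the time elapsed since the exit at [r]. *)
  rewrite (_ : u + t = u - ln (1 - (1 - expR (r - t))) + r); last first.
    by rewrite subKr expRK; lra.
  apply: hat_orbit_shift; first by rewrite min_l // max_r.
  apply: hat_phi_m => //.
  have := @collar_height r t; case/andP: rt => _ -> /(_ isT)/andP[-> _] /=.
  by rewrite ltrBlDr ltrDl expR_gt0.
- have r0 : r <= 0 by case/andP: rt.
  rewrite (_ : u + t = u + ln (1 - (1 - expR (t - r))) + r); last first.
    by rewrite subKr expRK; lra.
  apply: hat_orbit_shift; first by rewrite min_r // max_l.
  apply: hat_phi_p => //.
  have := @collar_height t r; case/andP: rt => -> _ /(_ isT)/andP[-> _] /=.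
  by rewrite ltrBlDr ltrDl expR_gt0.
Qed.

Lemma hat_orbit_or_top q :
  (exists t x, B x /\ hat_orbit t x (coord q)) \/ `|(coord q).1| = 1.
Proof.
have E (s : R) : s < 1 -> 1 - expR (ln (1 - s)) = s.
  by move=> s1; rewrite lnK ?posrE ?subr_gt0 // subKr.
have ln_le (s : R) : 0 < s -> s < 1 -> ln (1 - s) <= 0.
  by move=> s0 s1; apply: ln_le0; lra.
have seg0 x : B x -> seg 0 0 B x.
  by move=> Bx u; rewrite -eq_le => /eqP <-; rewrite (flow0 hphi).
case: (coordP q) => [x Bx q0|s x /andP[s0 s1] Bx q0|s x /andP[s0 s1] Bx q0].
- left; exists 0, x; split => //; rewrite q0 -{2}(flow0 hphi x).
  by apply: OrbB; rewrite min_l // max_l //; exact: seg0.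
- move: s1; rewrite le_eqVlt => /predU1P[s1|s1]; [right|left].
    by rewrite q0 /= s1 normr1.
  have Bx' : B x by case: Bx.
  exists (- ln (1 - s)), x; split => //.
  have : hat_orbit (- ln (1 - s)) x
    (1 - expR (0 - - ln (1 - s)), rm (1 - expR (0 - - ln (1 - s))) (phi 0 x)).
    by apply: OrbM; rewrite ?(flow0 hphi) ?lexx ?oppr_ge0 ?ln_le //; exact: seg0.
  by rewrite sub0r opprK E // (flow0 hphi) q0.
- move: s1; rewrite le_eqVlt => /predU1P[s1|s1]; [right|left].
    by rewrite q0 /= s1 normrN normr1.
  have Bx' : B x by case: Bx.
  exists (ln (1 - s)), x; split => //.
  have : hat_orbit (ln (1 - s)) x
    (- (1 - expR (ln (1 - s) - 0)), rp (1 - expR (ln (1 - s) - 0)) (phi 0 x)).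
    by apply: OrbP; rewrite ?(flow0 hphi) ?lexx ?andbT ?ln_le //; exact: seg0.
  by rewrite subr0 E // (flow0 hphi) q0.
Qed.

Lemma hat_phi0 q : psi 0 q = q.
Proof.
have [[t [x [Bx h]]]|top] := hat_orbit_or_top q; last exact: hat_phi_top.
apply: (hat_coord_inj hrp hrm); apply: (hat_orbit_inj _ h).
by rewrite -{1}(add0r t); exact: hat_orbit_flow.
Qed.

(** Away from the fixed ends of the collars, both sides are reached from the same point of [B] in
    the same total time, and [hat_orbit] is single-valued. *)
Lemma hat_phiD u v q : psi (u + v) q = psi u (psi v q).
Proof.
have [[t [x [Bx h]]]|top] := hat_orbit_or_top q; last first.
  by rewrite !(hat_phi_top _ top).
apply: (hat_coord_inj hrp hrm).
apply: (@hat_orbit_inj (u + v + t) x); first exact: hat_orbit_flow.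
by rewrite -addrA; apply: hat_orbit_flow => //; exact: hat_orbit_flow.
Qed.

End HatFlow.

(** * Composition of closed relations that depend on time *)

Section RelationComposition.
Context {R : realType} {M : topologicalType}.
Hypotheses (cM : compact [set: M]).
Implicit Types G : set (R * M * M).

(** The parameter [z.1] is the fraction of the total time spent in [G], not that time itself, so
    that it ranges over one compact interval for all times. *)
Definition relation_comp G G' : set (R * M * M) :=
  [set p | exists2 z : R * M, (`[0, 1] `*` [set: M]) z &
    G (z.1 * p.1.1, p.1.2, z.2) /\ G' ((1 - z.1) * p.1.1, z.2, p.2)].

Lemma closed_relation_comp G G' : closed G -> closed G' ->
  closed (relation_comp G G').
Proof.
move=> cG cG'.
pose Z : topologicalType := ((R * M * M) * (R * M))%type.
have c1 : continuous (fun w : Z =>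
  w.2.1) by exact/continuous_fstP/continuous_sndP/continuous_id.
have c2 : continuous (fun w : Z => w.1.1.1).
  exact/continuous_fstP/continuous_fstP/continuous_fstP/continuous_id.
have c3 : continuous (fun w : Z => w.1.1.2).
  exact/continuous_sndP/continuous_fstP/continuous_fstP/continuous_id.
have c4 : continuous (fun w : Z =>
  w.2.2) by exact/continuous_sndP/continuous_sndP/continuous_id.
have c5 : continuous (fun w : Z =>
  w.1.2) by exact/continuous_sndP/continuous_fstP/continuous_id.
apply: (@closed_exists_compact _ _ _ [set w : Z |
  G (w.2.1 * w.1.1.1, w.1.1.2, w.2.2) /\
  G' ((1 - w.2.1) * w.1.1.1, w.2.2, w.1.2)]).
  by apply: compact_setX => //; exact: segment_compact.
apply: closedI.
  apply: (@closed_preimage Z _ (fun w : Z => (w.2.1 * w.1.1.1, w.1.1.2, w.2.2))) =>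
    //.
  by apply: continuous_pair => //; apply: continuous_pair => //;
    exact: continuous_mul.
apply: (@closed_preimage Z _ (fun w : Z =>
  ((1 - w.2.1) * w.1.1.1, w.2.2, w.1.2))) => //.
apply: continuous_pair => //; apply: continuous_pair => //;
  apply: continuous_mul => //.
by apply: continuous_sub => //; exact: cst_continuous.
Qed.

Lemma relation_compI G G' t t1 q q1 q' : 0 <= t1 <= t ->
  G (t1, q, q1) -> G' (t - t1, q1, q') -> relation_comp G G' (t, q, q').
Proof.
move=> /andP[t10 t1t] g g'; have [t0|tn0] := eqVneq t 0.
  have t1E : t1 = 0 by apply/eqP; rewrite eq_le t10 -t0 t1t.
  exists (0, q1) => /=; first by rewrite in_itv /= lexx ler01.
  by split; rewrite t0 mulr0; [rewrite -t1E|rewrite t0 t1E subrr in g'].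
have tgt : 0 < t by rewrite lt_neqAle eq_sym tn0 (le_trans t10).
exists (t1 / t, q1) => /=.
  by split => //; rewrite in_itv /= divr_ge0 ?(ltW tgt) //= ler_pdivrMr // mul1r.
by rewrite mulrBl mul1r !divfK.
Qed.

End RelationComposition.

Section HatContinuity.
Context {R : realType} {T : topologicalType} (phi : R -> T -> T) (B : set T)
  (rp rm : R -> T -> T) (bp bm : set T).
Hypotheses (hphi : is_flow phi) (hT : hausdorff_space T) (kB : compact B).
Local Notation Bp := (entrance_set phi B).
Local Notation Bm := (exit_set phi B).
Hypotheses (cBp : closed Bp) (cBm : closed Bm).
Hypotheses (hrp : retraction rp Bp bp) (hrm : retraction rm Bm bm).
Hypotheses (hip : retraction_inj rp Bp) (him : retraction_inj rm Bm).

Local Notation H := (hatH phi B rp rm).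
Local Notation seg := (seg phi).
Local Notation coord := (@hat_coord R T phi B rp rm).
Local Notation psi := (hat_phi phi B rp rm).

Let cB : closed B. Proof. exact: compact_closed. Qed.

Lemma hat_phi_in_B t q x : 0 <= t -> B x -> seg 0 t B x -> coord q = (0, x) ->
  coord (psi t q) = (0, phi t x).
Proof.
move=> t0 Bx sB q0; apply: (hat_orbit_inj hphi hrp hrm (hat_phi_B0 hphi cB hrp hrm
  hip him t Bx q0)).
by apply: OrbB; rewrite min_l // max_r.
Qed.

(** In the exit collar the distance [1 - s] to the end decays like [expR (- t)]. In this form the
    law also covers the fixed points at [s = 1]. *)
Lemma hat_phi_in_m t q s s' x : 0 <= s <= 1 -> 0 <= s' <= 1 -> Bm x ->
  1 - s' = (1 - s) * expR (- t) -> coord q = (s, rm s x) ->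
  coord (psi t q) = (s', rm s' x).
Proof.
move=> /andP[s0 s1] s'01 Bx E q0; have Bx' : B x by case: Bx.
move: s1; rewrite le_eqVlt => /predU1P[s1|s1].
  have -> : s' = s by move: E; rewrite s1 subrr mul0r; lra.
  by rewrite (hat_phi_top t (q := q)) // q0 /= s1 normr1.
have s01 : 0 <= s < 1 by rewrite s0.
apply: (hat_orbit_inj hphi hrp hrm (hat_phi_m hphi cB hrp hrm hip him t s01 Bx q0)).
have Ee : expR (0 - (t - ln (1 - s))) = 1 - s'.
  by rewrite sub0r opprB expRD lnK ?posrE ?subr_gt0 // E.
have := @OrbM _ _ phi B rp rm (t - ln (1 - s)) x 0; rewrite Ee subKr (flow0 hphi).
apply => //; last by move=> u; rewrite -eq_le => /eqP <-; rewrite (flow0 hphi).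
rewrite lexx -subr_le0 -ler_expR Ee expR0; lra.
Qed.

Lemma hat_phi_in_p t q s s' x : 0 <= s <= 1 -> 0 <= s' <= 1 -> Bp x ->
  1 - s = (1 - s') * expR (- t) -> coord q = (- s, rp s x) ->
  coord (psi t q) = (- s', rp s' x).
Proof.
move=> /andP[s0 s1] s'01 Bx E q0; have Bx' : B x by case: Bx.
move: s1; rewrite le_eqVlt => /predU1P[s1|s1].
  have -> : s' = s.
    move: E; rewrite s1 subrr => /esym/eqP; rewrite mulf_eq0 (gt_eqF (expR_gt0 _)).
    by rewrite orbF subr_eq0 => /eqP.
  by rewrite (hat_phi_top t (q := q)) // q0 /= normrN s1 normr1.
have s01 : 0 <= s < 1 by rewrite s0.
apply: (hat_orbit_inj hphi hrp hrm (hat_phi_p hphi cB hrp hrm hip him t s01 Bx q0)).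
have Ee : expR (t + ln (1 - s) - 0) = 1 - s'.
  by rewrite subr0 expRD lnK ?posrE ?subr_gt0 // E mulrC -mulrA -expRD addNr expR0
    mulr1.
have := @OrbP _ _ phi B rp rm (t + ln (1 - s)) x 0; rewrite Ee subKr (flow0 hphi).
apply => //; last by move=> u; rewrite -eq_le => /eqP <-; rewrite (flow0 hphi).
rewrite lexx andbT -[X in X <= _]subr0 -ler_expR Ee expR0; lra.
Qed.

(** The pair [z.1] holds the heights before and after time [p.1.1], and [z.2] their common base
    point. The sign [sg] is that of the height; for the entrance collar start and end are exchanged
    as well. *)
Definition collar (sg : R) (r : R -> T -> T) (C : set T) : set (R * H * H) :=
  [set p | exists2 z : (R * R) * T, ((`[0, 1] `*` `[0, 1]) `*` C) z &
    [/\ 1 - z.1.2 = (1 - z.1.1) * expR (- p.1.1),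
        (coord p.1.2).1 = sg * z.1.1 /\ (coord p.2).1 = sg * z.1.2,
        retraction_graph r C ((z.1.1, z.2), (coord p.1.2).2)
      & retraction_graph r C ((z.1.2, z.2), (coord p.2).2)]].

Lemma closed_collar sg r C : compact C ->
  {within `[0, 1] `*` C, continuous (fun p : R * T => r p.1 p.2)} ->
  closed (collar sg r C).
Proof.
move=> kC cr.
have hRT : hausdorff_space ((R * T) * T)%type.
  by apply: hausdorff_prod => //; apply: hausdorff_prod => //; exact: Rhausdorff.
have cG : closed (retraction_graph r C).
  by apply: compact_closed => //; exact: compact_retraction_graph.
pose Z : topologicalType := ((R * H * H) * ((R * R) * T))%type.
have c1 : continuous (fun w : Z => w.2.1.1).
  exact/continuous_fstP/continuous_fstP/continuous_sndP/continuous_id.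
have c2 : continuous (fun w : Z => w.2.1.2).
  exact/continuous_sndP/continuous_fstP/continuous_sndP/continuous_id.
have c3 : continuous (fun w : Z =>
  w.2.2) by exact/continuous_sndP/continuous_sndP/continuous_id.
have c4 : continuous (fun w : Z => w.1.1.1).
  exact/continuous_fstP/continuous_fstP/continuous_fstP/continuous_id.
have c5 : continuous (fun w : Z => coord w.1.1.2).
  exact/continuous_coord/continuous_sndP/continuous_fstP/continuous_fstP/continuous_id.
have c6 : continuous (fun w : Z => coord w.1.2).
  exact/continuous_coord/continuous_sndP/continuous_fstP/continuous_id.
have cst (c : R) : continuous (fun _ : Z => c) by exact: cst_continuous.
have ce : continuous (fun w : Z => expR (- w.1.1.1)).
  move=> w; apply: (@continuous_comp _ _ _ (fun w : Z => - w.1.1.1) expR).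
    by apply: (continuous_comp (c4 w)); exact: opp_continuous.
  exact: continuous_expR.
apply: (@closed_exists_compact _ _ _ [set w : Z |
    [/\ 1 - w.2.1.2 = (1 - w.2.1.1) * expR (- w.1.1.1),
        (coord w.1.1.2).1 = sg * w.2.1.1 /\ (coord w.1.2).1 = sg * w.2.1.2,
        retraction_graph r C ((w.2.1.1, w.2.2), (coord w.1.1.2).2)
      & retraction_graph r C ((w.2.1.2, w.2.2), (coord w.1.2).2)]]).
  by apply: compact_setX => //; apply: compact_setX; exact: segment_compact.
rewrite (_ : [set w | _] =
  [set w : Z | 1 - w.2.1.2 = (1 - w.2.1.1) * expR (- w.1.1.1)] `&`
  ([set w : Z | (coord w.1.1.2).1 = sg * w.2.1.1] `&`
   [set w : Z | (coord w.1.2).1 = sg * w.2.1.2]) `&`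
  ([set w : Z | retraction_graph r C ((w.2.1.1, w.2.2), (coord w.1.1.2).2)] `&`
   [set w : Z | retraction_graph r C ((w.2.1.2, w.2.2), (coord w.1.2).2)]));
     last first.
  by apply/seteqP; split => w /=; [move=> [? [? ?] ? ?]|move=> [[? [? ?]] [? ?]]].
apply: closedI; [apply: closedI; last apply: closedI|apply: closedI].
- apply: closed_eq_fun; first exact: Rhausdorff.
    exact: continuous_sub.
  by apply: continuous_mul => //; exact: continuous_sub.
- apply: closed_eq_fun; first exact: Rhausdorff.
    exact/continuous_fstP.
  exact: continuous_mul.
- apply: closed_eq_fun; first exact: Rhausdorff.
    exact/continuous_fstP.
  exact: continuous_mul.
- apply: (@closed_preimage Z _ (fun w : Z =>
  ((w.2.1.1, w.2.2), (coord w.1.1.2).2))) => //.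
  apply: continuous_pair; first exact: continuous_pair.
  exact/continuous_sndP.
- apply: (@closed_preimage Z _ (fun w : Z =>
  ((w.2.1.2, w.2.2), (coord w.1.2).2))) => //.
  apply: continuous_pair; first exact: continuous_pair.
  exact/continuous_sndP.
Qed.


(** Lets an orbit skip a phase: the absent phase takes time 0. *)
Let Gid : set (R * H * H) := [set p | p.1.1 = 0 /\ p.1.2 = p.2].

Let GB : set (R * H * H) :=
  [set p | [/\ (coord p.1.2).1 = 0, (coord p.2).1 = 0,
     (coord p.2).2 = phi p.1.1 (coord p.1.2).2
   & seg 0 (Num.max 0 p.1.1) B (coord p.1.2).2]].

Let Gm := collar 1 rm Bm.

Let Gp : set (R * H * H) := [set p | collar (-1) rp Bp (p.1.1, p.2, p.1.2)].

(* The graph of the extended flow over nonnegative times: an orbit first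
   descends the entrance collar, then crosses B, then climbs the exit collar. *)
Let G := relation_comp (Gp `|` Gid) (relation_comp (GB `|` Gid) (Gm `|` Gid)).

Let hH : hausdorff_space H. Proof. exact: hausdorff_hatH hT hrp hrm. Qed.
Let cH : compact [set: H]. Proof. exact: compact_hatH kB cBp cBm hrp hrm. Qed.

Let closed_Gid : closed Gid.
Proof.
apply: closedI; apply: closed_eq_fun => //.
- exact/continuous_fstP/continuous_fstP/continuous_id.
- exact: cst_continuous.
- exact/continuous_sndP/continuous_fstP/continuous_id.
- exact/continuous_sndP/continuous_id.
Qed.

Let closed_GB : closed GB.
Proof.
pose Z : topologicalType := (R * H * H)%type.
have c1 : continuous (fun p : Z => coord p.1.2).
  exact/continuous_coord/continuous_sndP/continuous_fstP/continuous_id.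
have c2 : continuous (fun p : Z =>
  coord p.2) by exact/continuous_coord/continuous_sndP/continuous_id.
have c3 : continuous (fun p : Z =>
  p.1.1) by exact/continuous_fstP/continuous_fstP/continuous_id.
have cst (c : R) : continuous (fun _ : Z => c) by exact: cst_continuous.
have cmax : continuous (fun p : Z => Num.max 0 p.1.1).
  move=> p; apply: (@continuous_max R Z (fun=> 0) (fun p => p.1.1)).
    exact: cst.
  exact: c3.
rewrite (_ : GB = [set p : Z | (coord p.1.2).1 = 0] `&` [set p : Z | (coord p.2).1
  = 0] `&`
   [set p : Z | (coord p.2).2 = phi p.1.1 (coord p.1.2).2] `&`
   [set p : Z | seg 0 (Num.max 0 p.1.1) B (coord p.1.2).2]); last first.
  by apply/seteqP; split => p /=; [move=> []|move=> [[[]]]].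
apply: closedI; last first.
  apply: seg_closed => //; first exact/continuous_sndP.
  by move=> z; rewrite le_max lexx.
apply: closedI; first apply: closedI; apply: closed_eq_fun => //.
- exact/continuous_fstP.
- exact/continuous_fstP.
- exact/continuous_sndP.
- by apply: flow_continuous => //; exact/continuous_sndP.
Qed.

Let closed_Gm : closed Gm.
Proof. by apply: closed_collar; [exact: kBm|case: hrm]. Qed.

Let closed_Gp : closed Gp.
Proof.
apply: (@closed_preimage _ _ (fun p : R * H * H => (p.1.1, p.2, p.1.2))).
  apply: continuous_pair; last exact/continuous_sndP/continuous_fstP/continuous_id.
  by apply: continuous_pair; [exact/continuous_fstP/continuous_fstP/continuous_id|exact/continuous_sndP/continuous_id].
by apply: closed_collar; [exact: kBp|case: hrp].
Qed.

Let closed_G : closed G.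
Proof.
by apply: closed_relation_comp => //; [exact: closedU|
  apply: closed_relation_comp => //; exact: closedU].
Qed.

Let psi0 q : psi 0 q = q. Proof. exact: (hat_phi0 hphi cB hrp hrm hip him). Qed.
Let psiD u v q : psi (u + v) q = psi u (psi v q).
Proof. exact: (hat_phiD hphi cB hrp hrm hip him). Qed.

Let coordI q q' : coord q = coord q' -> q = q'.
Proof. exact: (hat_coord_inj hrp hrm). Qed.

Let sound (G1 : set (R * H * H)) := forall t q q', 0 <= t -> G1 (t, q,
  q') -> q' = psi t q.

Let sound_comp G1 G2 : sound G1 -> sound G2 -> sound (relation_comp G1 G2).
Proof.
move=> s1 s2 t q q' t0 [[v q1] /= [+ _]]; rewrite in_itv /= => /andP[v0 v1] [g1 g2].
rewrite (s2 _ _ _ _ g2) ?(s1 _ _ _ _ g1) ?mulr_ge0 ?subr_ge0 //.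
by rewrite -psiD mulrBl mul1r subrK.
Qed.

Let sound_U G1 : sound G1 -> sound (G1 `|` Gid).
Proof. by move=> s1 t q q' t0 [/s1->//|[/= -> ->]]; rewrite psi0. Qed.

Let sound_G : sound G.
Proof.
have cE q : coord q = ((coord q).1, (coord q).2) by case: (coord q).
apply: sound_comp; [|apply: sound_comp]; apply: sound_U => t q q' t0 /=.
- move=> [[[s' s] x] /= [[]]]; rewrite !in_itv /= => s'01 s01 Bx.
  move=> [E [q'1 q1] [_ _ /= q'2] [_ _ /= q2]]; apply: coordI.
  rewrite (@hat_phi_in_p t q s s' x) //; last by rewrite cE q1 q2 mulN1r.
  by rewrite cE q'1 q'2 mulN1r.
- move=> [q1 q'1 q'2]; rewrite max_r // => sB; apply: coordI.
  rewrite (@hat_phi_in_B t q (coord q).2) //; first by rewrite cE q'1 q'2.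
    by rewrite -(flow0 hphi (coord q).2); apply: sB; rewrite lexx t0.
  by rewrite {1}cE q1.
- move=> [[[s s'] x] /= [[]]]; rewrite !in_itv /= => s01 s'01 Bx.
  move=> [E [q1 q'1] [_ _ /= q2] [_ _ /= q'2]]; apply: coordI.
  rewrite (@hat_phi_in_m t q s s' x) //; last by rewrite cE q1 q2 mul1r.
  by rewrite cE q'1 q'2 mul1r.
Qed.

Let GmI t q s x : 0 <= t -> 0 <= s <= 1 -> Bm x -> coord q = (s, rm s x) ->
  Gm (t, q, psi t q).
Proof.
move=> t0 /andP[s0 s1] Bx q0; set s' := 1 - (1 - s) * expR (- t).
have s'01 : 0 <= s' <= 1.
  rewrite /s' subr_ge0 gerBl mulr_ge0 ?subr_ge0 ?expR_ge0 // andbT.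
  apply: (@le_trans _ _ (1 * 1)); last by rewrite mulr1.
  apply: ler_pM; rewrite ?subr_ge0 ?expR_ge0 //; first by rewrite gerBl.
  by rewrite -expR0 ler_expR oppr_le0.
have s01 : 0 <= s <= 1 by rewrite s0.
have E : 1 - s' = (1 - s) * expR (- t) by rewrite /s' subKr.
exists ((s, s'), x) => /=; first by rewrite !in_itv.
by rewrite (hat_phi_in_m s01 s'01 Bx E q0) q0 /= !mul1r.
Qed.

Let GpI t q s s' x : 0 <= s <= 1 -> 0 <= s' <= 1 -> Bp x ->
  1 - s = (1 - s') * expR (- t) -> coord q = (- s, rp s x) ->
  Gp (t, q, psi t q).
Proof.
move=> s01 s'01 Bx E q0.
exists ((s', s), x) => /=; first by rewrite !in_itv.
by rewrite (hat_phi_in_p s01 s'01 Bx E q0) q0 /= !mulN1r.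
Qed.

Let GBm := relation_comp (GB `|` Gid) (Gm `|` Gid).

Let GBmI t q : 0 <= t -> 0 <= (coord q).1 -> GBm (t, q, psi t q).
Proof.
move=> t0; case: (coordP hrp hrm q) =>
  [x Bx q0 _|s x s01 Bx q0 _|s x /andP[s0 _] _ ->]; last first.
- by rewrite /=; lra.
- apply: (@relation_compI _ _ _ _ t 0 q q); first by rewrite lexx.
    by right.
  left; rewrite subr0; apply: (GmI t0 _ Bx q0).
  by case/andP: s01 => /ltW -> ->.
have inB r : 0 <= r -> seg 0 r B x -> GB (r, q, psi r q).
  by move=> r0 sr; split; rewrite /= ?(hat_phi_in_B r0 Bx sr q0) ?q0 //= max_r.
case: (exit_timeP hphi cB Bx) => [HE|r r0 sr Br].
  apply: (@relation_compI _ _ _ _ t t q (psi t q)); first by rewrite t0 lexx.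
    by left; apply: inB => // u /andP[u0 _]; exact: HE.
  by right; rewrite subrr.
have [tr|rt] := leP t r.
  apply: (@relation_compI _ _ _ _ t t q (psi t q)); first by rewrite t0 lexx.
    by left; apply: inB => //; apply: segW sr.
  by right; rewrite subrr.
apply: (@relation_compI _ _ _ _ t r q (psi r q)); first by rewrite r0 ltW.
  by left; exact: inB.
left; rewrite -{2}(subrK r t) psiD.
apply: (@GmI _ _ 0 (phi r x)) => //; first by rewrite subr_ge0 ltW.
  by rewrite lexx ler01.
by rewrite (hat_phi_in_B r0 Bx sr q0) (r0m hrm).
Qed.

Let GI t q : 0 <= t -> G (t, q, psi t q).
Proof.
move=> t0; have [q1|q1] := leP 0 (coord q).1.
  apply: (@relation_compI _ _ _ _ t 0 q q); first by rewrite lexx.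
    by right.
  by rewrite subr0; exact: GBmI.
move: q1; case: (coordP hrp hrm q) =>
  [x Bx ->|s x /andP[s0 s1] Bx ->|s x /andP[s0 s1] Bx q0 _] /=.
- by rewrite ltxx.
- by lra.
have s01 : 0 <= s <= 1 by rewrite ltW.
(* Settles the orbits that are still in the entrance collar at time [t], the fixed points at its end
   included. *)
have stop s' : 0 <= s' <= 1 -> 1 - s = (1 - s') * expR (- t) -> G (t, q, psi t q).
  move=> s'01 E; apply: (@relation_compI _ _ _ _ t t q (psi t q));
    first by rewrite t0 lexx.
    by left; exact: (GpI s01 s'01 Bx E q0).
  rewrite subrr; apply: (@relation_compI _ _ _ _ 0 0 _ (psi t q));
    first by rewrite lexx.
    by right.
  by right; rewrite subrr.
have [s1'|sn1] := eqVneq s 1.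
  by apply: (stop 1); rewrite ?s1' ?subrr ?mul0r // ler01 lexx.
have slt : s < 1 by rewrite lt_neqAle sn1.
have s1gt : 0 < 1 - s by rewrite subr_gt0.
(* The threshold is the time in which the flow brings the collar parameter from [s] to 0, that is,
   to the entrance into [B]. *)
have [ta|at_] := leP t (- ln (1 - s)).
  apply: (stop (1 - (1 - s) * expR t)); last first.
    by rewrite subKr -mulrA -expRD addrN expR0 mulr1.
  rewrite subr_ge0 gerBl mulr_ge0 ?expR_ge0 ?(ltW s1gt) // andbT.
  by rewrite -[X in _ <= X]expR0 -{1}(lnK s1gt) -expRD ler_expR; lra.
have a0 : 0 <= - ln (1 - s) by rewrite oppr_ge0; apply: ln_le0; lra.
have E : 1 - s = (1 - 0) * expR (- - ln (1 - s)) by rewrite subr0 mul1r opprK lnK.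
have z01 : 0 <= (0 : R) <= 1 by rewrite lexx ler01.
apply: (@relation_compI _ _ _ _ t (- ln (1 - s)) q (psi (- ln (1 - s)) q)).
- by rewrite a0 ltW.
- by left; apply: (GpI _ z01 Bx E q0).
rewrite -{2}(subrK (- ln (1 - s)) t) psiD; apply: GBmI.
  by rewrite subr_ge0 ltW.
by rewrite (hat_phi_in_p s01 z01 Bx E q0) /= oppr0.
Qed.

(** [G] describes the graph over nonnegative times; over nonpositive times the graph is its mirror
    image, with the two points exchanged. *)
Lemma hat_phi_continuous : continuous (fun p : R * H => psi p.1 p.2).
Proof.
apply: closed_graph_continuous => //.
pose Z : topologicalType := (R * H * H)%type.
have c3 : continuous (fun p : Z =>
  p.1.1) by exact/continuous_fstP/continuous_fstP/continuous_id.
rewrite (_ : [set p | _] =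
  (fun p : Z => p.1.1) @^-1` [set t | 0 <= t] `&` G `|`
  (fun p : Z => p.1.1) @^-1` [set t | t <= 0] `&`
  [set p : Z | G (- p.1.1, p.2, p.1.2)]).
  apply: closedU; apply: closedI => //.
  - by apply: closed_preimage => //; exact: closed_ge.
  - by apply: closed_preimage => //; exact: closed_le.
  apply: (@closed_preimage Z _ (fun p : Z => (- p.1.1, p.2, p.1.2))) => //.
  apply: continuous_pair; last exact/continuous_sndP/continuous_fstP/continuous_id.
  apply: continuous_pair; last exact/continuous_sndP/continuous_id.
  by move=> p; apply: (continuous_comp (c3 p)); exact: opp_continuous.
apply/seteqP; split => [[[t q] q'] /= ->|[[t q] q'] /= [[t0 g]|[t0 g]]].
- have [t0|/ltW t0] := leP 0 t; [left|right]; split => //; first exact: GI.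
  have {2}-> : q = psi (- t) (psi t q) by rewrite -psiD addNr psi0.
  by apply: GI; rewrite oppr_ge0.
- exact: sound_G g.
- rewrite (sound_G _ g) ?oppr_ge0 // -psiD addrN psi0 //.
Qed.

Lemma hat_phi_flow : is_flow psi.
Proof. by split; [exact: hat_phi_continuous|exact: psi0|exact: psiD]. Qed.

End HatContinuity.

(** * Limit sets, attractors and the boundary *)

Section LimitSets.
Context {R : realType} {M : topologicalType} (psi : R -> M -> M).
Hypotheses (hpsi : is_flow psi).
Implicit Types (A C I : set M) (x y z : M).

Lemma omegaP x z : omega psi x z <->
  forall (s : R) (W : set M), nbhs z W -> exists2 t, s <= t & W (psi t x).
Proof.
split=> [H s W Wz|H s _ W Wz].
  have [_ [[_ -> [t /= st <-]] Wt]] := H s Logic.I W Wz.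
  by exists t => //; move: st; rewrite in_itv /= andbT.
have [t st Wt] := H s W Wz; exists (psi t x); split => //.
by exists x => //; exists t => //=; rewrite in_itv /= st.
Qed.

Lemma alphaP x z : alpha psi x z <->
  forall (s : R) (W : set M), nbhs z W -> exists2 t, t <= s & W (psi t x).
Proof.
split=> [H s W Wz|H s _ W Wz].
  have [_ [[t /= st <-] Wt]] := H s Logic.I W Wz.
  by exists t => //; move: st; rewrite in_itv.
have [t st Wt] := H s W Wz; exists (psi t x); split => //.
by exists t => //=; rewrite in_itv.
Qed.

Lemma omega_closed C s x : closed C -> (forall t, s <= t -> C (psi t x)) ->
  omega psi x `<=` C.
Proof.
move=> cC H z /omegaP Hz; apply: cC => W Wz; have [t st Wt] := Hz s W Wz.
by exists (psi t x); split => //; exact: H.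
Qed.

Lemma alpha_closed C s x : closed C -> (forall t, t <= s -> C (psi t x)) ->
  alpha psi x `<=` C.
Proof.
move=> cC H z /alphaP Hz; apply: cC => W Wz; have [t st Wt] := Hz s W Wz.
by exists (psi t x); split => //; exact: H.
Qed.

Lemma omega_shift t x : omega psi (psi t x) `<=` omega psi x.
Proof.
move=> z /omegaP H; apply/omegaP => s W Wz.
have [u su] := H (s - t) W Wz; rewrite (flowD hpsi) => Wu.
by exists (u + t) => //; rewrite -lerBlDr.
Qed.

Lemma alpha_shift t x : alpha psi (psi t x) `<=` alpha psi x.
Proof.
move=> z /alphaP H; apply/alphaP => s W Wz.
have [u su] := H (s - t) W Wz; rewrite (flowD hpsi) => Wu.
by exists (u + t) => //; rewrite -lerBrDr.
Qed.

Lemma omega_nonempty K s x : compact K -> (forall t, s <= t -> K (psi t x)) ->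
  omega psi x !=set0.
Proof.
move=> kK H; apply: contrapT => nex.
have cov z : K z -> \forall z' \near z & u \near pinfty_nbhs R, psi u x <> z'.
  move=> Kz; have : ~ omega psi x z by move=> oz; apply: nex; exists z.
  move=> /omegaP /existsNP [s' /existsNP [W /not_implyP [Wz nW]]].
  exists (W, [set u | s' <= u]) => /=.
    by split => //; apply: nbhs_pinfty_ge; rewrite num_real.
  by move=> [z' u] /= [Wz' su] E; apply: nW; exists u => //; rewrite E.
have su : \forall u \near pinfty_nbhs R, s <= u by apply: nbhs_pinfty_ge;
  rewrite num_real.
have [u [H1 {}su]] := filter_ex (filterI ((compact_near_coveringP _).1 kK R _ _ _
  cov) su).
exact: (H1 _ (H u su)).
Qed.

(** An orbit that accumulates at [A] enters the attracting neighbourhood once, and from then on its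
    limit points belong to the omega-limit set of that neighbourhood, which is [A]. *)
Lemma attractor_forward I A y : flow_invariant psi I -> attractor_in psi I A ->
  I y -> omega psi y `&` A !=set0 -> omega psi y `<=` A.
Proof.
move=> iI [U [UI [V [oV AV VU]] AE]] Iy [z [/omegaP oz Az]] w /omegaP ow.
have [t _ Vt] := oz 0 V (open_nbhs_nbhs (conj oV (AV _ Az))).
have Ut : U (psi t y) by apply: VU; split => //; exact: iI.
rewrite AE => s _ W Ww; have [u su Wu] := ow (s + t) W Ww.
exists (psi u y); split => //; exists (psi t y) => //; exists (u - t) => /=.
  by rewrite in_itv /= andbT lerBrDr.
by rewrite (flowD hpsi) subrK.
Qed.

(* Going backwards from y, the orbit would otherwise visit the attracting
   neighbourhood at arbitrarily negative times, so that y would lie in its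
   omega-limit set. *)
Lemma attractor_backward I A y z : flow_invariant psi I -> attractor_in psi I A ->
  I y -> ~ A y -> alpha psi y z -> omega psi z `&` A = set0.
Proof.
move=> iI [U [UI [V [oV AV VU]] AE]] Iy nAy /alphaP az.
apply: contrapT => /eqP/set0P [w [/omegaP ow Aw]]; apply: nAy.
have [t _ Vt] := ow 0 V (open_nbhs_nbhs (conj oV (AV _ Aw))).
rewrite AE => s _; apply: subset_closure.
have nz : nbhs z (psi t @^-1` V).
  apply: open_nbhs_nbhs; split => //; apply: open_comp => // x _.
  exact: continuous_time_map.
have [r rs Vr] := az (- s - t) _ nz.
exists (psi (t + r) y).
  by apply: VU; split; [rewrite -(flowD hpsi)|exact: iI].
exists (- (t + r)); last by rewrite (flowK hpsi).
by rewrite /= in_itv /= andbT; lra.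
Qed.

End LimitSets.

Section LimitSetsReverse.
Context {R : realType} {M : topologicalType} (psi : R -> M -> M).
Hypotheses (hpsi : is_flow psi).

Lemma alpha_nonempty (K : set M) s x : compact K ->
  (forall t, t <= s -> K (psi t x)) -> alpha psi x !=set0.
Proof.
move=> kK H; have [|z oz] := @omega_nonempty _ _ (fun t => psi (- t)) K (- s) x kK.
  by move=> t st; apply: H; rewrite lerNl.
exists z; apply/alphaP => u W Wz; have [t ut Wt] := (omegaP _ _ _).1 oz (- u) W Wz.
by exists (- t) => //; rewrite lerNl.
Qed.

End LimitSetsReverse.

(** * Closedness and invariance of the manifold boundary *)

Section ManifoldBoundary.
Context {R : realType} (X M : topologicalType) (psi : R -> M -> M).
Hypotheses (hpsi : is_flow psi).

Lemma closed_manifold_boundary : closed (manifold_boundary X M).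
Proof.
rewrite -openC openE => q /= nq;
  have [U [V [oU Uq oV h]]] : exists (U : set M) (V : set X),
     [/\ open U, U q, open V & homeomorphic (set_type U) (set_type V)].
  exact: contrapT.
apply: filterS (open_nbhs_nbhs (conj oU Uq)) => q' Uq' bq'.
by apply: bq'; exists U, V.
Qed.

(** [psi t] is a homeomorphism, so a chart around [psi t q] pulls back to a chart around [q]. *)
Lemma manifold_boundary_invariant : flow_invariant psi (manifold_boundary X M).
Proof.
move=> t q bq [U [V [oU Uq oV [f [g [cf cg fg gf]]]]]]; apply: bq.
have ct u : continuous (psi u) by exact: continuous_time_map.
exists (psi t @^-1` U), V; split => //; first by apply: open_comp.
pose U' := psi t @^-1` U.
pose k (p : set_type U') : set_type U :=
  exist _ (psi t (set_val p)) (mem_set (set_valP p)).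
have bk (p : set_type U) : U' (psi (- t) (set_val p)).
  by rewrite /U' /= (flowNK hpsi); exact: set_valP.
pose k' (p : set_type U) : set_type U' :=
  exist _ (psi (- t) (set_val p)) (mem_set (bk p)).
have ck : continuous k.
  apply: continuous_comp_initial => p.
  by apply: (continuous_comp (@set_val_continuous _ _ p)); exact: ct.
have ck' : continuous k'.
  apply: continuous_comp_initial => p.
  by apply: (continuous_comp (@set_val_continuous _ _ p)); exact: ct.
have kk : cancel k k' by move=> p; apply: val_inj => /=; rewrite (flowK hpsi).
have kk' : cancel k' k by move=> p; apply: val_inj => /=; rewrite (flowNK hpsi).
exists (f \o k), (k' \o g); split.
- by move=> p; apply: continuous_comp; [exact: ck|exact: cf].
- by move=> p; apply: continuous_comp; [exact: cg|exact: ck'].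
- by move=> p /=; rewrite fg kk.
- by move=> p /=; rewrite kk' gf.
Qed.

End ManifoldBoundary.

(** * Heteroclinic orbits *)

Section Heteroclinic.
Context {R : realType} {T : topologicalType} (phi : R -> T -> T) (B : set T)
  (rp rm : R -> T -> T) (bp bm : set T).
Hypotheses (hphi : is_flow phi) (hT : hausdorff_space T) (kB : compact B).
Local Notation Bp := (entrance_set phi B).
Local Notation Bm := (exit_set phi B).
Hypotheses (cBp : closed Bp) (cBm : closed Bm).
Hypotheses (hrp : retraction rp Bp bp) (hrm : retraction rm Bm bm).
Hypotheses (hip : retraction_inj rp Bp) (him : retraction_inj rm Bm).

Local Notation H := (hatH phi B rp rm).
Local Notation seg := (seg phi).
Local Notation coord := (@hat_coord R T phi B rp rm).
Local Notation psi := (hat_phi phi B rp rm).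

Let cB : closed B. Proof. exact: compact_closed. Qed.
Let hpsi : is_flow psi.
Proof. exact: (hat_phi_flow hphi hT kB cBp cBm hrp hrm hip him). Qed.
Let cH : compact [set: H]. Proof. exact: compact_hatH kB cBp cBm hrp hrm. Qed.
Let hH : hausdorff_space H. Proof. exact: hausdorff_hatH hT hrp hrm. Qed.

Lemma coord_hat_set (Q : set T) q : hat_set phi B rp rm Q q ->
  exists2 x, Q x & coord q = (0, x).
Proof. by move=> [x [Qx ->]]; exists (set_val x) => //; rewrite hat_coord_pi. Qed.

Lemma coord_hat_bm q : hat_bm phi B rp rm q -> (coord q).1 = 1.
Proof. by move=> [x [p [_ E ->]]]; rewrite hat_coord_pi /= E. Qed.

Lemma coord_hat_bp q : hat_bp phi B rp rm q -> (coord q).1 = -1.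
Proof. by move=> [x [p [_ E ->]]]; rewrite hat_coord_pi /= E. Qed.

Lemma hat_orbit_B t y x : B x -> coord y = (0,
  x) -> hat_orbit phi B rp rm t x (coord (psi t y)).
Proof. exact: (hat_phi_B0 hphi cB hrp hrm hip him). Qed.

Lemma hat_phi_stay t y x : B x -> coord y = (0, x) ->
  seg (Num.min 0 t) (Num.max 0 t) B x -> coord (psi t y) = (0, phi t x).
Proof.
move=> Bx y0 sB; apply: (hat_orbit_inj hphi hrp hrm (hat_orbit_B t Bx y0)).
exact: OrbB.
Qed.

Let height_closed (C : set R) : closed C -> closed [set q | C (coord q).1].
Proof.
move=> cC; apply: (@closed_preimage _ _ (fun q => (coord q).1)) => //.
exact/continuous_fstP/hat_coord_continuous.
Qed.

Let expN1 : expR (-1) < 1 :> R. Proof. by rewrite expR_lt1 ltrN10. Qed.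

(** Any positive delay after the exit bounds the height away from 0; the delay chosen is 1, whence
    the constant. *)
Lemma omega_exit r x y : B x -> coord y = (0, x) -> 0 <= r -> seg 0 r B x ->
  Bm (phi r x) -> omega psi y `<=` [set q | 1 - expR (-1) <= (coord q).1].
Proof.
move=> Bx y0 r0 sr Br; apply: (@omega_closed _ _ _ _ (r + 1)).
  exact: (height_closed (@closed_ge _ _)).
move=> t rt /=; have rt0 : 0 <= r <= t by rewrite r0; lra.
rewrite (hat_orbit_inj hphi hrp hrm (hat_orbit_B t Bx y0) (OrbM _ _ rt0 sr Br)) /=.
by rewrite lerD2l lerN2 ler_expR; lra.
Qed.

Lemma alpha_entrance r x y : B x -> coord y = (0, x) -> r <= 0 -> seg r 0 B x ->
  Bp (phi r x) -> alpha psi y `<=` [set q | (coord q).1 <= - (1 - expR (-1))].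
Proof.
move=> Bx y0 r0 sr Br; apply: (@alpha_closed _ _ _ _ (r - 1)).
  exact: (height_closed (@closed_le _ _)).
move=> t rt /=; have rt0 : t <= r <= 0 by rewrite r0 andbT; lra.
rewrite (hat_orbit_inj hphi hrp hrm (hat_orbit_B t Bx y0) (OrbP _ _ rt0 sr Br)) /=.
by rewrite lerN2 lerD2l lerN2 ler_expR; lra.
Qed.

(** Continuity of the inclusion of [B], phrased in coordinates, so that limit points under [phi]
    lift to limit points under the extended flow. *)
Let lift_point z : B z -> exists2 q, coord q = (0, z) &
  forall W : set H, nbhs q W -> exists2 V, nbhs z V &
    forall z' q', V z' -> B z' -> coord q' = (0, z') -> W q'.
Proof.
move=> Bz; pose j (b : set_type B) : H := \pi_H (in_B phi rp rm b).
have cj : continuous j.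
  move=> b; apply: continuous_comp; last exact: pi_continuous.
  exact: existT_continuous.
have cE b : coord (j b) = (0, set_val b) by rewrite hat_coord_pi.
pose b : set_type B := exist _ z (mem_set Bz).
exists (j b); first by rewrite cE.
move=> W Wj; have : nbhs b (j @^-1` W) by exact: cj.
move=> [_ [[V oV <-] Vb VW]]; exists V; first exact: open_nbhs_nbhs.
move=> z' q' Vz' Bz' q'E.
have -> : q' = j (exist _ z' (mem_set Bz')).
  by apply: (hat_coord_inj hrp hrm); rewrite q'E cE.
exact: VW.
Qed.

Lemma omega_stay x y : coord y = (0, x) -> (forall t, 0 <= t -> B (phi t x)) ->
  omega psi y `<=` [set q | (coord q).1 = 0] /\
  forall z, omega phi x z -> exists2 q, omega psi y q & coord q = (0, z).
Proof.
move=> y0 HB; have Bx : B x by rewrite -(flow0 hphi x); exact: HB.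
have yt t : 0 <= t -> coord (psi t y) = (0, phi t x).
  move=> t0; apply: hat_phi_stay => //; rewrite min_l // max_r //.
  by move=> u /andP[u0 _]; exact: HB.
split.
  apply: (@omega_closed _ _ _ _ 0); first exact: (height_closed (@closed_eq _ 0)).
  by move=> t t0 /=; rewrite yt.
move=> z oz; have Bz : B z by apply: (omega_closed cB HB).
have [q qE qW] := lift_point Bz; exists q => //; apply/omegaP => s W /qW [V Vz VW].
have [t] := (omegaP _ _ _).1 oz (Num.max 0 s) V Vz; rewrite ge_max => /andP[t0 st] Vt.
by exists t => //; apply: (VW (phi t x)) => //; [exact: HB|exact: yt].
Qed.

Lemma alpha_stay x y : coord y = (0, x) -> (forall t, t <= 0 -> B (phi t x)) ->
  alpha psi y `<=` [set q | (coord q).1 = 0] /\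
  forall z, alpha phi x z -> exists2 q, alpha psi y q & coord q = (0, z).
Proof.
move=> y0 HB; have Bx : B x by rewrite -(flow0 hphi x); exact: HB.
have yt t : t <= 0 -> coord (psi t y) = (0, phi t x).
  move=> t0; apply: hat_phi_stay => //; rewrite min_r // max_l //.
  by move=> u /andP[_ u0]; exact: HB.
split.
  apply: (@alpha_closed _ _ _ _ 0); first exact: (height_closed (@closed_eq _ 0)).
  by move=> t t0 /=; rewrite yt.
move=> z oz; have Bz : B z by apply: (alpha_closed cB HB).
have [q qE qW] := lift_point Bz; exists q => //; apply/alphaP => s W /qW [V Vz VW].
have [t] := (alphaP _ _ _).1 oz (Num.min 0 s) V Vz; rewrite le_min => /andP[t0 st] Vt.
by exists t => //; apply: (VW (phi t x)) => //; [exact: HB|exact: yt].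
Qed.

Lemma hat_phi_baseP q : `|(coord q).1| = 1 \/
  exists t x, B x /\ coord (psi t q) = (0, x).
Proof.
have [[t [x [Bx h]]]|] := hat_orbit_or_top hphi hrp hrm q; last by left.
right; exists (- t), x; split => //.
have := hat_orbit_flow hphi cB hrp hrm hip him (- t) Bx h; rewrite addNr => h'.
apply: (hat_orbit_inj hphi hrp hrm h'); rewrite -{2}(flow0 hphi x); apply: OrbB.
by rewrite min_l // max_l // => u; rewrite -eq_le => /eqP <-; rewrite (flow0 hphi).
Qed.

Variable S : set T.
Hypotheses (cS : closed S) (iS : flow_invariant phi S).
Hypothesis (hB : Defs.Inv phi B = dyn_complement phi S).

(** An orbit in the dynamical complement stays in the compact [B], so its omega-limit set is
    nonempty; starting in [S], that set would lie in [S]. *)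
Lemma dyn_complement_disjoint : dyn_complement phi S `&` S = set0.
Proof.
apply/seteqP; split => // x [cx Sx].
have Bx : forall t, 0 <= t -> B (phi t x).
  by move=> t _; apply: (InvP hphi B x).1; rewrite hB.
have [z oz] := omega_nonempty kB Bx.
have Sz : S z by apply: (omega_closed (s := 0) cS _ oz) => t _; exact: iS.
by case: cx => _ E; have : (omega phi x `&` S) z by []; rewrite E.
Qed.

Let leaves x r : ~ B x \/ Bm (phi r x) \/ Bp (phi r x) -> ~ dyn_complement phi S x.
Proof.
rewrite -hB => -[nB|[/exit_setP [_ h]|/entrance_setP [_ h]]] /(InvP hphi) HB.
- by apply: nB; rewrite -(flow0 hphi x).
- by apply: (h 1) => // t _; rewrite (flowD hphi).
- by apply: (h 1) => // t _; rewrite (flowD hphi).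
Qed.

Let alpha_nonempty_hat q : alpha psi q !=set0.
Proof. by apply: (@alpha_nonempty _ _ _ setT 0). Qed.

Let omega_nonempty_hat q : omega psi q !=set0.
Proof. by apply: (@omega_nonempty _ _ _ setT 0). Qed.

Let fixed_alpha q : `|(coord q).1| = 1 -> alpha psi q q.
Proof.
by move=> q1; apply/alphaP => s W Wq; exists s => //; rewrite hat_phi_top //;
  exact: nbhs_singleton.
Qed.

Let fixed_omega q : `|(coord q).1| = 1 -> omega psi q q.
Proof.
by move=> q1; apply/omegaP => s W Wq; exists s => //; rewrite hat_phi_top //;
  exact: nbhs_singleton.
Qed.

Lemma connection_to_S (Q : set T) (I : set H) :
  Q `<=` dyn_complement phi S ->
  attractor_repeller psi I (hat_bm phi B rp rm) (hat_set phi B rp rm Q) ->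
  (exists x, [/\ B x, alpha phi x `<=` Q & omega phi x `&` S !=set0]) \/
  I `<=` hat_set phi B rp rm Q `|` hat_bm phi B rp rm.
Proof.
move=> QS [kI iI AI attI QE].
have cI : closed I by exact: compact_closed.
have [|nc] := pselect (exists x, [/\ B x,
  alpha phi x `<=` Q & omega phi x `&` S !=set0]).
  by left.
right=> q Iq; have [qb|nqb] := pselect (hat_bm phi B rp rm q); first by right.
left; rewrite QE; split => //; apply: contrapT => /eqP/set0P [w [ow bw]].
have aQ : alpha psi q `<=` hat_set phi B rp rm Q.
  move=> z az; rewrite QE; split;
    last exact: (attractor_backward hpsi iI attI Iq nqb az).
  by apply: (alpha_closed (s := 0) cI _ az) => t _; exact: iI.
(* An end point of a collar is fixed, hence its own alpha-limit point, at height 1 or -1; but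
   alpha-limit points lie in [Q], at height 0. *)
have [top|[t [x [Bx yE]]]] := hat_phi_baseP q.
  have [z _ E] := coord_hat_set (aQ _ (fixed_alpha top)).
  by move/eqP: top; rewrite E normr0 eq_sym oner_eq0.
have {}aQ : alpha psi (psi t q) `<=` hat_set phi B rp rm Q.
  by move=> z /(alpha_shift hpsi) /aQ.
have {}ow : omega psi (psi t q) w.
  by apply: (omega_shift hpsi (t := - t)); rewrite (flowK hpsi).
move: yE aQ ow; set y := psi t q => yE aQ ow.
(* Leaving [B] backwards would put the alpha-limit points at negative height. *)
have ax : forall s, s <= 0 -> B (phi s x).
  case: (entrance_timeP hphi cB Bx) => // r r0 sr Br.
  have [z az] := alpha_nonempty_hat y; have [z' _ E] := coord_hat_set (aQ _ az).
  have := alpha_entrance Bx yE r0 sr Br az; rewrite /= E /= oppr_ge0 subr_le0.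
  by rewrite leNgt expN1.
have aQx : alpha phi x `<=` Q.
  move=> z /(alpha_stay yE ax).2 [q' /aQ /coord_hat_set [z' Qz' ->]] [<-] //.
(* An orbit that stays in [B] forwards has its limit points at height 0, whereas [w] has height 1;
   so the orbit leaves [B], and [x] is not in its invariant part. *)
have nx : ~ dyn_complement phi S x.
  case: (exit_timeP hphi cB Bx) => [ox|r r0 sr Br].
    have := (omega_stay yE ox).1 _ ow; rewrite /= (coord_hat_bm bw) => /eqP.
    by rewrite oner_eq0.
  by apply: (leaves (r := r)); right; left.
apply: nc; exists x; split => //; apply/set0P/eqP => E; apply: nx; split => //.
apply/seteqP; split => // z [/aQx /QS cz Sz].
by rewrite -dyn_complement_disjoint.
Qed.

Lemma connection_from_S (A : set T) (I : set H) :
  A `<=` dyn_complement phi S ->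
  attractor_repeller psi I (hat_set phi B rp rm A) (hat_bp phi B rp rm) ->
  (exists x, [/\ B x, omega phi x `<=` A & alpha phi x `&` S !=set0]) \/
  I `<=` hat_set phi B rp rm A `|` hat_bp phi B rp rm.
Proof.
move=> AS [kI iI AI attI bE].
have cI : closed I by exact: compact_closed.
have [|nc] := pselect (exists x, [/\ B x,
  omega phi x `<=` A & alpha phi x `&` S !=set0]).
  by left.
right=> q Iq; have [qA|nqA] := pselect (hat_set phi B rp rm A q); first by left.
right; rewrite bE; split => //; apply: contrapT => /eqP/set0P oA0.
(* The attractor is now the set in [B]: meeting it has to be improved to inclusion before heights
   can be compared. *)
have oA := attractor_forward hpsi iI attI Iq oA0.
have ab : alpha psi q `<=` hat_bp phi B rp rm.
  move=> z az; rewrite bE; split;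
    last exact: (attractor_backward hpsi iI attI Iq nqA az).
  by apply: (alpha_closed (s := 0) cI _ az) => t _; exact: iI.
have [top|[t [x [Bx yE]]]] := hat_phi_baseP q.
  exact/nqA/oA/fixed_omega.
have {}ab : alpha psi (psi t q) `<=` hat_bp phi B rp rm.
  by move=> z /(alpha_shift hpsi) /ab.
have {}oA : omega psi (psi t q) `<=` hat_set phi B rp rm A.
  by move=> z /(omega_shift hpsi) /oA.
move: yE ab oA; set y := psi t q => yE ab oA.
have ox : forall s, 0 <= s -> B (phi s x).
  case: (exit_timeP hphi cB Bx) => // r r0 sr Br.
  have [z oz] := omega_nonempty_hat y; have [z' _ E] := coord_hat_set (oA _ oz).
  have := omega_exit Bx yE r0 sr Br oz; rewrite /= E /= subr_le0.
  by rewrite leNgt expN1.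
have oAx : omega phi x `<=` A.
  move=> z /(omega_stay yE ox).2 [q' /oA /coord_hat_set [z' Az' ->]] [<-] //.
have nx : ~ dyn_complement phi S x.
  case: (entrance_timeP hphi cB Bx) => [ax|r r0 sr Br].
    have [z az] := alpha_nonempty_hat y.
    have := (alpha_stay yE ax).1 _ az; rewrite /= (coord_hat_bp (ab _ az)) => /eqP.
    by rewrite oppr_eq0 oner_eq0.
  by apply: (leaves (r := r)); right; right.
apply: nc; exists x; split => //; apply/set0P/eqP => E; apply: nx; split => //.
apply/seteqP; split => // z [/oAx /AS cz Sz].
by rewrite -dyn_complement_disjoint.
Qed.

Lemma hat_index_wedge (X : topologicalType) (I Q1 Q2 : set H) :
  I = Q1 `|` Q2 -> Q1 `&` Q2 = set0 ->
  ~ index_neq_wedge (manifold_boundary X H) psi I Q1 Q2.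
Proof.
move=> -> Q12 [N [N1 [K [K1 [L [L1 [pN pK pL]]]]]]]; apply.
apply: (index_wedge hpsi hH cH) pN pK pL => //.
- exact: closed_manifold_boundary.
- exact: manifold_boundary_invariant.
Qed.

End Heteroclinic.

Theorem theorem4p8 (R : realType) (X : normedModType R)
    (ip : {dot X for idfun}) (hX : euclidean_space ip)
    (phi : R -> hemi ip -> hemi ip) (hphi : poincare_flow phi)
    (S : set (hemi ip)) (hSE : S `<=` equator ip) (hSc : closed S)
    (hSi : flow_invariant phi S)
    (hScomp : isolated_invariant phi (dyn_complement phi S))
    (B : set (hemi ip)) (hB : isolating_block phi B (dyn_complement phi S))
    (rp rm : R -> hemi ip -> hemi ip) (bp bm : set (hemi ip))
    (hrp : retraction rp (entrance_set phi B) bp)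
    (hrm : retraction rm (exit_set phi B) bm)
    (hip : retraction_inj rp (entrance_set phi B))
    (him : retraction_inj rm (exit_set phi B)) :
  let Hhat := hatH phi B rp rm in
  let dHhat := manifold_boundary X Hhat in
  let phihat := hat_phi phi B rp rm in
  let emb := hat_set phi B rp rm in
  let hbm := hat_bm phi B rp rm in
  let hbp := hat_bp phi B rp rm in
  (forall (Q : set (hemi ip)) (I : set Hhat),
     Q `<=` dyn_complement phi S ->
     isolated_invariant phihat (emb Q) ->
     isolated_invariant phihat I ->
     emb Q `|` hbm `<=` I ->
     attractor_repeller phihat I hbm (emb Q) ->
     index_neq_wedge dHhat phihat I (emb Q) hbm ->
     exists x, [/\ B x, alpha phi x `<=` Q & omega phi x `&` S !=set0]) /\
  (forall (A : set (hemi ip)) (I : set Hhat),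
     A `<=` dyn_complement phi S ->
     isolated_invariant phihat (emb A) ->
     isolated_invariant phihat I ->
     emb A `|` hbp `<=` I ->
     attractor_repeller phihat I (emb A) hbp ->
     index_neq_wedge dHhat phihat I (emb A) hbp ->
     exists x, [/\ B x, omega phi x `<=` A & alpha phi x `&` S !=set0]).
Proof.
move=> Hhat dHhat phihat emb hbm hbp; have [fphi _] := hphi.
have [[kB _] BE _ cBm cBp] := hB.
have hT : hausdorff_space (hemi ip).
  apply: (@hausdorff_inj _ (X * R)%type set_val); last exact: val_inj.
    by apply: hausdorff_prod; exact: norm_hausdorff.
  exact: set_val_continuous.
split=> [Q I QS _ _ QI dec neq|A I AS _ _ AI dec neq].
  have [//|IQ] := connection_to_S fphi hT kB cBp cBm hrp hrm hip him hSc hSi BE QS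
    dec.
  exfalso; apply: (hat_index_wedge fphi hT kB cBp cBm hrp hrm hip him _ _ neq).
    by apply/seteqP.
  (* The repeller lies at height 0 and the attractor at height 1. *)
  apply/seteqP; split => // q [/coord_hat_set [x _ E] /coord_hat_bm].
  by rewrite E /= => /eqP; rewrite eq_sym oner_eq0.
have [//|IA] := connection_from_S fphi hT kB cBp cBm hrp hrm hip him hSc hSi BE AS
  dec.
exfalso; apply: (hat_index_wedge fphi hT kB cBp cBm hrp hrm hip him _ _ neq).
  by apply/seteqP.
apply/seteqP; split => // q [/coord_hat_set [x _ E] /coord_hat_bp].
by rewrite E /= => /eqP; rewrite eq_sym oppr_eq0 oner_eq0.
Qed.
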